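(* Fix $\alpha\in(0,1)$ and let $\nu$ be a diffusive probability measure on $E=[0,1]$ with support $E$. As $\theta\to\infty$, the family of the laws of $\Xi_{\theta,\alpha,\nu}$, $\theta>0$, satisfies a large deviation principle on the space $M_1(E)$ with speed $\theta$ and rate function \[ I^{\alpha}(\mu)=\sup_{f\ge 0,\ f\in C_b(E)}\Big\{\frac1\alpha\log\Big(\int_E (f(x))^{\alpha}\,\nu(dx)\Big)+1-\int_E f(x)\,\mu(dx)\Big\},\qquad \mu\in M_1(E). \]
   Context: $E=[0,1]$; $M_1(E)$ is the space of Borel probability measures on $E$ with the weak topology; $C_b(E)$ is the set of bounded continuous real functions on $E$; $\log 0=-\infty$. A probability measure $\nu$ on $E$ is diffusive if $\nu(\{x\})=0$ for every $x\in E$. For $\theta>0$ and $\alpha\in(0,1)$, let $U_1,U_2,\ldots$ be independent random variables such that $U_k$ has the $Beta(1-\alpha,\theta+k\alpha)$ distribution, and set $X_1^{\theta,\alpha}=U_1$, $X_n^{\theta,\alpha}=(1-U_1)\cdots(1-U_{n-1})U_n$ for $n\ge 2$; almost surely $\sum_k X_k^{\theta,\alpha}=1$. Let $(P_1(\theta,\alpha),P_2(\theta,\alpha),\ldots)$ denote the sequence $(X_1^{\theta,\alpha},X_2^{\theta,\alpha},\ldots)$ arranged in descending order (its law is the two-parameter Poisson-Dirichlet distribution $PD(\theta,\alpha)$). Let $\xi_1,\xi_2,\ldots$ be i.i.d. with common distribution $\nu$, independent of $(P_k(\theta,\alpha))_{k\ge1}$. The random probability measure \[ \Xi_{\theta,\alpha,\nu}=\sum_{k=1}^{\infty}P_k(\theta,\alpha)\,\delta_{\xi_k}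 \] has as its law the two-parameter Dirichlet process $Dirichlet(\theta,\alpha,\nu)$. A family of probability measures $\{Q_\theta:\theta>0\}$ on a topological space $\mathcal{X}$ satisfies a large deviation principle (as $\theta\to\infty$) with speed $\theta$ and rate function $I:\mathcal{X}\to[0,\infty]$ if $I$ is lower semicontinuous, $\limsup_{\theta\to\infty}\frac1\theta\log Q_\theta(F)\le-\inf_{x\in F}I(x)$ for every closed $F\subset\mathcal{X}$, and $\liminf_{\theta\to\infty}\frac1\theta\log Q_\theta(G)\ge-\inf_{x\in G}I(x)$ for every open $G\subset\mathcal{X}$. *)

(* Defs.v *)
From HB Require Import structures.
From mathcomp Require Import all_boot all_order all_algebra finmap.
From mathcomp Require Import all_classical all_reals all_analysis.

Set Implicit Arguments.
Unset Strict Implicit.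
Unset Printing Implicit Defensive.

Import Order.TTheory GRing.Theory Num.Theory.
Import numFieldTopology.Exports numFieldNormedType.Exports.

Local Open Scope classical_set_scope.
Local Open Scope ring_scope.

Definition borel (X : ptopologicalType) : measurableType _ :=
  g_sigma_algebraType (@open X).

Definition unit_interval (R : realType) : Type := set_type [set` `[0 : R, 1]].

HB.instance Definition _ (R : realType) :=
  PseudoMetric.copy (unit_interval R) (set_type [set` `[0 : R, 1]]).

Lemma unit_interval_subproof (R : realType) : (0 : R) \in [set` `[0 : R, 1]].
Proof. by rewrite inE /= in_itv /= lexx ler01. Qed.

HB.instance Definition _ (R : realType) :=
  isPointed.Build (unit_interval R) (exist _ (0 : R) (unit_interval_subproof R)).

Definition Cb (R : realType) (X : topologicalType) : set (X -> R) :=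
  [set f | continuous f /\ bounded_fun f].

Arguments Cb : clear implicits.

(* M1 R X carries the weak topology: the coarsest one for which
   mu |-> \int f dmu is continuous for every f in C_b(X), i.e. the initial
   topology of the map below into the product space R^(C_b(X)). *)
Definition M1 (R : realType) (X : ptopologicalType) : Type :=
  probability (borel X) R.

Definition M1_eval (R : realType) (X : ptopologicalType)
    (mu : probability (borel X) R) : prod_topology (fun _ : Cb R X => R) :=
  fun f => \int[mu]_x (set_val f x).

HB.instance Definition _ (R : realType) (X : ptopologicalType) :=
  Topological.copy (M1 R X) (initial_topology (@M1_eval R X)).

HB.instance Definition _ (R : realType) (X : ptopologicalType) :=
  isPointed.Build (M1 R X) (@dirac _ (borel X) point R : probability _ _).

Section measures_on_X.
Context {R : realType} {X : ptopologicalType}.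
Implicit Types nu : M1 R X.
Local Open Scope ereal_scope.

Definition diffusive nu := forall x : X, nu [set x] = 0.

Definition msupport nu : set X :=
  [set x | forall V : set X, open V -> V x -> 0 < nu V].

End measures_on_X.

Section independence.
Context {d d' d'' : measure_display} {R : realType} {T : measurableType d}.
Context {S : measurableType d'} {S' : measurableType d''}.
Variable P : probability T R.
Local Open Scope ereal_scope.

Definition mutually_independent (X : nat -> {RV P >-> S}) :=
  forall (J : {fset nat}) (A : nat -> set S), (forall j, measurable (A j)) ->
    P (\bigcap_(j in [set` J]) X j @^-1` A j) =
    \prod_(j <- J) P (X j @^-1` A j).

Definition sigma_of (d0 : measure_display) (S0 : measurableType d0)
    (X : nat -> {RV P >-> S0}) : set (set T) :=
  <<s \bigcup_k preimage_set_system setT (X k) measurable >>.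

Definition independent_sequences
    (X : nat -> {RV P >-> S}) (Y : nat -> {RV P >-> S'}) :=
  forall A B, sigma_of X A -> sigma_of Y B -> P (A `&` B) = P A * P B.

End independence.

Section beta.
Context {R : realType}.
Implicit Types a b : R.
Local Notation lebesgue := (@lebesgue_measure R).

Definition beta_weight a b (x : R) : R :=
  x `^ (a - 1) * (1 - x) `^ (b - 1).

Definition real_beta_fun a b : R :=
  \int[lebesgue]_(x in [set` `]0, 1[]) beta_weight a b x.

(* The library's beta_prob only has natural number parameters. *)
Definition real_beta_law a b (A : set R) : \bar R :=
  (\int[lebesgue]_(x in A `&` [set` `]0%R, 1%R[])
    (beta_weight a b x / real_beta_fun a b)%:E)%E.

End beta.

Definition stick_breaking (R : realType) (u : nat -> R) (n : nat) : R :=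
  (\prod_(i < n) (1 - u i)) * u n.

Definition descending_arrangement (R : realType) (x p : nat -> R) :=
  {homo p : m n / (m <= n)%N >-> n <= m} /\
  exists s : nat -> nat, bijective s /\ forall n, p n = x (s n).

(* Q is the law of sum_k p_k delta_(xi_k). Sequences are indexed from 0, so
   U k, p k and xi k stand for the usual U_(k+1), P_(k+1) and xi_(k+1). The
   descending arrangement exists, and the sum is a probability measure, only
   almost surely: p and Xi are arbitrary on the exceptional null set. *)
Definition dirichlet_process_law (R : realType) (X : ptopologicalType)
    (theta alpha : R) (nu : M1 R X) (Q : probability (borel (M1 R X)) R) : Prop :=
  exists (d : measure_display) (Omega : measurableType d)
    (P : probability Omega R) (U p : nat -> {RV P >-> R})
    (xi : nat -> {RV P >-> borel X}) (Xi : {RV P >-> borel (M1 R X)}),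
  (mutually_independent U /\
    forall k A, measurable A ->
      distribution P (U k) A =
      real_beta_law (1 - alpha) (theta + k.+1%:R * alpha) A) /\
  {ae P, forall w, descending_arrangement
                     (stick_breaking (fun k => U k w)) (fun k => p k w)} /\
  (mutually_independent xi /\
    forall k A, measurable A -> distribution P (xi k) A = nu A) /\
  independent_sequences xi p /\
  {ae P, forall w, forall A : set (borel X), measurable A ->
    (Xi w : M1 R X) A =
    (\sum_(0 <= k <oo) ((p k w)%:E * \d_(xi k w) A))%E} /\
  forall A, measurable A -> Q A = distribution P Xi A.

Section large_deviations.
Context {R : realType} {X : ptopologicalType}.
Local Open Scope ereal_scope.

(* Only the members of the family with theta > 0 matter. lne 0 = -oo. *)
Definition log_rate (Q : R -> probability (borel X) R) (A : set X) (theta : R)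
    : \bar R := (theta^-1)%:E * lne (Q theta A).

Definition LDP (Q : R -> probability (borel X) R) (I : X -> \bar R) : Prop :=
  [/\ forall x, 0 <= I x,
      lower_semicontinuous I,
      forall F : set X, closed F ->
        limf_esup (log_rate Q F) (pinfty_nbhs R) <= - ereal_inf (I @` F) &
      forall G : set X, open G ->
        - ereal_inf (I @` G) <= limf_einf (log_rate Q G) (pinfty_nbhs R)].

Definition rate_function (alpha : R) (nu mu : M1 R X) : \bar R :=
  ereal_sup
    [set (alpha^-1)%:E * lne (\int[nu]_x (f x `^ alpha)%:E)
         + 1 - \int[mu]_x (f x)%:E
    | f in [set f : X -> R | Cb R X f /\ forall x, (0 <= f x)%R]].

End large_deviations.

(* Main.v *)
From HB Require Import structures.
Require Import Defs.
From mathcomp Require Import all_boot all_order all_algebra finmap.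
From mathcomp Require Import all_classical all_reals all_analysis measurable_realfun.
From mathcomp Require Import ring lra.

Set Implicit Arguments.
Unset Strict Implicit.
Unset Printing Implicit Defensive.

Import Order.TTheory GRing.Theory Num.Theory.
Import numFieldTopology.Exports numFieldNormedType.Exports.

Local Open Scope classical_set_scope.
Local Open Scope ring_scope.

(** Everything rests on the Markov--Krein identity: for a continuous [f] with
    values in a compact part of the positive reals, the random measure [Xi] of
    law [Q theta] satisfies
      E (\int f dXi)^(-theta) = (\int f^alpha dnu)^(-theta / alpha)
    ([dirichlet_markov_krein]). It makes the exponential tilting of [Q theta] by
    [(\int f dmu)^(-theta)] explicit, and a large deviation principle follows
    by the usual change of measure.

    The identity. Adding a real [t >= 0] to [f], let [m theta t] be the left-hand
    side. Writing [x^(-theta)] as the integral of [theta s^(-(theta+1))] over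
    [s >= x] raises the exponent to [theta + 1], which is the sum of the
    parameters of the first beta variable [U_1]; by the beta integral
    [E (U x + (1 - U) y)^(-(p+q)) = x^(-p) y^(-q)] the first atom then separates
    from the rest of the sticks, which has the same structure with [theta]
    replaced by [theta + alpha]. So [m] solves the recursion
      m theta t = \int_t^oo theta L(s) m (theta + alpha) s ds,
    where [L s = \int (f + s)^(alpha-1) dnu], and the right-hand side of the
    identity solves it too, by differentiation. For sticks truncated after [k]
    breaks the two solutions differ, after [k] iterations, by an error that tends
    to [0] with [k] because the harmonic series diverges
    ([markov_krein_truncated]). The weights of [Xi] are the sticks in descending
    order; they are independent of the i.i.d. atoms, so that reordering them does
    not change the law of the average ([iid_sum_permuted],
    [markov_krein_weighted_sum]).

    The upper bound. If [I mu > c], some test function [f] has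
    [alpha^-1 ln (\int f^alpha dnu) + 1 - \int f dmu > c]; Markov's inequality for
    [(\int f dXi)^(-theta)] and [ln z <= z - 1] bound the probability of the open
    half-space [\int f dm < z], for a suitable [z], by [exp (- theta c)]
    ([half_space_bound]). Since [M_1(E)] is compact ([compact_M1]), finitely many
    such half-spaces cover a closed set on which the rate exceeds [c].

    The lower bound. Under the tilting by [f], the random measure concentrates at
    the measure proportional to [f^(alpha-1) nu]: if [\int g f^(alpha-1) dnu = 0],
    moving [f] to [f + e g] changes [\int f^alpha dnu] to second order only, hence
    the event [\int g dXi <= - d] has an exponentially small tilted mass
    ([tilted_tail]). The tilted mass of a neighbourhood is thus almost the total
    mass, while the tilting density is nearly constant there; this gives the
    lower bound [- (1/alpha - 1) ln (\int h^(-alpha/(1-alpha)) dnu)] at [h nu], for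
    a positive continuous density [h] ([tilted_lower_bound] with
    [f = h^(-1/(1-alpha))]). Finally every [mu] of finite rate is approximated by
    such measures without raising the rate: on a partition of unity by tents,
    mixing the ratios of the masses given by [mu] and [nu] yields a density whose
    cost is at most [I mu], by Jensen's inequality ([discretized_rate_le],
    [density_approximation]). *)

(** * Independence and iterated integrals *)

Section independent_pair.
Context {d d1 d2 : measure_display} {R : realType} {T : measurableType d}.
Context {T1 : measurableType d1} {T2 : measurableType d2}.
Variable P : probability T R.
Local Open Scope ereal_scope.

(** The joint law is the product of the marginal laws, to which Tonelli's theorem
    applies. *)
Lemma integral_indep_pair (X : {mfun T >-> T1}) (Y : {mfun T >-> T2})
    (F : T1 * T2 -> \bar R) :
  (forall A B, measurable A -> measurable B ->
    P ((X @^-1` A) `&` (Y @^-1` B)) = P (X @^-1` A) * P (Y @^-1` B)) ->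
  measurable_fun setT F -> (forall z, 0 <= F z) ->
  \int[P]_w F (X w, Y w) = \int[P]_w \int[P]_w' F (X w, Y w').
Proof.
move=> XY mF F0.
pose Z : T -> T1 * T2 := fun w => (X w, Y w).
have mZ : measurable_fun setT Z.
  by apply/measurable_fun_pairP; split; exact: measurable_funPT.
pose Zm : {mfun T >-> (T1 * T2)%type} := mfun_Sub (mem_set mZ).
have -> : \int[P]_w F (X w, Y w) = \int[distribution P Zm]_z F z.
  by rewrite ge0_integral_distribution.
have -> : \int[distribution P Zm]_z F z =
    \int[(distribution P X \x distribution P Y)]_z F z.
  apply: eq_measure_integral => A mA _; apply/esym.
  apply: (@product_measure_unique _ _ _ _ _ (distribution P X)
    (distribution P Y) (distribution P Zm)) => // B C mB mC; exact: XY.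
rewrite fubini_tonelli1//.
rewrite (@ge0_integral_distribution _ _ _ _ _ P X); last 2 first.
- exact: measurable_fun_fubini_tonelli_F.
- by move=> x; apply: integral_ge0.
apply: eq_integral => w _ /=.
rewrite /fubini_F (@ge0_integral_distribution _ _ _ _ _ P Y)//.
exact: measurableT_comp.
Qed.

End independent_pair.

Section independence_of_rest.
Context {d d' : measure_display} {R : realType} {T : measurableType d}.
Context {S : measurableType d'}.
Variable P : probability T R.
Variable X : nat -> {RV P >-> S}.
Local Open Scope ereal_scope.

(** A generating system rather than the sigma-algebra it spans, so that it can
    index [g_sigma_algebraType] and make coordinates measurable for it. *)
Definition generators_of (D : set nat) : set (set T) :=
  \bigcup_(j in D) preimage_set_system setT (X j) measurable.

Lemma generators_ofS D : generators_of D `<=` measurable.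
Proof.
move=> _ [j _ [B mB <-]]; rewrite setTI.
exact: measurable_funPTI.
Qed.

Lemma sub_sigma_of D A : <<s generators_of D >> A -> measurable A.
Proof.
move: A; apply: smallest_sub; first exact: sigma_algebra_measurable.
exact: generators_ofS.
Qed.

Lemma measurable_fun_generators_of D j : D j ->
  measurable_fun (setT : set (g_sigma_algebraType (generators_of D))) (X j).
Proof.
move=> Dj _ B mB; apply: sub_sigma_algebra.
by exists j => //; exists B.
Qed.

(** The events that constrain finitely many coordinates other than [k] form a
    pi-system generating the left factor, and on it both sides, which are finite
    measures in [A], agree by mutual independence. *)
Lemma independent_of_rest k A B : mutually_independent X ->
  <<s generators_of [set~ k] >> A -> measurable B ->
  P (A `&` (X k @^-1` B)) = P A * P (X k @^-1` B).
Proof.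
move=> indX sA mB.
pose G : set (set T) := [set A | exists (J : {fset nat}) (C : nat -> set S),
  [/\ k \notin J, forall j, measurable (C j) &
      A = \bigcap_(j in [set` J]) X j @^-1` C j]].
have mXB : measurable (X k @^-1` B) by exact: measurable_funPTI.
have Gm : G `<=` measurable.
  move=> _ [J [C [_ mC ->]]]; apply: fin_bigcap_measurable.
    exact: finite_fset.
  by move=> j _; exact: measurable_funPTI.
have GT : G setT.
  by exists fset0, (fun=> setT); split => //; rewrite set_fset0 bigcap_set0.
have GI : setI_closed G.
  move=> _ _ [J [C [kJ mC ->]]] [J' [C' [kJ' mC' ->]]].
  pose D j := (if j \in J then C j else setT) `&` (if j \in J' then C' j else setT).
  exists (J `|` J')%fset, D; split.
  - by rewrite inE negb_or kJ.
  - by move=> j; apply: measurableI; case: ifP.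
  - apply/seteqP; split => [w [h h'] j /=|w h].
      rewrite inE => _; split.
        by case: ifP => // jJ; exact: (h j).
      by case: ifP => // jJ; exact: (h' j).
    split => j /= jJ.
      by have := h j; rewrite /D /= !inE jJ/= => /(_ isT)[].
    by have := h j; rewrite /D /= !inE jJ/= orbT => /(_ isT)[].
pose c : {nonneg R} := NngNum (fine_ge0 (measure_ge0 P (X k @^-1` B))).
have cE : c%:num%:E = P (X k @^-1` B) by rewrite /= fineK// fin_num_measure.
suff : mrestr P mXB A = mscale c P A.
  by rewrite /mrestr /mscale/= => ->; rewrite fineK ?fin_num_measure// muleC.
apply: (g_sigma_algebra_measure_unique G Gm (fun=> setT)) => //.
- by apply: bigcup_const; exists 0%N.
- move=> _ [J [C [kJ mC ->]]].
  rewrite /mrestr /mscale /=.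
  pose D j := if j == k then B else C j.
  have mD j : measurable (D j) by rewrite /D; case: ifP.
  have := indX (k |` J)%fset D mD.
  rewrite set_fsetU1 bigcap_setU1 big_fsetU1//=.
  have -> : D k = B by rewrite /D eqxx.
  have -> : \bigcap_(j in [set` J]) X j @^-1` D j = \bigcap_(j in [set` J]) X j @^-1` C j.
    apply: eq_bigcapr => j /= jJ; rewrite /D.
    by case: eqP => // jk; rewrite -jk jJ in kJ.
  rewrite setIC => E; transitivity (c%:num%:E * P (\bigcap_(j in [set` J]) X j @^-1` C j)) => //.
  rewrite [LHS]E cE {E}; congr (_ * _).
  have := indX J C mC => ->.
  apply: eq_fbigr => j jJ _; rewrite /D.
  by case: eqP => // jk; rewrite -jk jJ in kJ.
- move=> _; apply: (@le_lt_trans _ _ (P (setT `&` (X k @^-1` B)))) => //.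
  by rewrite setTI (le_lt_trans (probability_le1 _ _)) ?ltry.
- move: A sA; apply: sub_smallest2r; first exact: smallest_sigma_algebra.
  move=> _ [j jk [C mC <-]]; rewrite setTI.
  exists [fset j]%fset, (fun=> C); split => //.
    by rewrite inE eq_sym; apply/eqP.
  by rewrite set_fset1 bigcap_set1.
Qed.

(** The identity, viewed as a map to the space equipped with the sigma-algebra of
    all the other coordinates, is independent of [X k]. *)
Lemma integral_peel k (F : g_sigma_algebraType (generators_of [set~ k]) * S -> \bar R) :
  mutually_independent X -> measurable_fun setT F -> (forall z, 0 <= F z) ->
  \int[P]_w F (w, X k w) = \int[P]_w \int[P]_w' F (w, X k w').
Proof.
move=> indX mF F0.
pose I : T -> g_sigma_algebraType (generators_of [set~ k]) := id.
have mI : measurable_fun setT I.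
  by move=> _ A sA; rewrite setTI; exact: (sub_sigma_of sA).
pose Im : {mfun T >-> g_sigma_algebraType (generators_of [set~ k])} :=
  mfun_Sub (mem_set mI).
apply: (integral_indep_pair (X := Im) (Y := X k)) => // A B mA mB.
exact: independent_of_rest.
Qed.

End independence_of_rest.

(** * Projective invariance of the beta weight *)

Section beta_substitution.
Context {R : realType}.
Variables (a b x y : R).
Hypotheses (x0 : 0 < x) (y0 : 0 < y).
Local Notation mu := (@lebesgue_measure R).

Let D (u : R) := u * x + (1 - u) * y.
Let G (u : R) : R := u * x / D u.
Let G' (u : R) : R := x * y / (D u * D u).

Let D_gt0 (u : R) : 0 <= u <= 1 -> 0 < D u.
Proof.
move=> /andP[u0 u1]; rewrite /D.
have [->|u1'] := eqVneq u 1; first by rewrite mul1r subrr mul0r addr0.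
have : u < 1 by rewrite lt_neqAle u1'.
rewrite -subr_gt0 => u1''; apply: ltr_wpDl; last exact: mulr_gt0.
by rewrite mulr_ge0// ltW.
Qed.

Let onemG (u : R) : 0 <= u <= 1 -> 1 - G u = (1 - u) * y / D u.
Proof.
move=> u01; have := D_gt0 u01; rewrite /G => /lt0r_neq0 D0.
by apply: (mulIf D0); rewrite mulrBl !divfK// mul1r /D; ring.
Qed.

Let derG (u : R) : 0 <= u <= 1 -> is_derive u 1 G (G' u).
Proof.
move=> u01; have D0 : D u != 0 by rewrite gt_eqF// D_gt0.
have dD : is_derive u 1 D (x - y).
  rewrite /D; apply: is_derive_eq; rewrite /GRing.scale/=; ring.
have dV := is_deriveV D0 dD.
have dX : is_derive u 1 (fun u : R => u * x) x.
  by apply: is_derive_eq; rewrite /GRing.scale/=; ring.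
have dG := is_deriveM dX dV.
apply: (is_derive_eq dG).
by rewrite /GRing.scale/= /G'; rewrite /D in D0 *; field.
Qed.

Let cvgG' (u : R) : 0 < u < 1 -> (G^`())%classic v @[v --> u] --> G' u.
Proof.
move=> /andP[u0 u1].
have D0 : D u != 0 by rewrite gt_eqF// D_gt0// !ltW.
apply: (@cvg_trans _ (G' v @[v --> u])).
  apply: near_eq_cvg; near=> v.
  have v01 : 0 <= v <= 1.
    by apply/andP; split; apply/ltW; near: v; [exact: lt_nbhsr|exact: lt_nbhsl].
  by have dv := derG v01; rewrite derive1E derive_val.
have cD : D v @[v --> u] --> D u.
  apply: cvgD; apply: cvgM; [exact: cvg_id|exact: cvg_cst| |exact: cvg_cst].
  by apply: cvgB; [exact: cvg_cst|exact: cvg_id].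
have D2 : D u * D u != 0 by rewrite mulf_neq0.
exact: (cvgM (cvg_cst (x * y)) (cvgV D2 (cvgM cD cD))).
Unshelve. all: by end_near. Qed.

Let G_incr : {in `[0, 1] &, {homo G : u v / u < v}}.
Proof.
move=> u v; rewrite !in_itv/= => u01 v01 uv.
rewrite /G ltr_pdivrMr ?D_gt0// mulrAC ltr_pdivlMr ?D_gt0// -subr_gt0.
have -> : v * x * D u - u * x * D v = x * y * (v - u) by rewrite /D; ring.
by rewrite !mulr_gt0 ?subr_gt0.
Qed.

Let weight_comp (u : R) : 0 < u < 1 ->
  beta_weight a b (G u) * G' u =
  x `^ a * y `^ b * (beta_weight a b u * D u `^ (- (a + b))).
Proof.
move=> /andP[u0 u1]; have u01 : 0 <= u <= 1 by rewrite !ltW.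
have D0 := D_gt0 u01.
have V0 : 0 <= (D u)^-1 by rewrite invr_ge0 ltW.
rewrite /beta_weight onemG// /G.
have u1' : 0 <= 1 - u by rewrite subr_ge0 ltW.
rewrite !powRM ?mulr_ge0 ?(ltW u0) ?(ltW x0) ?(ltW y0)//.
have xE : x `^ a = x `^ (a - 1) * x.
  by rewrite -{3}(powRr1 (ltW x0)) -powRD ?subrK// (gt_eqF x0) implybT.
have yE : y `^ b = y `^ (b - 1) * y.
  by rewrite -{3}(powRr1 (ltW y0)) -powRD ?subrK// (gt_eqF y0) implybT.
have DE : D u `^ (- (a + b)) =
    (D u)^-1 `^ (a - 1) * (D u)^-1 `^ (b - 1) * (D u * D u)^-1.
  rewrite -powR_inv1 ?(ltW D0)// -!powRrM -expr2 -[X in (X)^-1]powR_mulrn ?(ltW D0)//.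
  by rewrite -powRN -!powRD ?(gt_eqF D0) ?implybT//; congr (_ `^ _); ring.
rewrite xE yE DE /G'; ring.
Qed.

Let continuous_weight (u v : R) : 0 < u -> v < 1 ->
  {within `[u, v], continuous (beta_weight a b)}.
Proof.
move=> u0 v1; apply: derivable_within_continuous => w.
rewrite in_itv/= => /andP[uw wv].
have w0 : 0 < w by exact: lt_le_trans uw.
have w1 : 0 < 1 - w by rewrite subr_gt0 (le_lt_trans wv).
have d1 := is_derive1_powR (a - 1) w0.
have d2 := is_derive1_powR (b - 1) w1.
have d3 : is_derive w 1 (fun z : R => 1 - z) (-1).
  by apply: is_derive_eq; ring.
have d4 := @is_derive1_comp _ (fun z : R => z `^ (b - 1)) (fun z : R => 1 - z) _ _ _ d2 d3.
have d5 := is_deriveM d1 d4.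
by apply: ex_derive.
Qed.

Let beta_weight_ge0 (u : R) : 0 <= beta_weight a b u.
Proof. by rewrite mulr_ge0 ?powR_ge0. Qed.

Let measurable_weight E : measurable_fun E (beta_weight a b).
Proof.
apply: measurable_funTS; apply: measurable_funM => /=.
  exact: measurable_powR.
have m1 : measurable_fun [set: R] (fun z : R => 1 - z) by exact: measurable_funB.
exact: (measurableT_comp (measurable_powR (b - 1)) m1).
Qed.


Let mD : measurable_fun setT D.
Proof.
apply: measurable_funD; apply: measurable_funM => //.
exact: measurable_funB.
Qed.

(** The weight may blow up at both ends of the unit interval, so the change of
    variables is made on compact slices first. *)
Let slice (e : R) : 0 < e < 1 / 2 ->
  (\int[mu]_(u in [set` `[e, (1 - e)%R]]) (beta_weight a b u * D u `^ (- (a + b)))%:E =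
   (x `^ (- a) * y `^ (- b))%:E *
     \int[mu]_(u in [set` `[G e, G (1 - e)%R]]) (beta_weight a b u)%:E)%E.
Proof.
move=> /andP[e0 e2].
have e1 : e < 1 - e by lra.
have i01 u : u \in `[e, 1 - e] -> 0 < u < 1 by rewrite in_itv/= => ?; lra.
have i01' (u : R) : u \in `]e, 1 - e[ -> 0 < u < 1 by rewrite in_itv/= => ?; lra.
have G01 (u : R) : 0 < u < 1 -> 0 < G u < 1.
  move=> u01; have u01' : 0 <= u <= 1 by lra.
  rewrite -[G u < 1]subr_gt0 onemG// /G !divr_gt0 ?mulr_gt0 ?D_gt0//; lra.
have dGo (u : R) : 0 < u < 1 -> is_derive u 1 G (G' u).
  by move=> u01; apply: derG; lra.
have ei : 0 < e < 1 by lra.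
have fi : 0 < 1 - e < 1 by lra.
have cGo (u : R) : 0 < u < 1 -> G v @[v --> u] --> G u.
  move=> u01; apply/differentiable_continuous/derivable1_diffP.
  by case: (dGo _ u01).
rewrite (@integration_by_substitution_increasing _ G (beta_weight a b) e (1 - e)).
- have mB E : measurable_fun E (EFin \o (fun u => beta_weight a b u * D u `^ (- (a + b)))).
    apply/measurable_EFinP; apply: measurable_funM => //.
    by apply: measurable_funTS; exact: (measurableT_comp (measurable_powR _) mD).
  have -> : (\int[mu]_(u in [set` `[e, (1 - e)%R]])
      (((beta_weight a b \o G) * (G^`())%classic) u)%:E =
     \int[mu]_(u in [set` `[e, (1 - e)%R]]) ((x `^ a * y `^ b)%:E *
      (beta_weight a b u * D u `^ (- (a + b)))%:E))%E.
    apply: eq_integral => u; rewrite inE/= => /i01 u01; rewrite -EFinM; congr EFin.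
    rewrite -weight_comp//; congr (_ * _).
    by have dv := dGo _ u01; rewrite derive1E derive_val.
  rewrite ge0_integralZl//; last 2 first.
  + by move=> u _; rewrite lee_fin mulr_ge0 ?powR_ge0.
  + by rewrite lee_fin mulr_ge0 ?powR_ge0.
  rewrite muleA -EFinM !powRN mulrACA !mulVf ?mulr1 ?mul1e//.
  + by rewrite gt_eqF// powR_gt0.
  + by rewrite gt_eqF// powR_gt0.
  + exact: mB.
- exact: ltW.
- by move=> u v /i01 ? /i01 ?; apply: G_incr; rewrite in_itv/=; lra.
- move=> u /i01' u01; rewrite /continuous_at.
  have -> : (G^`())%classic u = G' u.
    by have dv := dGo _ u01; rewrite derive1E derive_val.
  exact: cvgG'.
- by apply/cvg_ex; exists (G' e); apply: cvg_at_right_filter; exact: cvgG'.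
- by apply/cvg_ex; exists (G' (1 - e)); apply: cvg_at_left_filter; exact: cvgG'.
- split.
  + by move=> u /i01' u01; case: (dGo _ u01).
  + by apply: cvg_at_right_filter; exact: cGo.
  + by apply: cvg_at_left_filter; exact: cGo.
- by apply: continuous_weight; [have := G01 _ ei|have := G01 _ fi] => /andP[].
Qed.

Let e (n : nat) : R := n.+3%:R^-1.

Let e_gt0 n : 0 < e n < 1 / 2.
Proof.
by rewrite invr_gt0 ltr0n/= div1r ltf_pV2 ?posrE ?ltr0n// ltr_nat.
Qed.

Let e_le m n : (m <= n)%N -> e n <= e m.
Proof. by move=> mn; rewrite lef_pV2 ?posrE ?ltr0n// ler_nat !ltnS. Qed.

Let e_small (u : R) : 0 < u -> exists n, e n <= u.
Proof.
move=> u0; exists (Num.truncn u^-1); apply/ltW.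
rewrite -[ltRHS]invrK ltf_pV2 ?posrE ?ltr0n ?invr_gt0//.
apply: (lt_le_trans (truncnS_gt _)).
by rewrite ler_nat ltnS !leqW.
Qed.

Let G01 (u : R) : 0 < u < 1 -> 0 < G u < 1.
Proof.
move=> u01; have u01' : 0 <= u <= 1 by lra.
rewrite -[G u < 1]subr_gt0 onemG// /G !divr_gt0 ?mulr_gt0 ?D_gt0//; lra.
Qed.

Let bigcup_e : \bigcup_n [set` `[e n, 1 - e n]] = [set` `]0%R, 1%R[].
Proof.
apply/seteqP; split => [u [n _]|u]; rewrite /= !in_itv/=.
  by have := e_gt0 n; lra.
move=> /andP[u0 u1].
have [n nu] := e_small u0.
have u1' : 0 < 1 - u by lra.
have [m mu] := e_small u1'.
exists (maxn n m) => //; rewrite /= in_itv/=.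
have := e_le (leq_maxl n m); have := e_le (leq_maxr n m); lra.
Qed.

Let G_le (u v : R) : 0 <= u <= 1 -> 0 <= v <= 1 -> u <= v -> G u <= G v.
Proof.
move=> u01 v01; rewrite le_eqVlt => /predU1P[->//|uv].
by apply/ltW/G_incr => //; rewrite in_itv.
Qed.

Let bigcup_Ge : \bigcup_n [set` `[G (e n), G (1 - e n)]] = [set` `]0%R, 1%R[].
Proof.
apply/seteqP; split => [u [n _]|v]; rewrite /= !in_itv/=.
  have en : 0 < e n < 1 by have := e_gt0 n; lra.
  have fn : 0 < 1 - e n < 1 by have := e_gt0 n; lra.
  by have := G01 en; have := G01 fn; lra.
move=> /andP[v0 v1].
have v1' : 0 < 1 - v by lra.
pose E := v * y + (1 - v) * x.
have E0 : 0 < E by rewrite addr_gt0// mulr_gt0.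
pose u := v * y / E.
have u0 : 0 < u by rewrite divr_gt0 ?mulr_gt0.
have u1E : 1 - u = (1 - v) * x / E.
  by rewrite /u /E; rewrite /E in E0; field; rewrite gt_eqF.
have u1 : 0 < 1 - u by rewrite u1E divr_gt0 ?mulr_gt0.
have Du : D u = x * y / E.
  by rewrite /D u1E /u /E; rewrite /E in E0; field; rewrite gt_eqF.
have Gu : G u = v.
  rewrite /G Du /u; field; rewrite !gt_eqF//.
have : [set` `]0%R, 1%R[] u by rewrite /= in_itv/=; lra.
rewrite -bigcup_e => -[n _ /=]; rewrite in_itv/= => /andP[nu un].
have := e_gt0 n => en.
exists n => //=; rewrite in_itv/= -Gu; apply/andP; split; apply: G_le; lra.
Qed.

(** The substitution [v = u x / (u x + (1 - u) y)], which maps the unit interval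
    to itself, absorbs the factor [(u x + (1 - u) y)^-(a+b)] into the weight. *)
Lemma beta_weight_projective :
  (\int[mu]_(u in [set` `]0%R, 1%R[])
      (beta_weight a b u * (u * x + (1 - u) * y) `^ (- (a + b)))%:E =
   (x `^ (- a) * y `^ (- b))%:E *
     \int[mu]_(u in [set` `]0%R, 1%R[]) (beta_weight a b u)%:E)%E.
Proof.
have mB E : measurable_fun E (EFin \o (fun u => beta_weight a b u * D u `^ (- (a + b)))).
  apply/measurable_EFinP; apply: measurable_funM => //.
  by apply: measurable_funTS; exact: (measurableT_comp (measurable_powR _) mD).
have mW E : measurable_fun E (EFin \o beta_weight a b) by exact/measurable_EFinP.
have Wcvg : (\int[mu]_(u in [set` `[G (e n), G (1 - e n)%R]]) (beta_weight a b u)%:E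
    @[n --> \oo] --> \int[mu]_(u in [set` `]0%R, 1%R[]) (beta_weight a b u)%:E)%E.
  rewrite -bigcup_Ge; apply: ge0_nondecreasing_set_cvg_integral => //.
  - move=> m n mn; apply/subsetPset => u /=; rewrite !in_itv/=.
    have := e_le mn; have := e_gt0 m; have := e_gt0 n => en em enm.
    have h1 : G (e n) <= G (e m) by apply: G_le; lra.
    have h2 : G (1 - e m) <= G (1 - e n) by apply: G_le; lra.
    lra.
  - by move=> n; exact: mW.
  - by move=> n u _; rewrite lee_fin.
have Lcvg : (\int[mu]_(u in [set` `[e n, (1 - e n)%R]])
      (beta_weight a b u * D u `^ (- (a + b)))%:E
    @[n --> \oo] --> \int[mu]_(u in [set` `]0%R, 1%R[])
      (beta_weight a b u * D u `^ (- (a + b)))%:E)%E.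
  rewrite -bigcup_e; apply: ge0_nondecreasing_set_cvg_integral => //.
  - move=> m n mn; apply/subsetPset => u /=; rewrite !in_itv/=.
    move: (e m) (e n) (e_le mn) => em en enm /andP[h1 h2].
    by apply/andP; split; lra.
  - by move=> n; exact: mB.
  - by move=> n u _; rewrite lee_fin mulr_ge0 ?powR_ge0.
have Lcvg' := cvgeZl (y := (x `^ (- a) * y `^ (- b))%:E) isT Wcvg.
rewrite (funext (fun n => slice (e_gt0 n))) in Lcvg.
exact: (cvg_unique (@ereal_hausdorff R) Lcvg Lcvg').
Qed.

End beta_substitution.

(** * A Volterra equation for power means *)

Section powR_facts.
Context {R : realType}.
Implicit Types (x y z t p th : R).

(** The tangent line at 1, from [1 + z <= expR z] and [ln x <= x - 1]. *)
Lemma powR_tangent_neg x p : 0 < x -> 0 <= p -> 1 - p * (x - 1) <= x `^ (- p).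
Proof.
move=> x0 p0; rewrite /powR gt_eqF//.
apply: (le_trans _ (expR_ge1Dx _)).
rewrite lerD2l mulNr lerN2 ler_wpM2l//.
by have := le_ln1Dx (x := x - 1); rewrite subrKC; apply; rewrite ltrBrDl subrr.
Qed.

Lemma powR_tangent x p : 0 < x -> 0 <= p <= 1 -> x `^ p <= 1 + p * (x - 1).
Proof.
move=> x0 /andP[p0 p1]; rewrite /powR gt_eqF//.
set l := ln x; have xE : x = expR l by rewrite lnK// posrE.
have h1 : expR (p * l) * (1 + (1 - p) * l) <= x.
  rewrite [leRHS]xE (_ : expR l = expR (p * l) * expR ((1 - p) * l)).
    by rewrite ler_wpM2l ?expR_ge0// expR_ge1Dx.
  by rewrite -expRD; congr expR; ring.
have h2 : expR (p * l) * (1 - p * l) <= 1.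
  have : expR (p * l) * (1 - p * l) <= expR (p * l) * expR (- (p * l)).
    by rewrite ler_wpM2l ?expR_ge0// expR_ge1Dx.
  by rewrite -expRD subrr expR0.
have := lerD (ler_wpM2l p0 h1) (ler_wpM2l (_ : 0 <= 1 - p) h2).
rewrite subr_ge0 => /(_ p1); set e := expR _ => h.
have -> : e = p * (e * (1 + (1 - p) * l)) + (1 - p) * (e * (1 - p * l)) by ring.
by apply: (le_trans h); lra.
Qed.

Lemma powR_cvg_pinfty z th : 0 < th -> (z + s) `^ (- th) @[s --> +oo] --> 0.
Proof.
move=> th0; apply/cvgrPdist_le => e e0; near=> s.
have es : e `^ (- th^-1) <= z + s.
  by rewrite -lerBlDl; near: s; apply: nbhs_pinfty_ge; exact: num_real.
have e'0 : 0 < e `^ (- th^-1) by exact: powR_gt0.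
have zs : 0 < z + s by exact: lt_le_trans es.
rewrite sub0r normrN ger0_norm ?powR_ge0//.
rewrite powRN -[leRHS]invrK lef_pV2 ?posrE ?invr_gt0 ?powR_gt0//.
have := ge0_ler_powR (ltW th0) _ _ es; rewrite !nnegrE => /(_ (ltW e'0) (ltW zs)).
by rewrite -powRrM mulNr mulVf ?gt_eqF// powR_inv1// ltW.
Unshelve. all: by end_near. Qed.

Lemma is_derive_powR_shift z p s : 0 < z + s ->
  is_derive s 1 (fun s => (z + s) `^ p) (p * (z + s) `^ (p - 1)).
Proof.
move=> zs; have d1 := is_derive1_powR p zs.
have d2 : is_derive s 1 (fun s : R => z + s) 1 by apply: is_derive_eq; ring.
have := @is_derive1_comp _ (fun u : R => u `^ p) (fun s : R => z + s) _ _ _ d1 d2.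
by rewrite mulr1.
Qed.

Lemma continuous_powR_shift z p s : 0 < z + s ->
  {for s, continuous (fun s : R => (z + s) `^ p)}.
Proof.
move=> zs; apply/differentiable_continuous/derivable1_diffP.
by case: (is_derive_powR_shift p zs).
Qed.

Lemma measurable_powR_shift z p E : measurable_fun E (fun s : R => (z + s) `^ p).
Proof.
apply: measurable_funTS.
have m1 : measurable_fun [set: R] (fun s : R => z + s) by exact: measurable_funD.
exact: (measurableT_comp (measurable_powR p) m1).
Qed.

Lemma integral_powR_tail z t th : 0 < z + t -> 0 < th ->
  (\int[@lebesgue_measure R]_(s in [set` `[t, +oo[%R])
     (th * (z + s) `^ (- (th + 1)))%:E = ((z + t) `^ (- th))%:E)%E.
Proof.
move=> zt th0.
have zs s : t <= s -> 0 < z + s by move=> ts; apply: lt_le_trans zt _; rewrite lerD2l.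
pose F (s : R) : R := - (z + s) `^ (- th).
have dF s : t <= s -> is_derive s 1 F (th * (z + s) `^ (- (th + 1))).
  move=> /zs zs'; have d1 := is_deriveN (is_derive_powR_shift (- th) zs').
  by apply: (is_derive_eq d1); rewrite mulNr opprK opprD.
rewrite (@ge0_continuous_FTC2y _ _ F t 0).
- by rewrite sub0e /F EFinN oppeK.
- by move=> s _; rewrite mulr_ge0 ?powR_ge0// ltW.
- apply/continuous_within_itvcyP; split.
    move=> s; rewrite in_itv/= andbT => /ltW/zs zs'.
    by apply: (cvgM (cvg_cst th)); exact: continuous_powR_shift.
  apply: (cvgM (cvg_cst th)); apply: cvg_at_right_filter.
  exact: continuous_powR_shift.
- by rewrite /F -oppr0; apply: cvgN; exact: powR_cvg_pinfty.
- by move=> s /ltW/dF[].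
- apply: cvg_at_right_filter; apply/differentiable_continuous/derivable1_diffP.
  by case: (dF t (lexx t)).
- by move=> s; rewrite in_itv/= andbT => /ltW/dF ds; rewrite derive1E derive_val.
Qed.

End powR_facts.

Section shifted_moments.
Context {d : measure_display} {T : measurableType d} {R : realType}.
Variable nu : probability T R.
Variables (f : T -> R) (a b : R).
Hypotheses (mf : measurable_fun setT f) (a0 : 0 < a).
Hypothesis fab : forall y, a <= f y <= b.
Implicit Types (p t : R).

Lemma powR_le_endpoints (x y z p : R) : 0 < x -> x <= z <= y ->
  z `^ p <= x `^ p + y `^ p.
Proof.
move=> x0 /andP[xz zy]; have z0 := lt_le_trans x0 xz.
have y0 := lt_le_trans z0 zy.
have [p0|p0] := leP 0 p.
  by rewrite ler_wpDl ?powR_ge0// ge0_ler_powR// nnegrE ltW.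
rewrite ler_wpDr ?powR_ge0// -[p]opprK !(powRN _ (- p)) lef_pV2 ?posrE ?powR_gt0//.
by rewrite ge0_ler_powR ?nnegrE ?oppr_ge0// ltW.
Qed.

(** The shift [t] is the variable of the Volterra equation. *)
Definition shifted_moment p t : R := \int[nu]_y ((f y + t) `^ p).

Let bnd p t y : 0 < a + t -> (f y + t) `^ p <= (a + t) `^ p + (b + t) `^ p.
Proof.
by move=> at0; apply: powR_le_endpoints => //; rewrite !lerD2r.
Qed.

Lemma measurable_shifted p t : measurable_fun setT (fun y => (f y + t) `^ p).
Proof.
have m1 : measurable_fun setT (fun y => f y + t) by exact: measurable_funD.
exact: (measurableT_comp (measurable_powR p) m1).
Qed.

Lemma integrable_shifted p t : 0 < a + t ->
  nu.-integrable setT (EFin \o (fun y => (f y + t) `^ p)).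
Proof.
move=> at0; apply: measurable_bounded_integrable => //.
- by rewrite (le_lt_trans (probability_le1 _ _)) ?ltry.
- exact: measurable_shifted.
exists ((a + t) `^ p + (b + t) `^ p); split; first exact: num_real.
move=> M MB y _ /=; rewrite ger0_norm ?powR_ge0//.
exact/ltW/(le_lt_trans (bnd _ _ at0)).
Qed.

Lemma shifted_moment_ge0 p t : 0 <= shifted_moment p t.
Proof. by apply: Rintegral_ge0 => y _; exact: powR_ge0. Qed.

Lemma EFin_shifted_moment p t : 0 < a + t ->
  (shifted_moment p t)%:E = (\int[nu]_y ((f y + t) `^ p)%:E)%E.
Proof.
move=> at0; rewrite /shifted_moment /Rintegral fineK//.
exact/integrable_fin_num/integrable_shifted.
Qed.

Lemma is_derive_shifted_moment p t : 0 < a + t ->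
  is_derive t 1 (shifted_moment p) (p * shifted_moment (p - 1) t).
Proof.
move=> at0; pose u := (t - a) / 2; pose v := t + 1.
have au : 0 < a + u by rewrite /u; lra.
have I s : s \in `]u, v[ -> 0 < a + s.
  by rewrite in_itv/= => /andP[us _]; apply: lt_trans au _; rewrite ltrD2l.
have fs s y : 0 < a + s -> 0 < f y + s.
  by move=> /lt_le_trans; apply; rewrite lerD2r; case/andP: (fab y).
have tI : `]u, v[%classic t by rewrite /= in_itv/=; rewrite /u /v; lra.
have dF s y : 0 < a + s ->
    is_derive s 1 (fun s => (f y + s) `^ p) (p * (f y + s) `^ (p - 1)).
  by move=> /fs as0; exact: is_derive_powR_shift.
pose M := `|p| * ((a + u) `^ (p - 1) + (b + v) `^ (p - 1)).
have hint s : `]u, v[%classic s ->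
    nu.-integrable setT (EFin \o (fun s y => (f y + s) `^ p) s).
  by move=> /I; exact: integrable_shifted.
have hder s y : `]u, v[%classic s -> [set: T] y ->
    derivable ((fun s y => (f y + s) `^ p) ^~ y) s 1.
  by move=> /I as0 _; case: (dF _ y as0).
have hM y : 0 <= (fun=> M : R) (y : T).
  by rewrite mulr_ge0// addr_ge0 ?powR_ge0.
have hMi : nu.-integrable setT (EFin \o (fun=> M : R)).
  by apply: finite_measure_integrable_cst.
have hbd s y : `]u, v[%classic s -> [set: T] y ->
    `|partial1of2 (fun s y => (f y + s) `^ p) s y| <= M.
  move=> sI _; have as0 := I _ sI.
  have ds := dF _ y as0; rewrite /partial1of2 derive1E derive_val normrM.
  rewrite ler_wpM2l// ger0_norm ?powR_ge0//.
  apply: powR_le_endpoints => //.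
  move: sI; rewrite /= in_itv/= => /andP[us sv]; have /andP[h1 h2] := fab y.
  by rewrite !lerD// ltW.
have D := derivable_under_integral measurableT tI hint hder hM hMi hbd.
have E := differentiation_under_integral measurableT tI hint hder hM hMi hbd.
split; first exact: D.
rewrite -derive1E E /shifted_moment -RintegralZl//; last exact: integrable_shifted.
apply: eq_Rintegral => y _.
by have ds := dF _ y at0; rewrite /partial1of2 derive1E derive_val.
Qed.

Lemma continuous_shifted_moment p t : 0 < a + t ->
  {for t, continuous (shifted_moment p)}.
Proof.
move=> at0; apply/differentiable_continuous/derivable1_diffP.
by case: (is_derive_shifted_moment p at0).
Qed.

Lemma shifted_moment_bounds p t : 0 < p -> 0 < a + t ->
  (a + t) `^ p <= shifted_moment p t <= (b + t) `^ p.
Proof.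
move=> p0 at0.
have fs y : a + t <= f y + t <= b + t by rewrite !lerD2r.
have cE (c : R) : (c = \int[nu]_y c)%R.
  rewrite Rintegral_cst// [X in fine X](_ : _ = 1%E) ?mulr1//.
  exact: probability_setT.
have ci (c : R) : nu.-integrable setT (EFin \o (fun=> c)).
  exact: finite_measure_integrable_cst.
apply/andP; split.
  rewrite [leLHS]cE; apply: le_Rintegral => //; first exact: integrable_shifted.
  move=> y _; have /andP[h1 _] := fs y.
  by rewrite ge0_ler_powR ?nnegrE ?(ltW p0) ?(ltW at0)// (le_trans _ h1)// ltW.
rewrite [leRHS]cE; apply: le_Rintegral => //; first exact: integrable_shifted.
move=> y _; have /andP[h1 h2] := fs y.
have h3 := lt_le_trans at0 h1; have h4 := lt_le_trans h3 h2.
by rewrite ge0_ler_powR ?nnegrE// ltW.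
Qed.

End shifted_moments.

Section volterra.
Context {d : measure_display} {T : measurableType d} {R : realType}.
Variable nu : probability T R.
Variables (f : T -> R) (a b al : R).
Hypotheses (mf : measurable_fun setT f) (a0 : 0 < a).
Hypothesis fab : forall y, a <= f y <= b.
Hypothesis al01 : 0 < al < 1.
Implicit Types (th t s C : R).
Local Notation mu := (@lebesgue_measure R).

Let al0 : 0 < al. Proof. by case/andP: al01. Qed.
Let al1 : al < 1. Proof. by case/andP: al01. Qed.

Lemma powR_anti (x y p : R) : 0 < x -> x <= y -> 0 <= p -> y `^ (- p) <= x `^ (- p).
Proof.
move=> x0 xy p0; have y0 := lt_le_trans x0 xy.
by rewrite !powRN lef_pV2 ?posrE ?powR_gt0// ge0_ler_powR// nnegrE ltW.
Qed.

(** The right-hand side of the Markov--Krein identity for the function [f + t]. *)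
Definition power_mean th t : R := shifted_moment nu f al t `^ (- (th / al)).

Local Notation L := (shifted_moment nu f (al - 1)).

Lemma shifted_moment_gt0 t : 0 < a + t -> 0 < shifted_moment nu f al t.
Proof.
move=> at0; have /andP[h _] := shifted_moment_bounds nu mf fab al0 at0.
by apply: lt_le_trans h; rewrite powR_gt0.
Qed.

Lemma power_mean_bounds th t : 0 <= th -> 0 < a + t ->
  (b + t) `^ (- th) <= power_mean th t <= (a + t) `^ (- th).
Proof.
move=> th0 at0; have /andP[h1 h2] := shifted_moment_bounds nu mf fab al0 at0.
have E (x : R) : x `^ (- th) = (x `^ al) `^ (- (th / al)).
  by rewrite -powRrM mulrN mulrCA divff ?mulr1// gt_eqF.
have q0 : 0 <= th / al by rewrite divr_ge0// ltW.
rewrite !E /power_mean !powR_anti ?powR_gt0//.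
exact: shifted_moment_gt0.
Qed.

Lemma continuous_power_mean th t : 0 < a + t -> {for t, continuous (power_mean th)}.
Proof.
move=> at0; apply/differentiable_continuous/derivable1_diffP.
have d1 := is_derive_shifted_moment nu mf fab al at0.
have d2 := is_derive1_powR (- (th / al)) (shifted_moment_gt0 at0).
have d3 := @is_derive1_comp _ (fun z : R => z `^ (- (th / al)))
  (shifted_moment nu f al) _ _ _ d2 d1.
by case: d3.
Qed.

(** The derivative of the [al]-moment is [al] times the [(al - 1)]-moment [L], so
    the integrand is the derivative of [- power_mean th], and the power mean
    vanishes at infinity. *)
Lemma power_mean_volterra th t : 0 < th -> 0 < a + t ->
  (\int[mu]_(s in [set` `[t, +oo[%R])
     (th * L s * power_mean (th + al) s)%:E = (power_mean th t)%:E)%E.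
Proof.
move=> th0 at0.
have as0 s : t <= s -> 0 < a + s.
  by move=> ts; apply: lt_le_trans at0 _; rewrite lerD2l.
pose F (s : R) : R := - power_mean th s.
have dF s : t <= s -> is_derive s 1 F (th * L s * power_mean (th + al) s).
  move=> /as0 s0.
  have d1 := is_derive_shifted_moment nu mf fab al s0.
  have d2 := is_derive1_powR (- (th / al)) (shifted_moment_gt0 s0).
  have d3 := @is_derive1_comp _ (fun z : R => z `^ (- (th / al)))
    (shifted_moment nu f al) _ _ _ d2 d1.
  apply: (is_derive_eq (is_deriveN d3)).
  have -> : power_mean (th + al) s =
      shifted_moment nu f al s `^ (- (th / al) - 1).
    by rewrite /power_mean mulrDl divff ?gt_eqF// opprD.
  by field; rewrite gt_eqF.
have dc s : t <= s -> {for s, continuous (power_mean (th + al))}.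
  by move=> /as0; exact: continuous_power_mean.
pose h (r : R) : R := th * L r * power_mean (th + al) r.
have ct s : t <= s -> {for s, continuous h}.
  move=> ts; have c1 := @continuous_shifted_moment _ _ _ nu _ _ _ mf fab (al - 1) _ (as0 _ ts).
  exact: (cvgM (cvgM (cvg_cst th) c1) (dc _ ts)).
rewrite (@ge0_continuous_FTC2y _ _ F t 0).
- by rewrite sub0e /F EFinN oppeK.
- by move=> s _; rewrite !mulr_ge0 ?powR_ge0 ?shifted_moment_ge0// ltW.
- apply/continuous_within_itvcyP; split.
    by move=> s; rewrite in_itv/= andbT => /ltW; exact: ct.
  by apply: cvg_at_right_filter; exact: ct.
- rewrite /F -oppr0; apply: cvgN.
  apply: (@squeeze_cvgr _ _ _ _ (fun=> 0) (fun s => (a + s) `^ (- th))).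
  + near=> s; rewrite powR_ge0/=.
    have ts : t <= s by near: s; apply: nbhs_pinfty_ge; exact: num_real.
    by have /andP[_ ->] := power_mean_bounds (ltW th0) (as0 _ ts).
  + exact: cvg_cst.
  + exact: powR_cvg_pinfty.
- by move=> s /ltW/dF[].
- apply: cvg_at_right_filter; apply/differentiable_continuous/derivable1_diffP.
  by case: (dF t (lexx t)).
- by move=> s; rewrite in_itv/= andbT => /ltW/dF ds; rewrite derive1E derive_val.
Unshelve. all: by end_near. Qed.

Lemma measurable_power_mean th t : 0 < a + t ->
  measurable_fun ([set` `[t, +oo[%R] : set R) (power_mean th).
Proof.
move=> at0; apply: subspace_continuous_measurable_fun => //.
apply/continuous_within_itvcyP; split; last first.
  by apply: cvg_at_right_filter; exact: continuous_power_mean.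
move=> s; rewrite in_itv/= andbT => ts; apply: continuous_power_mean.
by apply: lt_trans at0 _; rewrite ltrD2l.
Qed.

Lemma shifted_moment_le t : 0 < a + t -> L t <= (a + t) `^ (al - 1).
Proof.
move=> at0.
have -> : (a + t) `^ (al - 1) = (\int[nu]_y ((fun=> (a + t) `^ (al - 1)) (y : T)))%R.
  rewrite Rintegral_cst// [X in fine X](_ : _ = 1%E) ?mulr1//.
  exact: probability_setT.
apply: le_Rintegral => //.
- exact: integrable_shifted.
- exact: finite_measure_integrable_cst.
- move=> y _; rewrite -(opprB 1 al) powR_anti//.
    by rewrite lerD2r; case/andP: (fab y).
  by rewrite subr_ge0 ltW.
Qed.

(** Since [L s <= (a + s)^(al - 1)], the integrand is at most a multiple of
    [(a + s)^(-(th + 2))]; integrating it produces the factor [th / (th + 1)], which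
    is what makes the iteration contract. *)
Lemma volterra_error th t C : 0 < th -> 0 < a + t -> 0 <= C ->
  (\int[mu]_(s in [set` `[t, +oo[%R])
     (th * L s * (C * (a + s) `^ (- (th + al + 1))))%:E <=
   (C * (th / (th + 1)) * (a + t) `^ (- (th + 1)))%:E)%E.
Proof.
move=> th0 at0 C0.
have as0 s : t <= s -> 0 < a + s.
  by move=> ts; apply: lt_le_trans at0 _; rewrite lerD2l.
have th1 : 0 < th + 1 by rewrite addr_gt0.
rewrite EFinM -(integral_powR_tail at0 th1) -ge0_integralZl//; last 3 first.
- by apply/measurable_EFinP; apply: measurable_funM => //; exact: measurable_powR_shift.
- by move=> s _; rewrite lee_fin mulr_ge0 ?powR_ge0// ltW.
- by rewrite lee_fin mulr_ge0// divr_ge0// ltW.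
apply: ge0_le_integral => //.
- by move=> s _; rewrite lee_fin !mulr_ge0 ?powR_ge0 ?shifted_moment_ge0// ltW.
- apply/measurable_EFinP; apply: measurable_funM; last first.
    by apply: measurable_funM => //; exact: measurable_powR_shift.
  apply: measurable_funM => //.
  apply: subspace_continuous_measurable_fun => //.
  apply/continuous_within_itvcyP; split.
    move=> s; rewrite in_itv/= andbT => /ltW/as0 s0.
    exact: (continuous_shifted_moment mf fab).
  apply: cvg_at_right_filter; exact: (continuous_shifted_moment mf fab).
- apply/measurable_EFinP; apply: measurable_funM => //.
  by apply: measurable_funM => //; exact: measurable_powR_shift.
- move=> s; rewrite /= in_itv/= andbT => /as0 s0.
  rewrite -EFinM lee_fin.
  have -> : C * (th / (th + 1)) * ((th + 1) * (a + s) `^ (- (th + 1 + 1))) =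
     th * (a + s) `^ (al - 1) * (C * (a + s) `^ (- (th + al + 1))).
    have -> : (a + s) `^ (- (th + 1 + 1)) =
        (a + s) `^ (al - 1) * (a + s) `^ (- (th + al + 1)).
      by rewrite -powRD ?(gt_eqF s0) ?implybT//; congr (_ `^ _); ring.
    by field; rewrite gt_eqF.
  by rewrite ler_wpM2r ?mulr_ge0 ?powR_ge0// ler_wpM2l ?(ltW th0)// shifted_moment_le.
Qed.

(** The error after [k] iterations: a Lipschitz constant [b0 * th] to start with,
    and the factor of [volterra_error] at each step, the exponent moving from [th]
    to [th + al]. *)
Fixpoint stick_error (b0 th : R) (k : nat) : R :=
  if k is k'.+1 then stick_error b0 (th + al) k' * (th / (th + 1)) else b0 * th.

Lemma stick_error_ge0 b0 th k : 0 <= b0 -> 0 < th -> 0 <= stick_error b0 th k.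
Proof.
move=> b00; elim: k th => [|k IH] th th0 /=; first by rewrite mulr_ge0// ltW.
by rewrite mulr_ge0 ?IH ?addr_gt0// divr_ge0// ?ltW// addr_gt0.
Qed.

(** The increase of the Lipschitz constant is combined with the contraction
    factor of the step: [(th + al) / (th + 1) = 1 - (1 - al) / (th + 1)]. *)
Lemma stick_error_le b0 th k : 0 <= b0 -> 0 < th ->
  stick_error b0 th k <= b0 * th *
    expR (- \sum_(j < k) (1 - al) / (th + j%:R * al + 1)).
Proof.
move=> b00; elim: k th => [|k IH] th th0 /=.
  by rewrite big_ord0 oppr0 expR0 mulr1.
have th1 : 0 < th + 1 by rewrite addr_gt0.
rewrite big_ord_recl mul0r addr0 opprD expRD.
have h1 := IH (th + al) (addr_gt0 th0 al0).
have eqS : \sum_(j < k) (1 - al) / (th + al + j%:R * al + 1) =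
    \sum_(j < k) (1 - al) / (th + (lift ord0 j)%:R * al + 1).
  apply: eq_bigr => j _; rewrite lift0 -natr1; congr (_ / _); ring.
rewrite eqS in h1; set S := \sum_(j < k) _ in h1 *.
apply: (le_trans (ler_wpM2r (divr_ge0 (ltW th0) (ltW th1)) h1)).
have h2 : (th + al) / (th + 1) <= expR (- ((1 - al) / (th + 1))).
  apply: (le_trans _ (expR_ge1Dx _)).
  rewrite (_ : 1 + _ = (th + al) / (th + 1))//; field; rewrite gt_eqF//.
have -> : b0 * (th + al) * expR (- S) * (th / (th + 1)) =
   b0 * th * ((th + al) / (th + 1) * expR (- S)) by ring.
rewrite ler_wpM2l ?mulr_ge0 ?(ltW th0)// ler_wpM2r ?expR_ge0//.
Qed.

(** The exponent is bounded below by a multiple of the harmonic series. *)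
Lemma stick_error_cvg0 b0 th : 0 <= b0 -> 0 < th ->
  stick_error b0 th k @[k --> \oo] --> 0.
Proof.
move=> b00 th0; have th1 : 0 < th + 1 by rewrite addr_gt0.
pose c := (1 - al) / (th + 1).
have c0 : 0 < c by rewrite divr_gt0// subr_gt0.
have harm : series (@harmonic R) @ \oo --> +oo.
  have := nondecreasing_dvgn_lt (u_ := series (@harmonic R)).
  apply; last exact: dvg_harmonic.
  apply: nondecreasing_series => k _ _; exact: harmonic_ge0.
have sumge k : c * series harmonic k <= \sum_(j < k) (1 - al) / (th + j%:R * al + 1).
  rewrite /series/= big_mkord mulr_sumr; apply: ler_sum => j _.
  rewrite /c /harmonic -mulrA -invfM ler_wpM2l ?subr_ge0 ?(ltW al1)//.
  have j0 : 0 <= j%:R :> R by [].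
  have jal : j%:R * al <= j%:R by rewrite ler_piMr// ltW.
  have jth : 0 <= th * j%:R by rewrite mulr_ge0// ltW.
  have D0 : 0 < th + j%:R * al + 1 by rewrite ltr_wpDl// addr_ge0 ?(ltW th0)// mulr_ge0// ltW.
  rewrite lef_pV2 ?posrE ?mulr_gt0//.
  by rewrite -natr1 mulrDr mulrDl; lra.
apply: (@squeeze_cvgr _ _ _ _ (fun=> 0)
    (fun k => b0 * th * expR (- (c * series harmonic k)))).
- near=> k; rewrite stick_error_ge0//=.
  apply: (le_trans (stick_error_le k b00 th0)).
  rewrite ler_wpM2l ?mulr_ge0 ?(ltW th0)// ler_expR lerN2.
  exact: sumge.
- exact: cvg_cst.
- rewrite -[X in _ --> X](mulr0 (b0 * th)); apply: (cvgM (cvg_cst (b0 * th))).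
  apply: (cvg_comp _ _ _ (@cvgr_expR R)).
  apply/cvgryPge => M; near=> k.
  rewrite mulrC -ler_pdivrMr//; near: k.
  by move/cvgryPge : harm; apply.
Unshelve. all: by end_near. Qed.

End volterra.

(** * Expectations of beta variables *)

Section density.
Context {d : measure_display} {T : measurableType d} {R : realType}.
Variables (nu : {finite_measure set T -> \bar R})
          (mu : {sigma_finite_measure set T -> \bar R}).
Local Open Scope ereal_scope.

Lemma ge0_integral_density (D : set T) (g : T -> R) (phi : T -> \bar R) :
  measurable D -> measurable_fun D g -> (forall x, D x -> (0 <= g x)%R) ->
  (forall A, measurable A -> nu A = \int[mu]_(x in A `&` D) (g x)%:E) ->
  measurable_fun setT phi -> (forall x, 0 <= phi x) ->
  \int[nu]_x phi x = \int[mu]_(x in D) (phi x * (g x)%:E).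
Proof.
move=> mD mg g0 nuE mphi phi0.
pose G := (EFin \o g) \_ D.
have mG : measurable_fun setT G.
  by apply/(measurable_restrictT _ mD); exact/measurable_EFinP.
have GE A : measurable A -> nu A = \int[mu]_(x in A) G x.
  by move=> mA; rewrite nuE// integral_mkcondr.
have numu : nu `<< mu.
  apply/null_content_dominatesP => A mA A0; rewrite GE//.
  by rewrite null_set_integral//; exact: measurable_funTS.
rewrite -(Radon_Nikodym_SigmaFinite.change_of_variables numu)//.
have fG : ae_eq mu setT (Radon_Nikodym_SigmaFinite.f nu mu) G.
  apply: integral_ae_eq => //.
    exact: Radon_Nikodym_SigmaFinite.f_integrable.
  move=> E _ mE.
  by rewrite -Radon_Nikodym_SigmaFinite.f_integral// GE.
transitivity (\int[mu]_x (phi x * G x)).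
  apply: ge0_ae_eq_integral => //.
  - apply: emeasurable_funM => //.
    exact: measurable_int (Radon_Nikodym_SigmaFinite.f_integrable numu).
  - exact: emeasurable_funM.
  - by move=> x _; rewrite mule_ge0 ?Radon_Nikodym_SigmaFinite.f_ge0.
  - move=> x _; rewrite mule_ge0// /G patchE; case: ifPn => // /[!inE] Dx.
    by rewrite lee_fin g0.
  - by apply: filterS fG => x h xT; rewrite h.
rewrite [RHS]integral_mkcond; apply: eq_integral => x _.
by rewrite /G !patchE; case: ifPn => // _; rewrite mule0.
Qed.

End density.

Section beta_expectation.
Context {d : measure_display} {T : measurableType d} {R : realType}.
Variables (P : probability T R) (U : {RV P >-> R}) (a b : R).
Hypothesis lawU : forall A, measurable A -> distribution P U A = real_beta_law a b A.
Local Notation mu := (@lebesgue_measure R).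
Local Notation I := [set` `]0%R, 1%R[].

Let W : \bar R := (\int[mu]_(x in I) (beta_weight a b x)%:E)%E.

Lemma measurable_beta_weight E : measurable_fun E (beta_weight a b).
Proof.
apply: measurable_funTS; apply: measurable_funM => /=.
  exact: measurable_powR.
have m1 : measurable_fun [set: R] (fun z : R => 1 - z) by exact: measurable_funB.
exact: (measurableT_comp (measurable_powR (b - 1)) m1).
Qed.

Lemma beta_weight_ge0 (u : R) : 0 <= beta_weight a b u.
Proof. by rewrite mulr_ge0 ?powR_ge0. Qed.

Let B0 : 0 < real_beta_fun a b.
Proof.
rewrite lt_neqAle; apply/andP; split; last first.
  by apply: Rintegral_ge0 => x _; exact: beta_weight_ge0.
apply/negP => /eqP B0.
have := lawU measurableT; rewrite /real_beta_law -B0.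
under eq_integral do rewrite invr0 mulr0.
rewrite integral0_eq// => h.
have /eqP : (0%E : \bar R) = 1%E by rewrite -h; exact: probability_setT.
by rewrite eqe eq_sym oner_eq0.
Qed.

Let WE : W = (real_beta_fun a b)%:E.
Proof.
move: B0; rewrite /real_beta_fun /Rintegral -/W.
have : (0 <= W)%E by apply: integral_ge0 => x _; rewrite lee_fin beta_weight_ge0.
by case: W => //=; rewrite ltxx.
Qed.

Lemma ge0_beta_expectation (phi : R -> R) :
  measurable_fun setT phi -> (forall u, 0 <= phi u) ->
  (\int[P]_w (phi (U w))%:E = ((real_beta_fun a b)^-1)%:E *
     \int[mu]_(u in I) (beta_weight a b u * phi u)%:E)%E.
Proof.
move=> mphi phi0.
have mU : @measurable_fun _ _ T (measurableTypeR R) setT U.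
  exact: (@measurable_funPT _ _ _ _ U).
pose V : {mfun T >-> measurableTypeR R} := @mfun_Sub _ _ T (measurableTypeR R) _ (mem_set mU).
have mphi' : measurable_fun (setT : set (measurableTypeR R)) (EFin \o phi).
  exact/measurable_EFinP.
rewrite -[LHS](@ge0_integral_distribution _ _ _ _ _ P V (EFin \o phi)); last 2 first.
- exact/measurable_EFinP.
- by move=> u; rewrite lee_fin.
rewrite (@ge0_integral_density _ _ _ (distribution P V) mu I
   (fun x => beta_weight a b x / real_beta_fun a b)) //.
- rewrite -ge0_integralZl//.
  + by apply: eq_integral => u _ /=; rewrite -!EFinM; congr EFin; ring.
  + apply/measurable_EFinP; apply: measurable_funM; last exact: measurable_funTS.
    exact: measurable_beta_weight.
  + by move=> u _; rewrite lee_fin mulr_ge0 ?beta_weight_ge0.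
  + by rewrite lee_fin invr_ge0 ltW.
- apply: measurable_funM => //; exact: measurable_beta_weight.
- by move=> x _; rewrite divr_ge0 ?beta_weight_ge0// ltW.
Qed.

(** The beta law normalizes the integral of [beta_weight_projective]; this is the
    Markov--Krein identity for a measure with two atoms. *)
Lemma beta_projective_expectation (x y : R) : 0 < x -> 0 < y ->
  (\int[P]_w ((U w * x + (1 - U w) * y) `^ (- (a + b)))%:E =
   (x `^ (- a) * y `^ (- b))%:E)%E.
Proof.
move=> x0 y0.
rewrite (@ge0_beta_expectation (fun u => (u * x + (1 - u) * y) `^ (- (a + b)))).
- rewrite beta_weight_projective// -/W WE -!EFinM; congr EFin.
  by rewrite mulrC mulfK// gt_eqF.
- have mD : measurable_fun [set: R] (fun u : R => u * x + (1 - u) * y).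
    apply: measurable_funD; apply: measurable_funM => //.
    exact: measurable_funB.
  exact: (measurableT_comp (measurable_powR _) mD).
- by move=> u; exact: powR_ge0.
Qed.

Lemma beta_law_support : {ae P, forall w, 0 < U w < 1}.
Proof.
have mI : measurable (I : set R) by exact: measurable_itv.
exists (U @^-1` (~` I)); split.
- by apply: measurable_funPTI; exact: measurableC.
- have := lawU (measurableC mI); rewrite /real_beta_law.
  rewrite setICl integral_set0 /distribution /pushforward /= => ->//.
- by move=> w /=; rewrite in_itv.
Qed.

End beta_expectation.

(** * The Markov--Krein identity for truncated sticks *)

Lemma measurable_powR_comp {d} {T : measurableType d} {R : realType} (p : R)
    (g : T -> R) :
  measurable_fun setT g -> measurable_fun setT (fun z => g z `^ p).
Proof. by move=> mg; exact: (measurableT_comp (measurable_powR p) mg). Qed.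

Section stick_step.
Context {d1 d2 d : measure_display} {T1 : measurableType d1}
  {T2 : measurableType d2} {S : measurableType d} {R : realType}.
Variables (P1 : probability T1 R) (P2 : probability T2 R) (nu : probability S R).
Variables (U : nat -> {RV P1 >-> R}) (xi : nat -> {RV P2 >-> S}).
Variables (f : S -> R) (a b al th t : R) (n : nat) (Y : T1 -> T2 -> R).
Hypothesis indU : mutually_independent U.
Hypothesis indxi : mutually_independent xi.
Hypothesis lawU : forall A, measurable A ->
  distribution P1 (U n) A = real_beta_law (1 - al) (th + al) A.
Hypothesis lawxi : forall A, measurable A -> distribution P2 (xi n) A = nu A.
Hypotheses (mf : measurable_fun setT f) (fab : forall y, a <= f y <= b).
Hypothesis at0 : 0 < a + t.
Hypothesis mY : measurable_fun setT (fun z : T1 * T2 => Y z.1 z.2).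
Hypothesis mY1 : forall w', measurable_fun
  (setT : set (g_sigma_algebraType (generators_of U [set~ n]))) (Y ^~ w').
Hypothesis mY2 : forall w, measurable_fun
  (setT : set (g_sigma_algebraType (generators_of xi [set~ n]))) (Y w).
Hypothesis Y0 : forall w w', 0 < Y w w' + t.
Local Open Scope ereal_scope.

Let mU w' : measurable_fun setT (Y ^~ w').
Proof. exact: (measurableT_comp mY (pair2_measurable w')). Qed.

Let fxi0 s : (0 < f s + t)%R.
Proof. by apply: (lt_le_trans at0); rewrite lerD2r; case/andP: (fab s). Qed.

Let mfxi : measurable_fun setT (fun w' => f (xi n w')).
Proof. exact: measurableT_comp. Qed.

Let g (w : T1) (w' : T2) : \bar R :=
  ((U n w * f (xi n w') + (1 - U n w) * Y w w' + t) `^ (- (th + 1)))%:E.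

Let h (w : T1) (w' : T2) : \bar R := ((Y w w' + t) `^ (- (th + al)))%:E.

Let k (w' : T2) : \bar R := ((f (xi n w') + t) `^ (al - 1))%:E.

Let mg : measurable_fun setT (fun z : T1 * T2 => g z.1 z.2).
Proof.
apply/measurable_EFinP; apply: measurable_powR_comp.
have m1 : measurable_fun setT (fun z : T1 * T2 => U n z.1).
  exact: measurableT_comp.
have m2 : measurable_fun setT (fun z : T1 * T2 => f (xi n z.2)).
  exact: (measurableT_comp mfxi).
apply: measurable_funD => //; apply: measurable_funD; apply: measurable_funM => //.
exact: measurable_funB.
Qed.

Let mh : measurable_fun setT (fun z : T1 * T2 => h z.1 z.2).
Proof.
by apply/measurable_EFinP; apply: measurable_powR_comp; exact: measurable_funD.
Qed.

Let mk : measurable_fun setT k.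
Proof.
by apply/measurable_EFinP; apply: measurable_powR_comp; exact: measurable_funD.
Qed.

Let inner w' : \int[P1]_w g w w' = \int[P1]_w (k w' * h w w').
Proof.
pose F (z : g_sigma_algebraType (generators_of U [set~ n]) * R) : \bar R :=
  ((z.2 * (f (xi n w') + t) + (1 - z.2) * (Y z.1 w' + t)) `^ (- ((1 - al) + (th + al))))%:E.
transitivity (\int[P1]_w F (w, U n w)).
  by apply: eq_integral => w _; rewrite /g /F /=; congr (powR _ _)%:E; ring.
rewrite integral_peel//; last 2 first.
- apply/measurable_EFinP; apply: measurable_powR_comp.
  have m1 : measurable_fun setT
      (fun z : g_sigma_algebraType (generators_of U [set~ n]) * R => Y z.1 w').
    exact: (measurableT_comp (mY1 w')).
  apply: measurable_funD; first exact: measurable_funM.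
  by apply: measurable_funM; [exact: measurable_funB|exact: measurable_funD].
- by move=> z; rewrite lee_fin powR_ge0.
apply: eq_integral => w _; rewrite /F /=.
rewrite (beta_projective_expectation lawU)// ?fxi0// /k /h -EFinM.
by rewrite opprB.
Qed.

Let k_integral : \int[P2]_w' k w' = (shifted_moment nu f (al - 1) t)%:E.
Proof.
rewrite (EFin_shifted_moment nu mf fab)//.
rewrite -(@ge0_integral_distribution _ _ _ _ _ P2 (xi n)
  (fun s => ((f s + t) `^ (al - 1))%:E)); last 2 first.
- by apply/measurable_EFinP; apply: measurable_powR_comp; exact: measurable_funD.
- by move=> s; rewrite lee_fin powR_ge0.
by apply: eq_measure_integral => A mA _; exact: lawxi.
Qed.

Let outer w : \int[P2]_w' (k w' * h w w') =
  (shifted_moment nu f (al - 1) t)%:E * \int[P2]_w' h w w'.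
Proof.
pose F (z : g_sigma_algebraType (generators_of xi [set~ n]) * S) : \bar R :=
  ((f z.2 + t) `^ (al - 1))%:E * ((Y w z.1 + t) `^ (- (th + al)))%:E.
transitivity (\int[P2]_w' F (w', xi n w')); first by [].
have mh1 : measurable_fun setT (h w).
  exact: (measurableT_comp mh (pair1_measurable w)).
rewrite integral_peel//; last 2 first.
- have m1 : measurable_fun setT
      (fun z : g_sigma_algebraType (generators_of xi [set~ n]) * S => Y w z.1).
    exact: (measurableT_comp (mY2 w)).
  apply: emeasurable_funM; apply/measurable_EFinP; apply: measurable_powR_comp;
    apply: measurable_funD => //.
  exact: measurableT_comp.
- by move=> z; rewrite mule_ge0 ?lee_fin ?powR_ge0.
rewrite -ge0_integralZl//; last 2 first.
- by move=> w' _; rewrite lee_fin powR_ge0.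
- by rewrite lee_fin shifted_moment_ge0.
apply: eq_integral => w' _; rewrite /F /= ge0_integralZr//.
- by rewrite -/(k _) k_integral.
- by move=> s _; rewrite lee_fin powR_ge0.
- by rewrite lee_fin powR_ge0.
Qed.

(** The exponent [th + 1] is the sum [(1 - al) + (th + al)] of the two parameters of
    [U n], so that averaging over [U n] alone splits the integrand into a factor
    that depends on [xi n] and one that does not. *)
Lemma stick_step :
  \int[P1]_w \int[P2]_w'
     ((U n w * f (xi n w') + (1 - U n w) * Y w w' + t) `^ (- (th + 1)))%:E =
  (shifted_moment nu f (al - 1) t)%:E *
    \int[P1]_w \int[P2]_w' ((Y w w' + t) `^ (- (th + al)))%:E.
Proof.
have g0 z : 0 <= g z.1 z.2 by rewrite lee_fin powR_ge0.
have kh0 (z : T1 * T2) : 0 <= k z.2 * h z.1 z.2.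
  by rewrite mule_ge0// lee_fin powR_ge0.
have mkh : measurable_fun setT (fun z : T1 * T2 => k z.2 * h z.1 z.2).
  by apply: emeasurable_funM => //; exact: measurableT_comp.
have E1 : \int[P1]_w \int[P2]_w' g w w' = \int[P2]_w' \int[P1]_w g w w'.
  exact: (@fubini_tonelli _ _ _ _ _ P1 P2 _ mg).
have E2 : \int[P1]_w \int[P2]_w' (k w' * h w w') =
    \int[P2]_w' \int[P1]_w (k w' * h w w').
  exact: (@fubini_tonelli _ _ _ _ _ P1 P2 _ mkh).
rewrite [LHS]E1; under eq_integral do rewrite inner.
rewrite -E2; under eq_integral do rewrite outer.
rewrite ge0_integralZl//.
- have h0 z : 0 <= h z.1 z.2 by rewrite lee_fin powR_ge0.
  exact: (@measurable_fun_fubini_tonelli_F _ _ _ _ _ P2 _ mh).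
- by move=> w _; apply: integral_ge0 => w' _; rewrite lee_fin powR_ge0.
- by rewrite lee_fin shifted_moment_ge0.
Qed.

End stick_step.

(** [stick_average u y c k n] is the average of [y n, y n.+1, ...] for the
    weights obtained by breaking sticks with the proportions [u n, u n.+1, ...],
    where the stick left after [k] breaks is given the value [c]. *)
Fixpoint stick_average {R : realType} (u y : nat -> R) (c : R) (k n : nat) : R :=
  if k is k'.+1 then u n * y n + (1 - u n) * stick_average u y c k' n.+1 else c.

Section stick_average.
Context {R : realType}.

Lemma stick_average_bounds (u y : nat -> R) (a b c : R) (k n : nat) :
  (forall j, 0 < u j < 1) -> (forall j, a <= y j <= b) -> a <= c <= b ->
  a <= stick_average u y c k n <= b.
Proof.
move=> u01 yab cab; elim: k n => [//|k IH] n /=.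
have /andP[u0 u1] := u01 n; have /andP[y1 y2] := yab n; have /andP[s1 s2] := IH n.+1.
have u1' : 0 <= 1 - u n by rewrite subr_ge0 ltW.
have h1 := ler_wpM2l (ltW u0) y1; have h2 := ler_wpM2l (ltW u0) y2.
have h3 := ler_wpM2l u1' s1; have h4 := ler_wpM2l u1' s2.
by apply/andP; split; lra.
Qed.

Lemma measurable_stick_average {d} {Z : measurableType d} (u y : nat -> Z -> R)
    (c : R) (k n : nat) :
  (forall j, (n <= j)%N -> measurable_fun setT (u j)) ->
  (forall j, (n <= j)%N -> measurable_fun setT (y j)) ->
  measurable_fun setT
    (fun z => stick_average (fun j => u j z) (fun j => y j z) c k n).
Proof.
elim: k n => [|k IH] n mu my /=; first exact: measurable_cst.
apply: measurable_funD; apply: measurable_funM; [exact: mu|exact: my| |].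
  by apply: measurable_funB => //; exact: mu.
by apply: IH => j nj; [apply: mu|apply: my]; exact: ltnW.
Qed.

End stick_average.

Lemma integral_prob_cst {d} {T : measurableType d} {R : realType}
    (P : probability T R) (r : R) : (\int[P]_x r%:E = r%:E)%E.
Proof.
rewrite integral_cst// [X in (_ * X)%E](_ : _ = 1%E) ?mule1//.
exact: probability_setT.
Qed.

Lemma integral_mulr_indic {d} {T : measurableType d} {R : realType}
    (mu : {measure set T -> \bar R}) (D : set T) (phi : T -> R) :
  (\int[mu]_(x in D) (phi x)%:E = \int[mu]_x (phi x * \1_D x)%:E)%E.
Proof.
rewrite integral_mkcond; apply: eq_integral => x _.
by rewrite patchE indicE; case: ifPn => _; rewrite ?mulr1 ?mulr0.
Qed.

Section integrated_powers.
Context {d : measure_display} {Z : measurableType d} {R : realType}.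
Variables (PP : {sigma_finite_measure set Z -> \bar R}) (X : Z -> R).
Hypothesis mX : measurable_fun setT X.
Local Notation mu := (@lebesgue_measure R).
Local Open Scope ereal_scope.

Let mXs p : measurable_fun setT (fun z : Z * measurableTypeR R => ((X z.1 + z.2) `^ p)%R).
Proof.
have m2 : measurable_fun setT (fun z : Z * measurableTypeR R => (z.2 : R)).
  exact: measurable_snd.
have m1 : measurable_fun setT (fun z : Z * measurableTypeR R => X z.1).
  exact: (measurableT_comp mX).
by apply: measurable_powR_comp; exact: measurable_funD.
Qed.

Lemma measurable_integral_powR p (E : set R) :
  measurable_fun E (fun s => \int[PP]_z ((X z + s) `^ p)%:E).
Proof.
apply: measurable_funTS.
pose F (z : Z * measurableTypeR R) : \bar R := ((X z.1 + z.2) `^ p)%:E.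
have mF : measurable_fun setT F by exact/measurable_EFinP.
have F0 z : 0 <= F z by rewrite lee_fin powR_ge0.
exact: (@measurable_fun_fubini_tonelli_G _ _ _ _ _ PP F mF F0).
Qed.

(** The power [x^(-th)] is the tail integral of [th * s^(-(th + 1))]; this raises
    the exponent to the one that [stick_step] requires. *)
Lemma integral_powR_shift th t : (0 < th)%R -> (forall z, 0 < X z + t)%R ->
  \int[PP]_z ((X z + t) `^ (- th))%:E =
  \int[mu]_(s in [set` `[t, +oo[%R])
    (th%:E * \int[PP]_z ((X z + s) `^ (- (th + 1)))%:E).
Proof.
move=> th0 Xt; set D := [set` `[t, +oo[%R].
have mD : measurable (D : set R) by exact: measurable_itv.
pose F (z : Z * measurableTypeR R) : \bar R :=
  ((th * (X z.1 + z.2) `^ (- (th + 1))) * \1_D z.2)%:E.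
have mF : measurable_fun setT F.
  apply/measurable_EFinP; apply: measurable_funM; first exact: measurable_funM.
  exact: (measurableT_comp (measurable_indic mD) measurable_snd).
have F0 z : 0 <= F z by rewrite lee_fin !mulr_ge0 ?powR_ge0// ltW.
transitivity (\int[PP]_z \int[mu]_s F (z, s)).
  apply: eq_integral => z _.
  by rewrite -integral_powR_tail// integral_mulr_indic.
transitivity (\int[mu]_s \int[PP]_z F (z, s)).
  exact: (@fubini_tonelli _ _ _ _ _ PP mu F mF F0).
rewrite [RHS]integral_mkcond; apply: eq_integral => s _.
rewrite /F /= patchE indicE; case: ifPn => sD; last first.
  by under eq_integral do rewrite mulr0; rewrite integral0.
under eq_integral do rewrite mulr1 EFinM.
rewrite ge0_integralZl//.
- by apply/measurable_EFinP; apply: measurable_powR_comp; exact: measurable_funD.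
- by move=> z _; rewrite lee_fin powR_ge0.
- by rewrite lee_fin ltW.
Qed.

End integrated_powers.

Section markov_krein.
Context {d1 d2 d : measure_display} {T1 : measurableType d1}
  {T2 : measurableType d2} {S : measurableType d} {R : realType}.
Variables (P1 : probability T1 R) (P2 : probability T2 R) (nu : probability S R).
Variables (U : nat -> {RV P1 >-> R}) (xi : nat -> {RV P2 >-> S}).
Variables (f : S -> R) (a b c al th : R).
Hypotheses (al01 : 0 < al < 1) (th0 : 0 < th).
Hypothesis indU : mutually_independent U.
Hypothesis indxi : mutually_independent xi.
Hypothesis lawU : forall n A, measurable A ->
  distribution P1 (U n) A = real_beta_law (1 - al) (th + n.+1%:R * al) A.
Hypothesis lawxi : forall n A, measurable A -> distribution P2 (xi n) A = nu A.
Hypothesis U01 : forall n w, 0 < U n w < 1.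
Hypotheses (mf : measurable_fun setT f) (fab : forall y, a <= f y <= b).
Hypotheses (a0 : 0 < a) (cab : a <= c <= b).
Local Open Scope ereal_scope.
Local Notation mu := (@lebesgue_measure R).
Local Notation L := (shifted_moment nu f (al - 1)).
Local Notation g := (power_mean nu f al).

Let al0 : (0 < al)%R. Proof. by case/andP: al01. Qed.
Let ab : (a <= b)%R. Proof. by case/andP: cab; exact: le_trans. Qed.
Let th_ (n : nat) : R := (th + n%:R * al)%R.
Let th_gt0 n : (0 < th_ n)%R.
Proof. by rewrite ltr_wpDr// mulr_ge0// ltW. Qed.
Let th_S n : (th_ n + al = th_ n.+1)%R.
Proof. by rewrite /th_ -natr1; ring. Qed.

Let St (k n : nat) (w : T1) (w' : T2) : R :=
  stick_average (fun j => U j w) (fun j => f (xi j w')) c k n.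

Let mxi j : measurable_fun setT (fun w' => f (xi j w')).
Proof. exact: measurableT_comp. Qed.

Let St_bounds k n w w' : (a <= St k n w w' <= b)%R.
Proof. by apply: stick_average_bounds. Qed.

Let mSt k n : measurable_fun setT (fun z : T1 * T2 => St k n z.1 z.2).
Proof.
apply: measurable_stick_average => j _; first exact: measurableT_comp.
exact: (measurableT_comp (mxi j)).
Qed.

Let mSt1 k n w' : measurable_fun
  (setT : set (g_sigma_algebraType (generators_of U [set~ n]))) (St k n.+1 ^~ w').
Proof.
apply: measurable_stick_average => j nj; last exact: measurable_cst.
by apply: measurable_fun_generators_of => jn; move: nj; rewrite jn ltnn.
Qed.

Let mSt2 k n w : measurable_fun
  (setT : set (g_sigma_algebraType (generators_of xi [set~ n]))) (St k n.+1 w).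
Proof.
apply: measurable_stick_average => j nj; first exact: measurable_cst.
apply: (measurableT_comp mf).
by apply: measurable_fun_generators_of => jn; move: nj; rewrite jn ltnn.
Qed.

Let St_gt0 k n w w' t : (0 < a + t)%R -> (0 < St k n w w' + t)%R.
Proof. by move=> /lt_le_trans; apply; rewrite lerD2r; case/andP: (St_bounds k n w w'). Qed.

(** The exponent [th_ n] follows the parameters of the remaining sticks. *)
Let m (k n : nat) (t : R) : \bar R :=
  \int[P1]_w \int[P2]_w' ((St k n w w' + t) `^ (- th_ n))%:E.

Let PP : probability (T1 * T2)%type R := (P1 \x P2)%E.

Let mE k n t p : \int[P1]_w \int[P2]_w' ((St k n w w' + t) `^ p)%:E =
  \int[PP]_z ((St k n z.1 z.2 + t) `^ p)%:E.
Proof.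
rewrite [RHS]fubini_tonelli1//; last by move=> z; rewrite lee_fin powR_ge0.
apply/measurable_EFinP; apply: measurable_powR_comp; exact: measurable_funD.
Qed.

Let m_ge0 k n t : 0 <= m k n t.
Proof.
by apply: integral_ge0 => w _; apply: integral_ge0 => w' _; rewrite lee_fin powR_ge0.
Qed.

(** The same recursion as for the power means, by [power_mean_volterra]. *)
Let m_volterra k n t : (0 < a + t)%R ->
  m k.+1 n t = \int[mu]_(s in [set` `[t, +oo[%R]) ((th_ n * L s)%:E * m k n.+1 s).
Proof.
move=> at0; set D := [set` `[t, +oo[%R].
have mD : measurable (D : set R) by exact: measurable_itv.
have Ds s : D s -> (0 < a + s)%R.
  by rewrite /D/= in_itv/= andbT => ts; apply: (lt_le_trans at0); rewrite lerD2l.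
rewrite [LHS]mE; pose X (z : T1 * T2) : R := St k.+1 n z.1 z.2.
transitivity (\int[mu]_(s in D)
    ((th_ n)%:E * \int[PP]_z ((X z + s) `^ (- (th_ n + 1)))%:E)).
  by apply: (@integral_powR_shift _ _ R PP X (mSt k.+1 n)) => // z; exact: St_gt0.
apply: eq_integral => s /[!inE] sD.
rewrite -mE EFinM -muleA; congr (_ * _).
rewrite /m -th_S.
apply: (@stick_step _ _ _ _ _ _ _ P1 P2 nu U xi f a b al (th_ n) s n (St k n.+1)) => //.
- by move=> A mA; rewrite th_S; exact: lawU.
- by move=> A mA; exact: lawxi.
- exact: Ds.
- by move=> w w'; apply/St_gt0/Ds.
Qed.

Let m_measurable k n E : measurable_fun E (m k n).
Proof.
have -> : m k n = (fun s => \int[PP]_z ((St k n z.1 z.2 + s) `^ (- th_ n))%:E).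
  by apply/funext => s; rewrite /m mE.
exact: (@measurable_integral_powR _ _ R PP (fun z => St k n z.1 z.2)).
Qed.

Let St_error (k n : nat) : R := stick_error al (b - a) (th_ n) k.

Let St_errorS k n : (St_error k.+1 n = St_error k n.+1 * (th_ n / (th_ n + 1)))%R.
Proof. by rewrite /St_error /= th_S. Qed.

Let St_error_ge0 k n : (0 <= St_error k n)%R.
Proof. by apply: stick_error_ge0 => //; rewrite subr_ge0. Qed.

Let volterra_step n (C : R) (u v : R -> \bar R) t : (0 < a + t)%R -> (0 <= C)%R ->
  (forall s : R, (t <= s)%R -> 0 <= u s) -> (forall s : R, (t <= s)%R -> 0 <= v s) ->
  measurable_fun [set` `[t, +oo[%R] u -> measurable_fun [set` `[t, +oo[%R] v ->
  (forall s : R, (t <= s)%R ->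
     u s <= v s + (C * (a + s) `^ (- (th_ n.+1 + 1)))%:E) ->
  \int[mu]_(s in [set` `[t, +oo[%R]) ((th_ n * L s)%:E * u s) <=
  \int[mu]_(s in [set` `[t, +oo[%R]) ((th_ n * L s)%:E * v s) +
  (C * (th_ n / (th_ n + 1)) * (a + t) `^ (- (th_ n + 1)))%:E.
Proof.
move=> at0 C0 u0 v0 mu_ mv uv; set D := [set` `[t, +oo[%R].
have mD : measurable (D : set R) by exact: measurable_itv.
have Ds (s : R) : D s -> (t <= s)%R by rewrite /D/= in_itv/= andbT.
have as0 (s : R) : D s -> (0 < a + s)%R.
  by move=> /Ds ts; apply: (lt_le_trans at0); rewrite lerD2l.
have mL : measurable_fun (D : set R) (fun s => (th_ n * L s)%:E).
  apply/measurable_EFinP; apply: measurable_funM => //.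
  apply: subspace_continuous_measurable_fun => //.
  apply/continuous_within_itvcyP; split.
    move=> s; rewrite in_itv/= andbT => ts.
    apply: (continuous_shifted_moment mf fab).
    by apply: (lt_trans at0); rewrite ltrD2l.
  by apply: cvg_at_right_filter; exact: (continuous_shifted_moment mf fab).
have L0 (s : R) : (0 <= th_ n * L s)%R.
  by rewrite mulr_ge0 ?shifted_moment_ge0// ltW.
have := volterra_error nu mf fab al01 (th_gt0 n) at0 C0.
rewrite th_S -/D => err.
apply: le_trans (leeD (lexx _) err).
rewrite -ge0_integralD//; last 4 first.
- by move=> s /Ds Ds'; rewrite mule_ge0 ?lee_fin ?v0.
- exact: emeasurable_funM.
- by move=> s _; rewrite lee_fin mulr_ge0// mulr_ge0// powR_ge0.
- apply/measurable_EFinP; apply: measurable_funM; first exact/measurable_EFinP.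
  by apply: measurable_funM => //; exact: measurable_powR_shift.
apply: ge0_le_integral => //.
- by move=> s /Ds Ds'; rewrite mule_ge0 ?lee_fin ?u0.
- by apply: emeasurable_funM.
- apply: emeasurable_funD; first by apply: emeasurable_funM.
  apply/measurable_EFinP; apply: measurable_funM; first exact/measurable_EFinP.
  by apply: measurable_funM => //; exact: measurable_powR_shift.
- move=> s /Ds Ds'; rewrite [X in _ <= _ + X]EFinM -ge0_muleDr ?v0//.
    by rewrite lee_wpmul2l ?lee_fin// uv.
  by rewrite lee_fin mulr_ge0// powR_ge0.
Qed.

(** The Lipschitz bound for [x^(-th)] between [a + t] and [b + t], by convexity. *)
Let base_error n (t x y : R) : (0 < a + t)%R ->
  (x <= (a + t) `^ (- th_ n))%R -> ((b + t) `^ (- th_ n) <= y)%R ->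
  x%:E <= y%:E + (St_error 0 n * (a + t) `^ (- (th_ n + 1)))%:E.
Proof.
move=> at0 h1 h2; rewrite -EFinD lee_fin.
apply: (le_trans h1); apply: (le_trans _ (lerD h2 (lexx _))).
have -> : ((a + t) `^ (- (th_ n + 1)) = (a + t)^-1 * (a + t) `^ (- th_ n))%R.
  rewrite -powR_inv1 ?(ltW at0)// -powRD ?(gt_eqF at0) ?implybT//.
  by congr (powR _ _); ring.
rewrite /St_error/=.
have bt0 : (0 < b + t)%R by apply: (lt_le_trans at0); rewrite lerD2r.
have r0 : (0 < (b + t) / (a + t))%R by rewrite divr_gt0.
have -> : ((b + t) `^ (- th_ n) =
    ((b + t) / (a + t)) `^ (- th_ n) * (a + t) `^ (- th_ n))%R.
  by rewrite -powRM ?(ltW r0) ?(ltW at0)// divfK// gt_eqF.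
have := powR_tangent_neg r0 (ltW (th_gt0 n)).
set q := ((_ / _) `^ _)%R => hq.
have -> : ((b - a) * th_ n * ((a + t)^-1 * (a + t) `^ (- th_ n)) =
    (th_ n * ((b + t) / (a + t) - 1)) * (a + t) `^ (- th_ n))%R.
  by field; rewrite gt_eqF.
rewrite -mulrDl -[leLHS]mul1r ler_wpM2r ?powR_ge0//.
by rewrite -lerBlDr.
Qed.

(** Both families satisfy the recursion, and for [k = 0] both lie between the same
    two powers. *)
Let m_power_mean k n t : (0 < a + t)%R ->
  m k n t <= (g (th_ n) t)%:E + (St_error k n * (a + t) `^ (- (th_ n + 1)))%:E /\
  (g (th_ n) t)%:E <= m k n t + (St_error k n * (a + t) `^ (- (th_ n + 1)))%:E.
Proof.
elim: k n t => [|k IH] n t at0.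
  have -> : m 0 n t = ((c + t) `^ (- th_ n))%:E.
    rewrite /m /St/=; under eq_integral do rewrite integral_prob_cst.
    exact: integral_prob_cst.
  have /andP[g1 g2] := power_mean_bounds nu mf fab al01 (ltW (th_gt0 n)) at0.
  have ct : (0 < c + t)%R.
    by apply: (lt_le_trans at0); rewrite lerD2r; case/andP: cab.
  split; apply: base_error => //; apply: powR_anti; rewrite ?lerD2r ?(ltW (th_gt0 n))//.
    by case/andP: cab.
  by case/andP: cab.
have vg : (g (th_ n) t)%:E = \int[mu]_(s in [set` `[t, +oo[%R])
    ((th_ n * L s)%:E * (g (th_ n.+1) s)%:E).
  have E := power_mean_volterra nu mf fab al01 (th_gt0 n) at0.
  apply: (eq_trans (esym E)); rewrite th_S.
  by apply: eq_integral => s _; rewrite EFinM.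
have as0 (s : R) : (t <= s)%R -> (0 < a + s)%R.
  by move=> ts; apply: (lt_le_trans at0); rewrite lerD2l.
have mg : measurable_fun [set` `[t, +oo[%R] (fun s => (g (th_ n.+1) s)%:E).
  by apply/measurable_EFinP; exact: (measurable_power_mean nu mf fab al01).
rewrite St_errorS m_volterra// vg; split; apply: volterra_step => //.
- by move=> s _; rewrite lee_fin powR_ge0.
- by move=> s /as0/(IH n.+1)[].
- by move=> s _; rewrite lee_fin powR_ge0.
- by move=> s /as0/(IH n.+1)[].
Qed.

(** The comparison of [m] with the power means at [t = 0], where the error
    vanishes as the truncation level grows. *)
Lemma markov_krein_truncated :
  \int[P1]_w \int[P2]_w'
    ((stick_average (fun j => U j w) (fun j => f (xi j w')) c k 0) `^ (- th))%:E
  @[k --> \oo] --> (shifted_moment nu f al 0 `^ (- (th / al)))%:E.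
Proof.
have at0 : (0 < a + 0)%R by rewrite addr0.
pose e k : R := (St_error k 0 * (a + 0) `^ (- (th_ 0 + 1)))%R.
have thE : th_ 0 = th by rewrite /th_ mul0r addr0.
have ba0 : (0 <= b - a)%R by rewrite subr_ge0.
have e0r : e k @[k --> \oo] --> (0%R : R).
  have := cvgM (stick_error_cvg0 al01 ba0 (th_gt0 0))
    (cvg_cst ((a + 0) `^ (- (th_ 0 + 1)))%R).
  by rewrite mul0r; exact.
have e0 : (e k)%:E @[k --> \oo] --> 0 by apply: cvg_EFin; [exact: nearW|exact: e0r].
have -> : (fun k => \int[P1]_w \int[P2]_w'
    ((stick_average (fun j => U j w) (fun j => f (xi j w')) c k 0) `^ (- th))%:E) =
    (fun k => m k 0 0).
  apply/funext => k; rewrite /m /St thE; apply: eq_integral => w _.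
  by apply: eq_integral => w' _; rewrite addr0.
have -> : (shifted_moment nu f al 0 `^ (- (th / al)))%R = g (th_ 0) 0 by rewrite thE.
apply: (@squeeze_cvge _ _ _ _ (fun k => (g (th_ 0) 0)%:E - (e k)%:E) _
   (fun k => (g (th_ 0) 0)%:E + (e k)%:E)).
- near=> k; have [h1 h2] := m_power_mean k 0 at0.
  by rewrite h1 andbT leeBlDr.
- rewrite -[X in _ --> X]sube0; apply: cvgeB => //; exact: cvg_cst.
- rewrite -[X in _ --> X]adde0; apply: cvgeD => //; exact: cvg_cst.
Unshelve. all: by end_near. Qed.

End markov_krein.

(** * Truncated and rearranged averages *)

Section truncated_average.
Context {R : realType}.
Implicit Types (p x y u : nat -> R) (a b c : R).

(** The missing mass is placed at [c], so that the value remains between the bounds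
    of [y] and negative powers of it remain bounded. *)
Definition truncated_average p y c (N : nat) : R :=
  \sum_(k < N) p k * y k + (1 - \sum_(k < N) p k) * c.

Lemma truncated_average_bounds p y a b c N :
  (forall k, 0 <= p k) -> \sum_(k < N) p k <= 1 ->
  (forall k, a <= y k <= b) -> a <= c <= b ->
  a <= truncated_average p y c N <= b.
Proof.
move=> p0 p1 yab /andP[ca cb]; rewrite /truncated_average.
set s := \sum_(k < N) p k in p1 *.
have s1 : 0 <= 1 - s by rewrite subr_ge0.
have h1 : s * a <= \sum_(k < N) p k * y k.
  by rewrite mulr_suml; apply: ler_sum => k _; rewrite ler_wpM2l//; case/andP: (yab k).
have h2 : \sum_(k < N) p k * y k <= s * b.
  by rewrite mulr_suml; apply: ler_sum => k _; rewrite ler_wpM2l//; case/andP: (yab k).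
have h3 := ler_wpM2l s1 ca; have h4 := ler_wpM2l s1 cb.
by apply/andP; split; lra.
Qed.

Lemma partial_sum_le1 p : (forall k, 0 <= p k) ->
  (\sum_(0 <= k <oo) (p k)%:E = 1)%E -> forall N, \sum_(k < N) p k <= 1.
Proof.
move=> p0 p1 N; rewrite -lee_fin -[leRHS]p1 -sumEFin -(big_mkord xpredT (fun k => (p k)%:E)).
by apply: nneseries_lim_ge => k _; rewrite lee_fin.
Qed.

Lemma truncated_average_cvg p y c : (forall k, 0 <= p k) -> (forall k, 0 <= y k) ->
  (\sum_(0 <= k <oo) (p k)%:E = 1)%E ->
  (truncated_average p y c N)%:E @[N --> \oo] -->
    (\sum_(0 <= k <oo) (p k * y k)%:E)%E.
Proof.
move=> p0 y0 p1.
have c1 : \sum_(k < N) p k @[N --> \oo] --> (1 : R).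
  have := @is_cvg_nneseries R (fun k => (p k)%:E) xpredT 0 (fun k _ _ => p0 k).
  rewrite p1 => h; have /fine_cvg : (\sum_(k < N) p k)%:E @[N --> \oo] --> 1%E.
    apply: cvg_trans h; apply: near_eq_cvg; apply: nearW => N.
    by rewrite big_mkord sumEFin.
  exact.
have c2 : ((1 - \sum_(k < N) p k) * c)%:E @[N --> \oo] --> 0%E.
  apply: cvg_EFin; first exact: nearW.
  have := cvgM (cvgB (cvg_cst (1 : R)) c1) (cvg_cst c).
  by rewrite subrr mul0r; exact.
have c3 : (\sum_(k < N) p k * y k)%:E @[N --> \oo] -->
    (\sum_(0 <= k <oo) (p k * y k)%:E)%E.
  have := @is_cvg_nneseries R (fun k => (p k * y k)%:E) xpredT 0
    (fun k _ _ => mulr_ge0 (p0 k) (y0 k)).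
  apply: cvg_trans; apply: near_eq_cvg; apply: nearW => N.
  by rewrite big_mkord sumEFin.
rewrite -[X in _ --> X]adde0.
have := cvgeD _ c3 c2; rewrite fin_num_adde_defl//.
by move=> /(_ _ isT); apply: cvg_trans.
Qed.

(** Sums of nonnegative terms do not depend on their order. *)
Lemma nneseries_permuted p x y (s : nat -> nat) (t : nat -> nat) :
  (forall k, 0 <= x k) -> (forall k, 0 <= y k) -> cancel s t -> cancel t s ->
  (forall n, p n = x (s n)) ->
  (\sum_(0 <= k <oo) (p k * y k)%:E = \sum_(0 <= j <oo) (x j * y (t j))%:E)%E.
Proof.
move=> x0 y0 st ts ps.
have p0 k : 0 <= p k by rewrite ps.
rewrite !nneseries_esumT; last 2 first.
- by move=> n; rewrite lee_fin mulr_ge0.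
- by move=> n; rewrite lee_fin mulr_ge0.
rewrite [RHS](@reindex_esum _ _ _ [set: nat] [set: nat] s); last first.
  split => //; first by move=> m n _ _ /(can_inj st).
  by move=> n _; exists (t n).
by apply: eq_esum => n _; rewrite ps st.
Qed.

Lemma stick_breaking_ge0 u : (forall k, 0 < u k < 1) ->
  forall n, 0 <= stick_breaking u n.
Proof.
move=> u01 n; have u1 k : 0 <= 1 - u k.
  by rewrite subr_ge0; case/andP: (u01 k) => _ /ltW.
by rewrite mulr_ge0 ?prodr_ge0//; case/andP: (u01 n) => /ltW.
Qed.

(** Unfolding the recursion from the first stick gives the explicit weights, and
    the stick left after [N] breaks is the missing mass. *)
Lemma stick_averageE u y c N :
  stick_average u y c N 0 = truncated_average (stick_breaking u) y c N.
Proof.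
have rest k : 1 - \sum_(j < k) stick_breaking u j = \prod_(j < k) (1 - u j).
  elim: k => [|k IH]; first by rewrite !big_ord0 subr0.
  by rewrite !big_ord_recr/= opprD addrA IH /stick_breaking; ring.
have gen n k : stick_average u y c k n =
    \sum_(j < k) stick_breaking (fun i => u (n + i)%N) j * y (n + j)%N +
    \prod_(j < k) (1 - u (n + j)%N) * c.
  elim: k n => [|k IH] n /=; first by rewrite !big_ord0 add0r mul1r.
  rewrite IH !big_ord_recl/= {2}/stick_breaking big_ord0 mul1r addn0.
  rewrite mulrDr addrA; congr (_ + _ + _).
    rewrite mulr_sumr; apply: eq_bigr => j _.
    have bS (i : nat) : (n + bump 0 i = n.+1 + i)%N by rewrite /bump leq0n add1n addSnnS.
    rewrite /stick_breaking big_ord_recl/= addn0 bS !mulrA; congr (_ * _ * _ * _).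
    by apply: eq_bigr => i _; rewrite bS.
  rewrite mulrA; congr (_ * _ * _).
  by apply: eq_bigr => j _; rewrite /bump leq0n add1n addSnnS.
rewrite gen /truncated_average rest; congr (_ + _).
Qed.

End truncated_average.

Section probability_convergence.
Context {d : measure_display} {T : measurableType d} {R : realType}.
Variable P : probability T R.
Local Open Scope ereal_scope.

Lemma probability_dominated_cvg (F : nat -> T -> \bar R) (G : T -> \bar R) (M : R) :
  (forall n, measurable_fun setT (F n)) -> measurable_fun setT G ->
  {ae P, forall w, F n w @[n --> \oo] --> G w} ->
  {ae P, forall w n, `|F n w| <= M%:E} ->
  \int[P]_w F n w @[n --> \oo] --> \int[P]_w G w.
Proof.
move=> mF mG FG FM.
have [||| _ _ //] := @dominated_convergence _ T R P setT measurableT F G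
  (fun=> M%:E) mF mG.
- by apply: filterS FG => w h _.
- exact: finite_measure_integrable_cst.
- by apply: filterS FM => w h n _.
Qed.

End probability_convergence.

Section exchangeability.
Context {d d' : measure_display} {R : realType} {T : measurableType d}.
Context {S : measurableType d'}.
Variables (P : probability T R) (X : nat -> {RV P >-> S}) (nu : probability S R).
Hypothesis indX : mutually_independent X.
Hypothesis lawX : forall n A, measurable A -> distribution P (X n) A = nu A.
Variables (f : S -> R) (phi : R -> \bar R).
Hypothesis mf : measurable_fun setT f.
Hypothesis mphi : measurable_fun setT phi.
Hypothesis phi0 : forall z, (0 <= phi z)%E.
Local Open Scope ereal_scope.

(** Conditioning on the last variable reduces the number of summands by one, so
    only the common law of the variables matters. *)
Lemma iid_sum_permuted (t : nat -> nat) (x : nat -> R) (N : nat) (c : R) :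
  injective t ->
  \int[P]_w phi (c + \sum_(j < N) x j * f (X (t j) w))%R =
  \int[P]_w phi (c + \sum_(j < N) x j * f (X j w))%R.
Proof.
move=> inj_t; elim: N c => [|N IH] c; first by apply: eq_integral => w _; rewrite !big_ord0.
pose psi (s : S) := \int[P]_w phi (c + x N * f s + \sum_(j < N) x j * f (X j w))%R.
have mpsi : measurable_fun setT psi.
  pose F (z : S * T) := phi (c + x N * f z.1 + \sum_(j < N) x j * f (X j z.2))%R.
  have mF : measurable_fun setT F.
    apply: (measurableT_comp mphi); apply: measurable_funD.
      apply: measurable_funD => //; apply: measurable_funM => //.
      exact: (measurableT_comp mf).
    apply: measurable_sum => j; apply: measurable_funM => //.
    apply: (measurableT_comp mf); exact: measurableT_comp.
  exact: (@measurable_fun_fubini_tonelli_F _ _ _ _ _ P F mF (fun z => phi0 _)).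
have psi0 s : 0 <= psi s by apply: integral_ge0.
suff key (r : nat -> nat) : injective r ->
    (forall c, \int[P]_w phi (c + \sum_(j < N) x j * f (X (r j) w))%R =
       \int[P]_w phi (c + \sum_(j < N) x j * f (X j w))%R) ->
    \int[P]_w phi (c + \sum_(j < N.+1) x j * f (X (r j) w))%R =
    \int[nu]_s psi s.
  by rewrite (key t)// (key id).
move=> inj_r IHr.
pose k := r N.
have mI : measurable_fun setT (id : T -> g_sigma_algebraType (generators_of X [set~ k])).
  by move=> _ A sA; rewrite setTI; exact: (sub_sigma_of sA).
pose Im : {mfun T >-> g_sigma_algebraType (generators_of X [set~ k])} :=
  mfun_Sub (mem_set mI).
pose F (z : S * g_sigma_algebraType (generators_of X [set~ k])) :=
  phi (c + x N * f z.1 + \sum_(j < N) x j * f (X (r j) z.2))%R.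
have indH A B : measurable A -> measurable B ->
    P ((X k @^-1` A) `&` (Im @^-1` B)) = P (X k @^-1` A) * P (Im @^-1` B).
  by move=> mA mB; rewrite setIC muleC; exact: independent_of_rest.
have mF : measurable_fun setT F.
  apply: (measurableT_comp mphi); apply: measurable_funD.
    apply: measurable_funD => //; apply: measurable_funM => //.
    exact: (measurableT_comp mf).
  apply: measurable_sum => j; apply: measurable_funM => //.
  apply: (measurableT_comp mf); apply: measurableT_comp => //.
  apply: measurable_fun_generators_of => /inj_r jN.
  by have := ltn_ord j; rewrite jN ltnn.
have F0 z : 0 <= F z by exact: phi0.
transitivity (\int[P]_w F (X k w, Im w)).
  apply: eq_integral => w _; rewrite /F/= big_ord_recr/=; congr phi.
  by rewrite -/k; ring.
rewrite (integral_indep_pair indH mF F0).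
transitivity (\int[P]_w psi (X k w)).
  by apply: eq_integral => w _; rewrite /F/= IHr.
rewrite -(@ge0_integral_distribution _ _ _ _ _ P (X k) psi)//.
by apply: eq_measure_integral => A mA _; exact: lawX.
Qed.

End exchangeability.

(** * The Markov--Krein identity for random weights *)

Section borel_measurability.
Context {R : realType} {X : ptopologicalType}.

Lemma continuous_borel_measurable (f : X -> R) : continuous f ->
  measurable_fun (setT : set (borel X)) f.
Proof.
move=> /continuousP cf.
apply: (measurability _ (RGenOpens.measurableE R)) => _ [_ [x [y ->] <-]].
rewrite setTI; apply: sub_sigma_algebra; apply: cf; exact: interval_open.
Qed.

Lemma Cb_of_bounds (f : X -> R) (a b : R) : continuous f ->
  (forall y, a <= f y <= b) -> Cb R X f.
Proof.
move=> cf fab; split=> //; exists (`|a| + `|b|); split; first exact: num_real.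
move=> M hM y _; apply/ltW/(le_lt_trans _ hM); have /andP[h1 h2] := fab y.
rewrite ler_norml; apply/andP; split.
  apply: le_trans h1; rewrite lerNl (le_trans (ler_norm _))// normrN lerDl//.
by apply: (le_trans h2); rewrite (le_trans (ler_norm _))// lerDr.
Qed.

Lemma continuous_M1_integral (f : X -> R) : Cb R X f ->
  continuous (fun mu : M1 R X => (\int[mu]_x f x)%R).
Proof.
move=> Cf; pose F : Cb R X := exist _ f (mem_set Cf).
have -> : (fun mu : M1 R X => (\int[mu]_x f x)%R) =
    (proj F) \o (@M1_eval R X) by [].
move=> mu; apply: continuous_comp; first exact: initial_continuous.
exact: proj_continuous.
Qed.

(** The evaluation is continuous, and the Borel sets of the weak topology are
    generated by its open sets. *)
Lemma measurable_M1_integral (f : X -> R) : Cb R X f ->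
  measurable_fun (setT : set (borel (M1 R X)))
    (fun mu : M1 R X => (\int[mu]_x f x)%R).
Proof.
move=> /continuous_M1_integral /continuousP cf.
apply: (measurability _ (RGenOpens.measurableE R)) => _ [_ [x [y ->] <-]].
rewrite setTI; apply: sub_sigma_algebra; apply: cf; exact: interval_open.
Qed.

End borel_measurability.

Section discrete_integral.
Context {d : measure_display} {T : measurableType d} {R : realType}.
Local Open Scope ereal_scope.

Lemma integral_discrete (m : probability T R) (p : nat -> R) (z : nat -> T)
    (g : T -> R) :
  (forall k, (0 <= p k)%R) ->
  (forall A, measurable A -> m A = \sum_(0 <= k <oo) ((p k)%:E * \d_(z k) A)) ->
  measurable_fun setT g -> (forall y, (0 <= g y)%R) ->
  \int[m]_y (g y)%:E = \sum_(0 <= k <oo) (p k * g (z k))%:E.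
Proof.
move=> p0 mE mg g0.
pose ms k := mscale (NngNum (p0 k)) (@dirac _ T (z k) R).
transitivity (\int[mseries ms 0]_y (g y)%:E).
  by apply: eq_measure_integral => A mA _; exact: mE.
rewrite ge0_integral_measure_series//; last 2 first.
- by move=> y _; rewrite lee_fin.
- exact/measurable_EFinP.
apply: eq_eseriesr => k _.
rewrite ge0_integral_mscale//; last 2 first.
- exact/measurable_EFinP.
- by move=> y _; rewrite lee_fin.
by rewrite integral_dirac ?diracT ?mul1e//; exact/measurable_EFinP.
Qed.

End discrete_integral.

Section negative_powers.
Context {R : realType}.

Lemma cvg_powR_neg (u : nat -> R) (L : \bar R) (a b th : R) :
  0 < a -> (forall N, a <= u N <= b) -> (u N)%:E @[N --> \oo] --> L ->
  (u N `^ (- th))%:E @[N --> \oo] --> (fine L `^ (- th))%:E.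
Proof.
move=> a0 uab uL.
have cL : cvgn (fun N => (u N)%:E) by apply/cvg_ex; exists L.
have LE : limn (fun N => (u N)%:E) = L by exact/cvg_lim.
have La : (a%:E <= L)%E.
  rewrite -LE; apply: lime_ge => //; apply: nearW => N.
  by rewrite lee_fin; case/andP: (uab N).
have Lb : (L <= b%:E)%E.
  rewrite -LE; apply: lime_le => //; apply: nearW => N.
  by rewrite lee_fin; case/andP: (uab N).
clear cL LE; case: L => [l| |] in uL La Lb *; [|by rewrite leNgt ltry in Lb|by rewrite leNgt ltNyr in La].
rewrite lee_fin in La.
apply: cvg_EFin; first exact: nearW.
have ul : u N @[N --> \oo] --> l by exact: (fine_cvg uL).
have l0 := lt_le_trans a0 La.
have cl : {for l, continuous (fun z : R => z `^ (- th))}.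
  apply/differentiable_continuous/derivable1_diffP.
  by case: (is_derive1_powR (- th) l0).
exact: (cvg_comp u (fun z : R => z `^ (- th)) ul cl).
Qed.

Lemma powR_neg_le (a z th : R) : 0 < a -> a <= z -> 0 <= th ->
  (`|(z `^ (- th))%:E| <= (a `^ (- th))%:E)%E.
Proof.
by move=> a0 az th0; rewrite lee_fin ger0_norm ?powR_ge0// powR_anti.
Qed.

End negative_powers.

Section dirichlet_core.
Context {d : measure_display} {Om : measurableType d} {R : realType}.
Context {d' : measure_display} {S : measurableType d'}.
Variables (P : probability Om R) (U p : nat -> {RV P >-> R}).
Variables (xi : nat -> {RV P >-> S}) (nu : probability S R).
Variables (f : S -> R) (a b al th : R) (Z : Om -> R).
Hypotheses (al01 : 0 < al < 1) (th0 : 0 < th).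
Hypothesis indU : mutually_independent U.
Hypothesis lawU : forall n A, measurable A ->
  distribution P (U n) A = real_beta_law (1 - al) (th + n.+1%:R * al) A.
Hypothesis U01 : forall n w, 0 < U n w < 1.
Hypothesis indxi : mutually_independent xi.
Hypothesis lawxi : forall n A, measurable A -> distribution P (xi n) A = nu A.
Hypothesis indp : independent_sequences xi p.
Hypotheses (mf : measurable_fun setT f) (fab : forall y, a <= f y <= b).
Hypothesis a0 : 0 < a.
Hypothesis mZ : measurable_fun setT Z.
Hypothesis good : {ae P, forall w,
  [/\ descending_arrangement (stick_breaking (fun k => U k w)) (fun k => p k w),
      (\sum_(0 <= k <oo) (p k w)%:E = 1)%E &
      ((Z w)%:E = \sum_(0 <= k <oo) (p k w * f (xi k w))%:E)%E]}.
Local Open Scope ereal_scope.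

Let phi (z : R) : \bar R := (z `^ (- th))%:E.
Let phi0 z : 0 <= phi z. Proof. by rewrite lee_fin powR_ge0. Qed.
Let mphi : measurable_fun setT phi.
Proof. apply/measurable_EFinP; exact: measurable_powR. Qed.
Let M : R := (a `^ (- th))%R.
Let phiM z : (a <= z)%R -> `|phi z| <= M%:E.
Proof. by move=> az; apply: powR_neg_le => //; exact: ltW. Qed.

Let mfxi k : measurable_fun setT (fun w => f (xi k w)).
Proof. exact: measurableT_comp. Qed.

Let F (N : nat) (w w' : Om) : R :=
  truncated_average (fun k => p k w) (fun k => f (xi k w')) a N.
Let G (N : nat) (w w' : Om) : R :=
  stick_average (fun j => U j w) (fun j => f (xi j w')) a N 0.

Let a_ab : (a <= a <= b)%R.
Proof. by rewrite lexx /=; have /andP[] := fab (xi 0%N point); exact: le_trans. Qed.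

Let f0 y : (0 <= f y)%R.
Proof. by have /andP[h _] := fab y; apply: le_trans h; exact: ltW. Qed.

Let G_bounds N w w' : (a <= G N w w' <= b)%R.
Proof. exact: stick_average_bounds. Qed.

Lemma measurable_truncated_average {d0} {T0 : measurableType d0}
    (u y : nat -> T0 -> R) (c : R) N :
  (forall k, measurable_fun setT (u k)) -> (forall k, measurable_fun setT (y k)) ->
  measurable_fun setT
    (fun z => truncated_average (fun k => u k z) (fun k => y k z) c N).
Proof.
move=> mu my; apply: measurable_funD.
  by apply: measurable_sum => k; exact: measurable_funM.
apply: measurable_funM => //; apply: measurable_funB => //.
exact: measurable_sum.
Qed.

Let mF N : measurable_fun setT (fun z : Om * Om => phi (F N z.1 z.2)).
Proof.
apply: (measurableT_comp mphi); apply: measurable_truncated_average => k.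
  exact: measurableT_comp.
exact: (measurableT_comp (mfxi k)).
Qed.

Let mG N : measurable_fun setT (fun z : Om * Om => phi (G N z.1 z.2)).
Proof.
apply: (measurableT_comp mphi); apply: measurable_stick_average => k _.
  exact: measurableT_comp.
exact: (measurableT_comp (mfxi k)).
Qed.

(** The weights and the atoms are independent, so that a second copy of the atoms
    may be averaged with the weights held fixed. *)
Let F_diag N : \int[P]_w phi (F N w w) = \int[P]_w \int[P]_w' phi (F N w w').
Proof.
pose Tp := g_sigma_algebraType (generators_of p setT).
pose Tx := g_sigma_algebraType (generators_of xi setT).
have mp : measurable_fun setT (id : Om -> Tp).
  by move=> _ A sA; rewrite setTI; exact: (sub_sigma_of sA).
have mx : measurable_fun setT (id : Om -> Tx).
  by move=> _ A sA; rewrite setTI; exact: (sub_sigma_of sA).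
pose Ip : {mfun Om >-> Tp} := mfun_Sub (mem_set mp).
pose Ix : {mfun Om >-> Tx} := mfun_Sub (mem_set mx).
have ind A B : measurable A -> measurable B ->
    P ((Ip @^-1` A) `&` (Ix @^-1` B)) = P (Ip @^-1` A) * P (Ix @^-1` B).
  by move=> mA mB; rewrite setIC muleC; exact: indp.
pose H (z : Tp * Tx) := phi (F N z.1 z.2).
have mH : measurable_fun setT H.
  apply: (measurableT_comp mphi); apply: measurable_truncated_average => k.
    by apply: measurableT_comp => //; exact: measurable_fun_generators_of.
  apply: (measurableT_comp mf); apply: measurableT_comp => //.
  exact: measurable_fun_generators_of.
exact: (integral_indep_pair ind mH (fun z => phi0 _)).
Qed.

(** For fixed weights both truncations converge, in law, to the same average of
    exchangeable variables: the two enumerations of the weights differ by a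
    permutation only. *)
Let fixed_weights w : 
  [/\ descending_arrangement (stick_breaking (fun k => U k w)) (fun k => p k w),
      (\sum_(0 <= k <oo) (p k w)%:E = 1)%E &
      ((Z w)%:E = \sum_(0 <= k <oo) (p k w * f (xi k w))%:E)%E] ->
  [/\ forall N w', (a <= F N w w' <= b)%R,
      phi (F N w w) @[N --> \oo] --> phi (Z w) &
      exists H : \bar R,
        (\int[P]_w' phi (F N w w') @[N --> \oo] --> H) /\
        (\int[P]_w' phi (G N w w') @[N --> \oo] --> H)].
Proof.
move=> [[_ [s [[t st ts] ps]]] p1 ZE].
set x := stick_breaking _ in ps.
have x0 k : (0 <= x k)%R by exact: stick_breaking_ge0.
have p0 k : (0 <= p k w)%R by rewrite ps.
have psum N : (\sum_(k < N) p k w <= 1)%R.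
  exact: (partial_sum_le1 (p := fun k => p k w)).
have Fab N w' : (a <= F N w w' <= b)%R by apply: truncated_average_bounds.
have Fcvg w' : phi (F N w w') @[N --> \oo] -->
    phi (fine (\sum_(0 <= k <oo) (p k w * f (xi k w'))%:E)).
  apply: (@cvg_powR_neg _ (fun N => F N w w') _ a b) => //.
  exact: (truncated_average_cvg (p := fun k => p k w)).
split => //; first by have := Fcvg w; rewrite -ZE.
exists (\int[P]_w' phi (fine (\sum_(0 <= k <oo) (p k w * f (xi k w'))%:E))).
have mFw N : measurable_fun setT (fun w' => phi (F N w w')).
  exact: (measurableT_comp (mF N) (pair1_measurable w)).
have mlim : measurable_fun setT
    (fun w' => phi (fine (\sum_(0 <= k <oo) (p k w * f (xi k w'))%:E))).
  by apply: (emeasurable_fun_cvg (fun N w' => phi (F N w w'))) => // w' _; exact: Fcvg.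
split.
  apply: (probability_dominated_cvg (M := M)) => //; first exact: aeW.
  by apply: aeW => w' N; apply: phiM; case/andP: (Fab N w').
pose F' N w' := truncated_average x (fun j => f (xi (t j) w')) a N.
have x1 : (\sum_(0 <= k <oo) (x k)%:E = 1)%E.
  have := nneseries_permuted x0 (fun=> ler01) st ts ps.
  under eq_eseriesr do rewrite mulr1; rewrite p1 => ->.
  by apply: eq_eseriesr => k _; rewrite mulr1.
have F'ab N w' : (a <= F' N w' <= b)%R.
  by apply: truncated_average_bounds => //; exact: partial_sum_le1.
have F'cvg w' : phi (F' N w') @[N --> \oo] -->
    phi (fine (\sum_(0 <= k <oo) (p k w * f (xi k w'))%:E)).
  apply: (@cvg_powR_neg _ (fun N => F' N w') _ a b) => //.
  rewrite (nneseries_permuted (y := fun k => f (xi k w')) x0 _ st ts ps)//.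
  exact: truncated_average_cvg.
have -> : (fun N => \int[P]_w' phi (G N w w')) = (fun N => \int[P]_w' phi (F' N w')).
  apply/funext => N; pose c : R := ((1 - \sum_(k < N) x k) * a)%R.
  have := iid_sum_permuted indxi lawxi mf mphi phi0 x N c (can_inj ts).
  move=> E; transitivity (\int[P]_w' phi (c + \sum_(j < N) x j * f (xi j w'))%R).
    apply: eq_integral => w' _.
    by rewrite /G stick_averageE /truncated_average addrC.
  rewrite -E; apply: eq_integral => w' _.
  by rewrite /F' /truncated_average addrC.
apply: (probability_dominated_cvg (M := M)) => //; last 2 first.
- exact: aeW.
- by apply: aeW => w' N; apply: phiM; case/andP: (F'ab N w').
move=> N; apply: (measurableT_comp mphi).
apply: (@measurable_truncated_average _ _ (fun k _ => x k) (fun k w' => f (xi (t k) w'))) => k //.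
Qed.

Let section_le (h : Om -> R) : measurable_fun setT h -> (forall w', (a <= h w')%R) ->
  `|\int[P]_w' phi (h w')| <= M%:E.
Proof.
move=> mh ah; rewrite gee0_abs; last exact: integral_ge0.
rewrite -(integral_prob_cst P M); apply: ge0_le_integral => //.
- exact: (measurableT_comp mphi).
- by move=> w' _; apply: le_trans (phiM (ah w')); rewrite gee0_abs.
Qed.

(** With the weights held fixed, the average over the atoms has the same limit for
    the descending order as for the order of the sticks; the latter is
    [markov_krein_truncated]. *)
Lemma markov_krein_weighted_sum :
  \int[P]_w (Z w `^ (- th))%:E = (shifted_moment nu f al 0 `^ (- (th / al)))%:E.
Proof.
have mFs N w : measurable_fun setT (F N w).
  apply: (measurable_truncated_average (u := fun k _ => p k w)
    (y := fun k w' => f (xi k w'))) => // k; exact: mfxi.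
have mGs N w : measurable_fun setT (G N w).
  by apply: (measurable_stick_average (u := fun k _ => U k w)
    (y := fun k w' => f (xi k w'))) => // k _; exact: mfxi.
pose RG N w := \int[P]_w' phi (G N w w').
pose RF N w := \int[P]_w' phi (F N w w').
have mRG N : measurable_fun setT (RG N).
  exact: (@measurable_fun_fubini_tonelli_F _ _ _ _ _ P _ (mG N) (fun z => phi0 _)).
have mRF N : measurable_fun setT (RF N).
  exact: (@measurable_fun_fubini_tonelli_F _ _ _ _ _ P _ (mF N) (fun z => phi0 _)).
(* the limit exists almost everywhere only; the upper limit is measurable *)
pose W w := limn_esup (RG ^~ w).
have mW : measurable_fun setT W by exact: measurable_fun_limn_esup.
have RGW : {ae P, forall w, RG N w @[N --> \oo] --> W w}.
  apply: filterS good => w /fixed_weights[_ _ [H [_ GH]]].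
  have -> : W w = H by exact: (cvg_limn_einf_sup GH).2.
  exact: GH.
have RFW : {ae P, forall w, RF N w @[N --> \oo] --> W w}.
  apply: filterS good => w /fixed_weights[_ _ [H [FH GH]]].
  have -> : W w = H by exact: (cvg_limn_einf_sup GH).2.
  exact: FH.
have iG : \int[P]_w RG N w @[N --> \oo] --> \int[P]_w W w.
  apply: (probability_dominated_cvg (M := M) mRG mW RGW).
  by apply: aeW => w N; apply: section_le => // w'; case/andP: (G_bounds N w w').
have iF : \int[P]_w RF N w @[N --> \oo] --> \int[P]_w W w.
  apply: (probability_dominated_cvg (M := M) mRF mW RFW).
  apply: filterS good => w /fixed_weights[Fab _ _] N.
  by apply: section_le => // w'; case/andP: (Fab N w').
have iZ : \int[P]_w phi (F N w w) @[N --> \oo] --> \int[P]_w phi (Z w).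
  apply: (probability_dominated_cvg (M := M)).
  - move=> N; apply: (measurableT_comp mphi).
    exact: (measurable_truncated_average (u := fun k w => p k w)
      (y := fun k w => f (xi k w))).
  - exact: (measurableT_comp mphi).
  - by apply: filterS good => w /fixed_weights[].
  - apply: filterS good => w /fixed_weights[Fab _ _] N.
    by apply: phiM; case/andP: (Fab N w).
rewrite (funext F_diag) in iZ.
have iK := markov_krein_truncated al01 th0 indU indxi lawU lawxi U01 mf fab a0 a_ab.
have E1 := cvg_unique (@ereal_hausdorff R) iZ iF.
have E2 := cvg_unique (@ereal_hausdorff R) iG iK.
by rewrite [LHS]E1 E2.
Qed.

End dirichlet_core.

(** * The Markov--Krein identity for the Dirichlet process *)

Section clip.
Context {R : realType}.
Local Notation I := (`]0, 1[%classic : set R).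

(** A beta variable lies strictly between 0 and 1 almost surely only; clipping it
    makes this hold everywhere, and changes neither its law nor independence. *)
Definition clip01 (z : R) : R := z * \1_I z + 2^-1 * \1_(~` I) z.

Lemma clip01_id z : 0 < z < 1 -> clip01 z = z.
Proof.
move=> z01; have Iz : I z by rewrite /= in_itv.
by rewrite /clip01 !indicE mem_set// memNset ?mulr1 ?mulr0 ?addr0//; apply.
Qed.

Lemma clip01_in z : 0 < clip01 z < 1.
Proof.
have [z01|z01] := boolP (0 < z < 1); first by rewrite clip01_id.
have nIz : ~ I z by rewrite /= in_itv/= => h; rewrite h in z01.
rewrite /clip01 !indicE memNset// mem_set// mulr0 mulr1 add0r.
by rewrite invr_gt0 invf_lt1// ltr0n ltr1n.
Qed.

Lemma measurable_clip01 : measurable_fun setT clip01.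
Proof.
have mI : measurable (I : set R) by exact: measurable_itv.
apply: measurable_funD; apply: measurable_funM => //.
by apply: measurable_indic; exact: measurableC.
Qed.

End clip.

Section dirichlet_markov_krein.
Context {R : realType} {X : ptopologicalType}.
Variables (th al : R) (nu : M1 R X) (Q : probability (borel (M1 R X)) R).
Hypotheses (al01 : 0 < al < 1) (th0 : 0 < th).
Hypothesis lawQ : dirichlet_process_law th al nu Q.
Variables (f : X -> R) (a b : R).
Hypotheses (cf : continuous f) (a0 : 0 < a) (fab : forall y, a <= f y <= b).

(** The integral of [f] for the random measure is the weighted sum of its values at
    the atoms, so that [markov_krein_weighted_sum] applies after clipping. *)
Theorem dirichlet_markov_krein :
  (\int[Q]_mu ((\int[(mu : M1 R X)]_y f y)%R `^ (- th))%:E =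
   ((\int[nu]_y (f y `^ al))%R `^ (- (th / al)))%:E)%E.
Proof.
move: lawQ => [d [Om [P [U [p [xi [Xi [[indU lawU] [desc [[indxi lawxi] [indp [XiE QE]]]]]]]]]]]].
have mf : measurable_fun (setT : set (borel X)) f by exact: continuous_borel_measurable.
have Cf : Cb R X f by exact: (Cb_of_bounds cf fab).
have mev := measurable_M1_integral Cf.
have f0 y : 0 <= f y by have /andP[h _] := fab y; apply: le_trans h; exact: ltW.
have mU k : measurable_fun setT (fun w => clip01 (U k w)).
  by apply: measurableT_comp => //; exact: measurable_clip01.
pose U' k : {RV P >-> R} := mfun_Sub (mem_set (mU k)).
have mclip (A : set R) : measurable A -> measurable (clip01 @^-1` A).
  by move=> mA; rewrite -[X in measurable X]setTI; exact: measurable_clip01.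
have indU' : mutually_independent U'.
  by move=> J A mA; exact: (indU J (fun j => clip01 @^-1` A j) (fun j => mclip _ (mA j))).
have lawU' n A : measurable A ->
    distribution P (U' n) A = real_beta_law (1 - al) (th + n.+1%:R * al) A.
  move=> mA; have := lawU n _ (mclip _ mA).
  have -> : real_beta_law (1 - al) (th + n.+1%:R * al) (clip01 @^-1` A) =
      real_beta_law (1 - al) (th + n.+1%:R * al) A.
    rewrite /real_beta_law; congr (integral _ _ _); apply/seteqP.
    by split=> z /= [Az]; rewrite in_itv/= => z01; move: Az; rewrite clip01_id.
  exact.
have U'01 n w : 0 < U' n w < 1 by exact: clip01_in.
have UU' : {ae P, forall w, forall n, U' n w = U n w}.
  apply: ae_foralln => n; apply: filterS (beta_law_support (lawU n)) => w h.
  exact: clip01_id.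
pose Z (w : Om) : R := \int[(Xi w : M1 R X)]_y f y.
have mZ : measurable_fun setT Z by exact: (measurableT_comp mev).
have good : {ae P, forall w,
  [/\ descending_arrangement (stick_breaking (fun k => U' k w)) (fun k => p k w),
      (\sum_(0 <= k <oo) (p k w)%:E = 1)%E &
      ((Z w)%:E = \sum_(0 <= k <oo) (p k w * f (xi k w))%:E)%E]}.
  apply: filterS3 UU' desc XiE => w Uw dw Xw.
  have dw' : descending_arrangement (stick_breaking (fun k => U' k w)) (fun k => p k w).
    by rewrite (funext Uw).
  have p0 k : 0 <= p k w.
    have [_ [s [_ ->]]] := dw'; exact: stick_breaking_ge0.
  split => //.
    have := Xw setT measurableT.
    under eq_eseriesr do rewrite diracT mule1.
    move=> <-; exact: probability_setT.
  have iF : (Xi w : M1 R X).-integrable setT (EFin \o f).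
    apply: measurable_bounded_integrable => //.
      by rewrite (le_lt_trans (probability_le1 _ _)) ?ltry.
    have [_ [M [Mr hM]]] := Cf; exists M; split => // M' MM' y _; exact: hM.
  rewrite -(integral_discrete p0 Xw mf f0) /Z /Rintegral fineK//.
  exact: (integrable_fin_num _ iF).
have := markov_krein_weighted_sum al01 th0 indU' lawU' U'01 indxi lawxi indp mf fab a0 mZ good.
rewrite /shifted_moment; under eq_Rintegral do rewrite addr0.
move=> <-.
pose psi (mu : borel (M1 R X)) : \bar R := ((\int[(mu : M1 R X)]_y f y)%R `^ (- th))%:E.
have mpsi : measurable_fun setT psi.
  by apply/measurable_EFinP; exact: measurable_powR_comp.
transitivity (\int[distribution P Xi]_mu psi mu)%E.
  by apply: eq_measure_integral => A mA _; exact: QE.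
by rewrite ge0_integral_distribution// => mu; rewrite lee_fin powR_ge0.
Qed.

End dirichlet_markov_krein.

(** * The weak topology and the unit interval *)

Section weak_topology_M1.
Context {R : realType} {X : ptopologicalType}.

(** The weak topology is initial for the evaluations. *)
Lemma M1_cvg (F : set_system (M1 R X)) (mu : M1 R X) : Filter F ->
  (forall f : X -> R, Cb R X f ->
    (\int[(m : M1 R X)]_x f x)%R @[m --> F] --> (\int[mu]_x f x)%R) ->
  F --> mu.
Proof.
move=> FF cF.
have cP : (@M1_eval R X) m @[m --> F] --> (@M1_eval R X mu).
  apply/cvg_sup => -f; have Cf : Cb R X (set_val f) by exact: set_valP.
  move=> A [_ [[W oW <-] /= Wf] WA].
  apply: filterS WA _ => /=.
  by apply: (cF _ Cf W); rewrite nbhsE; exists W.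
move=> A [_ [[W oW <-] /= Wf] WA].
apply: filterS WA _ => /=.
by apply: cP; rewrite nbhsE; exists W.
Qed.

Definition basic_nbhd (mu : M1 R X) (gs : seq (X -> R)) (e : R) : set (M1 R X) :=
  [set m : M1 R X | forall i, (i < size gs)%N ->
    `|(\int[m]_x (nth (fun=> 0) gs i x))%R -
      (\int[mu]_x (nth (fun=> 0) gs i x))%R| < e].

(** The supersets of these basic sets form a filter, which converges to [mu] by
    [M1_cvg], hence contains the neighbourhoods of [mu]. *)
Lemma M1_basic_nbhd (mu : M1 R X) (A : set (M1 R X)) : nbhs mu A ->
  exists (gs : seq (X -> R)) (e : R),
    [/\ 0 < e, forall i, (i < size gs)%N -> Cb R X (nth (fun=> 0) gs i) &
        basic_nbhd mu gs e `<=` A].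
Proof.
pose F : set_system (M1 R X) := [set A | exists (gs : seq (X -> R)) (e : R),
    [/\ 0 < e, forall i, (i < size gs)%N -> Cb R X (nth (fun=> 0) gs i) &
        basic_nbhd mu gs e `<=` A]].
have FF : Filter F.
  split.
  - by exists [::], 1; split.
  - move=> B C [gs [e [e0 Cgs gsB]]] [gs' [e' [e'0 Cgs' gsC]]].
    exists (gs ++ gs'), (Num.min e e'); split.
    + by rewrite lt_min e0.
    + move=> i; rewrite size_cat nth_cat; case: (ltnP i (size gs)) => [igs _|igs ii].
        exact: Cgs.
      by apply: Cgs'; rewrite ltn_subLR.
    + move=> m hm; split.
        apply: gsB => i ii; have := hm i; rewrite size_cat nth_cat ii.
        by rewrite ltn_addr// lt_min => /(_ isT)/andP[].
      apply: gsC => i ii; have := hm (size gs + i)%N.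
      rewrite size_cat nth_cat ltn_add2l ii ltnNge leq_addr/= addKn.
      by rewrite lt_min => /(_ isT)/andP[].
  - by move=> B C BC [gs [e [e0 Cgs gsB]]]; exists gs, e; split => // m /gsB/BC.
suff : F --> mu by move=> Fmu /Fmu.
apply: M1_cvg => f Cf; apply/cvgrPdist_lt => e e0.
exists [:: f], e; split => //; first by case.
by move=> m /(_ 0%N isT)/=; rewrite distrC.
Qed.

End weak_topology_M1.

Lemma ultra_bounded_cvg {T : Type} {R : realType} (F : set_system T) (g : T -> R) :
  UltraFilter F -> (forall x, 0 <= g x <= 1) -> exists l : R, g x @[x --> F] --> l.
Proof.
move=> UF g01.
have PF : ProperFilter (g x @[x --> F]) by exact: fmap_proper_filter.
have FI : (g x @[x --> F]) `[0, 1]%classic.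
  rewrite /fmap/=; apply: filterE => x; have /andP[h1 h2] := g01 x; rewrite /preimage/= in_itv/= h1 h2.
  by [].
have [l [_ cl]] := segment_compact PF FI.
exists l => A Al /=.
have [//|nA] := in_ultra_setVsetC (g @^-1` A) UF.
have [y [/= yA yA']] := cl (~` A) A nA Al.
by [].
Qed.

Section unit_interval_facts.
Context {R : realType}.
Local Notation E := (unit_interval R).
Local Notation I := [set` `[0 : R, 1]].

Definition uval (t : E) : R := set_val (t : set_type I).

Lemma uval_itv t : 0 <= uval t <= 1.
Proof. by have := @set_valP R I t; rewrite /= in_itv. Qed.

Lemma uval_inj : injective uval.
Proof. exact: val_inj. Qed.

Lemma continuous_uval : continuous uval.
Proof. exact: (@initial_continuous (set_type I) R set_val). Qed.

Lemma uclamp_subproof (y : R) : Num.max 0 (Num.min 1 y) \in I.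
Proof. by rewrite inE /= in_itv/= le_max lexx ge_max ler01 ge_min lexx. Qed.

Definition uclamp (y : R) : E := exist _ (Num.max 0 (Num.min 1 y)) (uclamp_subproof y).

Lemma uval_uclamp y : uval (uclamp y) = Num.max 0 (Num.min 1 y).
Proof. by []. Qed.

Lemma uval_uclamp_id y : 0 <= y <= 1 -> uval (uclamp y) = y.
Proof. by move=> /andP[y0 y1]; rewrite uval_uclamp min_r// max_r. Qed.

Lemma uclampK t : uclamp (uval t) = t.
Proof. by apply: uval_inj; rewrite uval_uclamp_id ?uval_itv. Qed.

Lemma continuous_uclamp : continuous uclamp.
Proof.
apply: (@continuous_comp_initial _ _ _ (set_val : set_type I -> R)).
move=> y; apply: (@continuous_comp _ _ _ (fun y : R => Num.min 1 y) (fun z => Num.max 0 z)).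
  by apply: continuous_min; [exact: cvg_cst|exact: cvg_id].
by apply: continuous_max; [exact: cvg_cst|exact: cvg_id].
Qed.

Lemma compact_unit_interval : compact [set: E].
Proof.
have -> : [set: E] = uclamp @` `[0, 1]%classic.
  apply/seteqP; split => // t _; exists (uval t); last exact: uclampK.
  by rewrite /= in_itv/= uval_itv.
apply: continuous_compact; last exact: segment_compact.
exact: continuous_subspaceT continuous_uclamp.
Qed.

(** Otherwise a sequence of bad pairs would have a cluster point, at which
    continuity fails. *)
Lemma unit_interval_uniform_continuity (f : E -> R) (e : R) : continuous f -> 0 < e ->
  exists n : nat, forall s t, `|uval s - uval t| <= n.+1%:R^-1 -> `|f s - f t| <= e.
Proof.
move=> cf e0; apply: contrapT => nh.
have {}nh n : exists st : E * E, `|uval st.1 - uval st.2| <= n.+1%:R^-1 /\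
    ~ `|f st.1 - f st.2| <= e.
  apply: contrapT => h; apply: nh; exists n => s t st.
  by apply: contrapT => h'; apply: h; exists (s, t).
have [st hst] := choice nh.
have PF : ProperFilter (fst (st n) @[n --> \oo]) by exact: fmap_proper_filter.
have FT : (fst (st n) @[n --> \oo]) setT by exact: filterT.
have [p [_ clp]] := compact_unit_interval PF FT.
have e2 : 0 < e / 2 by rewrite divr_gt0.
have /cvgrPdist_lt/(_ _ e2) := cf p.
move=> fe2.
have cv : \forall s \near p, `|f p - f s| < e / 2 by exact: fe2.
have [r r0 rW] : exists2 r : R, 0 < r &
    forall s, `|uval p - uval s| < r -> `|f p - f s| < e / 2.
  by have /nbhs_ballP[r /= r0 rW] := cv; exists r => // s ps; exact: rW.
have r2 : 0 < r / 2 by rewrite divr_gt0.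
have [N hN] : exists N : nat, forall n, (N <= n)%N -> n.+1%:R^-1 <= r / 2.
  exists (Num.truncn (r / 2)^-1) => n Nn.
  rewrite -[leRHS]invrK lef_pV2 ?posrE ?invr_gt0//.
  apply/ltW/(lt_le_trans (truncnS_gt _)); by rewrite ler_nat.
have FN : (fst (st n) @[n --> \oo]) [set s | exists2 n, (N <= n)%N & s = (st n).1].
  by exists N => // n /= Nn; exists n.
have nb : nbhs p (uval @^-1` ball (uval p) (r / 2)).
  by apply: continuous_uval; apply/nbhs_ballP; exists (r / 2).
have [_ /= [[n Nn ->]]] := clp _ _ FN nb.
rewrite /ball/= => h1.
have [h2 []] := hst n.
have in1 : `|f p - f (st n).1| < e / 2.
  by apply: rW; rewrite (lt_trans h1)// gtr_pMr// invf_lt1// ltr1n.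
have in2 : `|f p - f (st n).2| < e / 2.
  apply: rW.
  rewrite -(subrKA (uval (st n).1)) (le_lt_trans (ler_normD _ _))//.
  by rewrite [r]splitr ltr_leD// (le_trans h2)// hN.
rewrite -(subrKA (f p)) (le_trans (ler_normD _ _))// [e]splitr lerD//; last exact: ltW.
by rewrite distrC ltW.
Qed.

End unit_interval_facts.

(** * Compactness of the space of probability measures *)

Section stieltjes.
Context {R : realType}.

Lemma stieltjes_probability (F : R -> R) :
  {homo F : x y / x <= y} -> right_continuous F ->
  F x @[x --> -oo] --> (0 : R) -> F x @[x --> +oo] --> (1 : R) ->
  exists m : probability (measurableTypeR R) R,
    forall x, m (`]-oo, x]%classic : set R) = (F x)%:E.
Proof.
move=> ndF rcF F0 F1.
pose Fc := HB.pack_for (cumulativeBounded (0 : R) (1 : R)) F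
  (isCumulative.Build _ _ _ F ndF rcF) (isCumulativeBounded.Build _ 0 1 F F0 F1).
exists (lebesgue_stieltjes_measure Fc) => x.
exact: (cdf_lebesgue_stieltjes_id Fc x).
Qed.

(** The right-continuous version of a nondecreasing function. *)
Definition right_regularization (G : R -> R) (x : R) : R :=
  inf [set G y | y in [set y | x < y]].

Section right_regularization.
Variable G : R -> R.
Hypotheses (G01 : forall x, 0 <= G x <= 1) (ndG : {homo G : x y / x <= y}).
Local Notation F := (right_regularization G).

Let has_infG x : has_inf [set G y | y in [set y | x < y]].
Proof.
split; first by exists (G (x + 1)); exists (x + 1) => //=; rewrite ltrDl.
by exists 0 => _ [y _ <-]; case/andP: (G01 y).
Qed.

Lemma right_regularization_le x y : x < y -> F x <= G y.
Proof.
move=> xy; apply: ge_inf; last by exists y.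
by case: (has_infG x).
Qed.

Lemma right_regularization_ge x : G x <= F x.
Proof.
apply: lb_le_inf; first by case: (has_infG x).
by move=> _ [y /= xy <-]; apply: ndG; exact: ltW.
Qed.

Lemma right_regularization_nd : {homo F : x y / x <= y}.
Proof.
move=> x y xy; apply: lb_le_inf; first by case: (has_infG y).
by move=> _ [z /= yz <-]; apply: right_regularization_le; exact: le_lt_trans yz.
Qed.

Lemma right_regularization_rc : right_continuous F.
Proof.
move=> x; apply/cvgrPdist_le => e e0.
have [_ [y /= xy <-] Gy] := inf_adherent e0 (has_infG x).
near=> z; have xz : x <= z by near: z; exact: nbhs_right_ge.
have zy : z < y by near: z; exact: nbhs_right_lt.
rewrite ler_norml; apply/andP; split; last first.
  by rewrite lerBlDr (le_trans (right_regularization_nd xz))// lerDr ltW.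
rewrite lerBrDr addrC lerBlDr.
by rewrite (le_trans (right_regularization_le zy))// ltW.
Unshelve. all: by end_near. Qed.

(** The regularization has the limits 0 and 1 since [G] is constant outside the
    unit interval. *)
Lemma right_regularization_probability : (forall x, x < 0 -> G x = 0) ->
  (forall x, 1 <= x -> G x = 1) ->
  exists m : probability (measurableTypeR R) R,
    forall x, m (`]-oo, x]%classic : set R) = (F x)%:E.
Proof.
move=> G0 G1; apply: stieltjes_probability.
- exact: right_regularization_nd.
- exact: right_regularization_rc.
- apply: cvg_near_cst; near=> x.
  have x0 : x < 0 by near: x; apply: nbhs_ninfty_lt; exact: num_real.
  have [h1 h2] : x < x / 2 /\ x / 2 < 0 by split; lra.
  apply/eqP; rewrite eq_le; apply/andP; split.
    by rewrite -(G0 _ h2) right_regularization_le.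
  by rewrite -(G0 _ x0) right_regularization_ge.
- apply: cvg_near_cst; near=> x.
  have x1 : 1 <= x by near: x; apply: nbhs_pinfty_ge; exact: num_real.
  apply/eqP; rewrite eq_le; apply/andP; split.
    rewrite -(G1 (x + 1)); last by rewrite (le_trans x1)// lerDl.
    by rewrite right_regularization_le// ltrDl.
  by rewrite -[leLHS](G1 _ x1) right_regularization_ge.
Unshelve. all: by end_near. Qed.

End right_regularization.
End stieltjes.

Section step_functions.
Context {R : realType}.
Local Notation E := (unit_interval R).

Definition initial_segment (x : R) : set (borel E) := [set t : E | uval t <= x].

Lemma measurable_initial_segment x : measurable (initial_segment x).
Proof.
have -> : initial_segment x = ~` (uval @^-1` `]x, +oo[%classic).
  apply/seteqP; split => t; rewrite /initial_segment/= in_itv/= andbT leNgt.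
    by move=> /negP.
  by move/negP.
apply: measurableC; apply: sub_sigma_algebra.
move/continuousP : (@continuous_uval R); apply; exact: interval_open.
Qed.

Definition cdf01 (m : M1 R E) (x : R) : R := fine (m (initial_segment x)).

Lemma cdf01_fin (m : M1 R E) x : (cdf01 m x)%:E = m (initial_segment x).
Proof. by rewrite /cdf01 fineK// fin_num_measure//; exact: measurable_initial_segment. Qed.

Lemma cdf01_bounds m x : 0 <= cdf01 m x <= 1.
Proof.
rewrite -!lee_fin cdf01_fin measure_ge0/= probability_le1//.
exact: measurable_initial_segment.
Qed.

Lemma cdf01_nd m : {homo cdf01 m : x y / x <= y}.
Proof.
move=> x y xy; rewrite -lee_fin !cdf01_fin; apply: le_measure.
- rewrite inE; exact: measurable_initial_segment.
- rewrite inE; exact: measurable_initial_segment.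
- by move=> t; rewrite /initial_segment/= => /le_trans; apply.
Qed.

Lemma cdf01_lt0 m x : x < 0 -> cdf01 m x = 0.
Proof.
move=> x0; rewrite /cdf01 (_ : initial_segment x = set0) ?measure0//.
apply/seteqP; split => // t; rewrite /initial_segment/= => tx.
have /andP[t0 _] := uval_itv t.
by have := le_lt_trans (le_trans t0 tx) x0; rewrite ltxx.
Qed.

Lemma cdf01_ge1 m x : 1 <= x -> cdf01 m x = 1.
Proof.
move=> x1; rewrite /cdf01 (_ : initial_segment x = setT).
  by rewrite [X in fine X](_ : _ = 1%E)//; exact: probability_setT.
apply/seteqP; split => // t _; rewrite /initial_segment/=.
by have /andP[_ /le_trans] := uval_itv t; apply.
Qed.

(** Summation by parts for a step function with a jump at [j]. *)
Lemma telescope_from (h : nat -> R) (n j : nat) : (j <= n)%N ->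
  \sum_(i < n) (h i - h i.+1) * (j <= i)%N%:R = h j - h n.
Proof.
elim: n => [|n IH]; first by rewrite leqn0 => /eqP ->; rewrite big_ord0 subrr.
rewrite leq_eqVlt big_ord_recr/= => /predU1P[->|jn].
  rewrite ltnn mulr0 addr0 subrr big1// => i _.
  by rewrite leqNgt (ltn_trans (ltn_ord i))// mulr0.
by move: jn; rewrite ltnS => jn; rewrite IH// jn mulr1; ring.
Qed.

Lemma integral_step (m : M1 R E) (A : nat -> set (borel E)) (c0 : R) (c : nat -> R)
    (n : nat) : (forall i, measurable (A i)) ->
  m.-integrable setT (EFin \o (fun t => c0 + \sum_(i < n) c i * \1_(A i) t)) /\
  (\int[m]_t (c0 + \sum_(i < n) c i * \1_(A i) t))%R =
    c0 + \sum_(i < n) c i * fine (m (A i)).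
Proof.
move=> mA; elim: n => [|n [IHi IH]].
  have -> : (fun t => c0 + \sum_(i < 0) c i * \1_(A i) t) = (fun=> c0).
    by apply/funext => t; rewrite big_ord0 addr0.
  split; first exact: finite_measure_integrable_cst.
  rewrite big_ord0 addr0 Rintegral_cst// [X in fine X](_ : _ = 1%E) ?mulr1//.
  exact: probability_setT.
have i0 : m.-integrable setT (EFin \o (\1_(A n) : E -> R)).
  exact: integrable_indic.
have i1 : m.-integrable setT (EFin \o (fun t => c n * \1_(A n) t)).
  exact: (integrableZl measurableT _ i0).
have E1 : (fun t => c0 + \sum_(i < n.+1) c i * \1_(A i) t) =
  (fun t => (c0 + \sum_(i < n) c i * \1_(A i) t) + c n * \1_(A n) t).
  by apply/funext => t; rewrite big_ord_recr/= addrA.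
rewrite E1; split.
  by have := integrableD measurableT IHi i1; exact.
rewrite RintegralD// IH RintegralZl//.
rewrite big_ord_recr/= addrA; congr (_ + _ * _).
by rewrite /Rintegral integral_indic// setIT.
Qed.

(** On the grid of mesh [1 / (n + 1)] the function [f] is replaced by its value at
    the right end of each cell; Abel summation writes the integral of this step
    function in terms of the distribution function. *)
Lemma integral_step_approx (m : M1 R E) (f : E -> R) (h : nat -> R) (n : nat)
    (w : R) : continuous f ->
  (forall s t, `|uval s - uval t| <= n.+1%:R^-1 -> `|f s - f t| <= w) ->
  (forall i, h i = f (uclamp (i%:R / n.+1%:R))) ->
  `|(\int[m]_t f t)%R -
    (h n.+1 + \sum_(i < n.+1) (h i - h i.+1) * cdf01 m (i%:R / n.+1%:R))| <= w.
Proof.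
move=> cf fw hE; pose N : R := n.+1%:R.
have N0 : 0 < N by rewrite ltr0n.
pose A i := initial_segment (i%:R / N).
pose st t := h n.+1 + \sum_(i < n.+1) (h i - h i.+1) * \1_(A i) t.
have [ist Est] := integral_step m (h n.+1) (fun i => h i - h i.+1) n.+1
  (fun i => measurable_initial_segment (i%:R / N)).
have close t : `|f t - st t| <= w.
  have /andP[t0 t1] := uval_itv t.
  have ex : exists i : nat, uval t <= i%:R / N.
    by exists n.+1; rewrite divff ?gt_eqF.
  pose j := ex_minn ex.
  have [jt jmin] : uval t <= j%:R / N /\ forall i : nat, uval t <= i%:R / N -> (j <= i)%N.
    by rewrite /j; case: ex_minnP.
  have jn : (j <= n.+1)%N by apply: jmin; rewrite divff ?gt_eqF.
  have -> : st t = h j.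
    rewrite /st; have -> : \sum_(i < n.+1) (h i - h i.+1) * \1_(A i) t =
        \sum_(i < n.+1) (h i - h i.+1) * (j <= i)%N%:R.
      apply: eq_bigr => i _; congr (_ * _); rewrite indicE.
      have -> : (t \in A i) = (j <= i)%N; last by [].
      apply/idP/idP => [|ji]; first by rewrite inE; exact: jmin.
      rewrite inE /A /initial_segment/=; apply: (le_trans jt).
      by rewrite ler_pM2r ?invr_gt0// ler_nat.
    by rewrite telescope_from//; ring.
  rewrite hE; apply: fw; rewrite uval_uclamp_id; last first.
    rewrite divr_ge0 ?(ltW N0)//= ler_pdivrMr// mul1r ler_nat//.
  rewrite distrC ger0_norm ?subr_ge0// lerBlDr.
  case: (j) jt jmin => [|k] jt jmin.
    by rewrite mul0r addr_ge0// invr_ge0 ltW.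
  have : k%:R / N <= uval t.
    by rewrite leNgt; apply/negP => /ltW/jmin; rewrite ltnn.
  by rewrite -natr1 mulrDl mul1r addrC => ?; rewrite lerD2l.
have [M [Mr hM]] : bounded_fun f.
  have [M [Mr hM]] := compact_bounded (continuous_compact (continuous_subspaceT cf)
    (@compact_unit_interval R)).
  by exists M; split => // M' MM' t _; apply: (hM M' MM'); exists t.
have mf : measurable_fun (setT : set (borel E)) f by exact: continuous_borel_measurable.
have intf : m.-integrable setT (EFin \o f).
  apply: measurable_bounded_integrable => //.
    by rewrite (le_lt_trans (probability_le1 _ _)) ?ltry.
  by exists M; split => // M' MM' t _; exact: hM.
have intw : m.-integrable setT (EFin \o (fun=> w)).
  exact: finite_measure_integrable_cst.
have Ew : (\int[m]_t w)%R = w.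
  rewrite Rintegral_cst// [X in fine X](_ : _ = 1%E) ?mulr1//.
  exact: probability_setT.
have -> : h n.+1 + \sum_(i < n.+1) (h i - h i.+1) * cdf01 m (i%:R / N) =
    (\int[m]_t st t)%R by rewrite Est.
rewrite -RintegralB//.
apply: (le_trans (le_normr_Rintegral _ _)) => //.
  by have := integrableB measurableT intf ist; exact.
rewrite -[leRHS]Ew; apply: le_Rintegral => //.
have := integrableB measurableT intf ist => /integrable_abse; exact.
Qed.

End step_functions.

Section compact_M1.
Context {R : realType}.
Local Notation E := (unit_interval R).

(** Helly's selection along an ultrafilter: the distribution functions converge
    pointwise to a nondecreasing [G], and the limit measure has the right
    regularization of [G] as its distribution function. The two may differ, but
    over the cells of a grid their differences telescope to at most 1, and they
    are weighted by small increments of the test function. *)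
Lemma compact_M1 : compact [set: M1 R E].
Proof.
rewrite compact_ultra => F UF _.
have cG x : exists l : R, cdf01 m x @[m --> F] --> l.
  by apply: ultra_bounded_cvg => m; exact: cdf01_bounds.
have [G GE] := choice cG.
have limG x y : (forall m, cdf01 m x <= cdf01 m y) -> G x <= G y.
  by move=> xy; apply: (ler_cvg_to (GE x) (GE y)); exact: nearW.
have eqG x (l : R) : (forall m : M1 R E, cdf01 m x = l) -> G x = l.
  move=> xl; apply/esym; apply: (cvg_unique (@Rhausdorff R) _ (GE x)).
  by rewrite (_ : (fun m => _) = cst l); [exact: cvg_cst|exact/funext].
have ndG : {homo G : x y / x <= y}.
  by move=> x y xy; apply: limG => m; exact: cdf01_nd.
have G0 x : x < 0 -> G x = 0 by move=> x0; apply: eqG => m; exact: cdf01_lt0.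
have G1 x : 1 <= x -> G x = 1 by move=> x1; apply: eqG => m; exact: cdf01_ge1.
have G01 x : 0 <= G x <= 1.
  have hl : G (Num.min x (-1)) = 0 by rewrite G0// gt_min ltrN10 orbT.
  have hr : G (Num.max x 1) = 1 by rewrite G1// le_max lexx orbT.
  by rewrite -hl -{2}hr !ndG// ?ge_min ?le_max lexx.
have [p pE] := right_regularization_probability G01 ndG G0 G1.
have mclamp : @measurable_fun _ _ (measurableTypeR R) (borel E) setT uclamp.
  apply: (measurability _ (erefl (@measurable _ (borel E)))) => _ [A oA <-].
  rewrite setTI; apply: open_measurable.
  by move/continuousP : (@continuous_uclamp R); exact.
pose C : {mfun measurableTypeR R >-> borel E} := mfun_Sub (mem_set mclamp).
pose mu : M1 R E := distribution p C.
exists mu; split => //=.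
have cdfmu x : 0 <= x < 1 -> cdf01 mu x = right_regularization G x.
  move=> /andP[x0 x1]; rewrite /cdf01.
  have -> : mu (initial_segment x) = p (`]-oo, x]%classic : set R).
    rewrite /mu /distribution/= /pushforward; congr (p _).
    apply/seteqP; split => y; rewrite /initial_segment/= in_itv/= uval_uclamp.
      by rewrite ge_max => /andP[_]; rewrite ge_min leNgt x1.
    by move=> yx; rewrite ge_max x0 ge_min yx orbT.
  by rewrite pE.
apply: M1_cvg => f [cf _]; apply/cvgrPdist_lt => e e0.
(* two step approximations cost [w] each and their comparison [2 * w] *)
pose w := e / 5; have w0 : 0 < w by rewrite divr_gt0.
have [n fn] := unit_interval_uniform_continuity cf w0.
pose N : R := n.+1%:R.
have N0 : 0 < N by rewrite ltr0n.
pose x (i : nat) : R := i%:R / N.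
have xS i : x i < x i.+1 by rewrite ltr_pM2r ?invr_gt0// ltr_nat.
(* the [n.+1] deviations add up to at most 1 *)
have near_i : \forall m \near F, forall i : 'I_n.+1, `|G (x i) - cdf01 m (x i)| <= N^-1.
  apply: filter_forall => i.
  have /cvgrPdist_le := GE (x i); apply; by rewrite invr_gt0.
apply: filterS near_i => m hm.
pose h i := f (uclamp (i%:R / n.+1%:R)).
have x01 i : (i <= n.+1)%N -> 0 <= x i <= 1.
  by move=> iN; rewrite divr_ge0 ?(ltW N0)//= ler_pdivrMr// mul1r ler_nat.
have hw (i : 'I_n.+1) : `|h i - h i.+1| <= w.
  apply: fn; rewrite !uval_uclamp_id; [|exact: (x01 i.+1)|exact/x01/ltnW].
  rewrite -mulrBl -[in X in _ - X]natr1 opprD addNKr mulN1r normrN ger0_norm//.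
have S1 := integral_step_approx m cf fn (fun i => erefl (h i)).
have S2 := integral_step_approx mu cf fn (fun i => erefl (h i)).
pose s1 := \sum_(i < n.+1) (h i - h i.+1) * cdf01 m (x i).
pose s2 := \sum_(i < n.+1) (h i - h i.+1) * cdf01 mu (x i).
have D : `|s1 - s2| <= w * 2.
  rewrite /s1 /s2 -sumrB; apply: (le_trans (ler_norm_sum _ _ _)).
  have bi (i : 'I_n.+1) :
      `|(h i - h i.+1) * cdf01 m (x i) - (h i - h i.+1) * cdf01 mu (x i)| <=
      w * (N^-1 + (G (x i.+1) - G (x i))).
    rewrite -mulrBr normrM; apply: ler_pM => //.
    have xi01 : 0 <= x i < 1.
      by rewrite divr_ge0 ?(ltW N0)//= ltr_pdivrMr// mul1r ltr_nat ltn_ord.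
    rewrite (cdfmu _ xi01) -(subrKA (G (x i))) (le_trans (ler_normD _ _))//.
    rewrite lerD//; first by rewrite distrC; exact: hm.
    have h1 := right_regularization_ge G01 ndG (x i).
    have h2 := right_regularization_le G01 (xS i).
    by rewrite distrC ger0_norm ?subr_ge0// lerD2r.
  apply: (le_trans (ler_sum _ (fun i _ => bi i))).
  rewrite -mulr_sumr ler_wpM2l ?(ltW w0)// big_split/=.
  rewrite sumr_const card_ord -[N^-1 *+ _]mulr_natl divff ?gt_eqF//.
  rewrite -(big_mkord xpredT (fun i => G (x i.+1) - G (x i))) telescope_sumr//.
  have /andP[_ g1] := G01 (x n.+1); have /andP[g0 _] := G01 (x 0%N); lra.
move: S1 S2 D; rewrite -/s1 -/s2 -/N.
move: (\int[m]_t f t)%R (\int[mu]_t f t)%R (h n.+1) s1 s2 => I1 I2 c s1 s2.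
rewrite !ler_norml ltr_norml /w => /andP[? ?] /andP[? ?] /andP[? ?].
by apply/andP; split; lra.
Qed.

End compact_M1.

(** * Continuous functions and their integrals *)

Lemma le_ereal_approx {R : realType} (x y : \bar R) :
  (forall c : R, (c%:E < x)%E -> (c%:E <= y)%E) -> (x <= y)%E.
Proof.
move=> h; rewrite leNgt; apply/negP => yx.
case: x y => [r| |] [s| |] //= in h yx *.
- rewrite lte_fin in yx; have := h ((r + s) / 2).
  rewrite lte_fin lee_fin => /(_ _); have -> : (r + s) / 2 < r by lra.
  by move=> /(_ isT); lra.
- by have := h (r - 1); rewrite lte_fin ltrBlDr ltrDl ltr01 leNgt ltNyr => /(_ isT).
- by have := h (s + 1); rewrite ltry lee_fin => /(_ isT); lra.
- by have := h 0; rewrite ltry leNgt ltNyr => /(_ isT).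
Qed.

Lemma ler_ln_pos {R : realType} (x y : R) : 0 < x -> x <= y -> ln x <= ln y.
Proof. by move=> x0 xy; rewrite ler_ln ?posrE// (lt_le_trans x0). Qed.

Section continuous_functions.
Context {R : realType} {X : topologicalType}.
Implicit Types (f g : X -> R).

Lemma continuous_add f g : continuous f -> continuous g ->
  continuous (fun x => f x + g x).
Proof. by move=> cf cg x; apply: cvgD; [exact: cf|exact: cg]. Qed.

Lemma continuous_mul f g : continuous f -> continuous g ->
  continuous (fun x => f x * g x).
Proof. by move=> cf cg x; apply: cvgM; [exact: cf|exact: cg]. Qed.

Lemma continuous_cst (c : R) : continuous (fun _ : X => c).
Proof. by move=> x; exact: cvg_cst. Qed.

Lemma continuous_scale (c : R) f : continuous f -> continuous (fun x => c * f x).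
Proof. by move=> cf; apply: continuous_mul => //; exact: continuous_cst. Qed.

Lemma continuous_sumf (n : nat) (F : nat -> X -> R) :
  (forall i, continuous (F i)) -> continuous (fun x => \sum_(i < n) F i x).
Proof.
move=> cF; elim: n => [|n IH].
  by rewrite (_ : (fun x => _) = (fun=> 0)); [exact: continuous_cst|apply/funext => x; rewrite big_ord0].
rewrite (_ : (fun x => _) = (fun x => (\sum_(i < n) F i x) + F n x)).
  exact: continuous_add.
by apply/funext => x; rewrite big_ord_recr.
Qed.

Lemma continuous_powRf (p : R) f : continuous f -> (forall x, 0 < f x) ->
  continuous (fun x => f x `^ p).
Proof.
move=> cf f0 x.
have cl : {for f x, continuous (fun z : R => z `^ p)}.
  apply/differentiable_continuous/derivable1_diffP.
  by case: (is_derive1_powR p (f0 x)).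
exact: (cvg_comp f (fun z : R => z `^ p) (cf x) cl).
Qed.

Lemma continuous_powR_pos (alpha : R) f : 0 < alpha -> continuous f -> (forall t, 0 <= f t) ->
  continuous (fun t => f t `^ alpha).
Proof.
move=> al0 cf f0 t.
have [ft0|ft0] := ltP 0 (f t).
  have cl : {for f t, continuous (fun z : R => z `^ alpha)}.
    apply/differentiable_continuous/derivable1_diffP.
    by case: (is_derive1_powR alpha ft0).
  exact: (cvg_comp f (fun z : R => z `^ alpha) (cf t) cl).
have {}ft0 : f t = 0 by apply/eqP; rewrite eq_le ft0 f0.
apply/cvgrPdist_lt => e e0; rewrite ft0 powR0 ?gt_eqF//.
have e'0 : 0 < e `^ alpha^-1 by rewrite powR_gt0.
have /cvgrPdist_lt/(_ _ e'0) := cf t; apply: filterS => s.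
rewrite ft0 !sub0r !normrN !ger0_norm ?powR_ge0// => fs.
have := gt0_ltr_powR al0 _ _ fs; rewrite !nnegrE f0 powR_ge0 => /(_ isT isT).
by rewrite -powRrM mulVf ?gt_eqF// powRr1// ltW.
Qed.

End continuous_functions.

Section integrals_on_unit_interval.
Context {R : realType}.
Local Notation E := (unit_interval R).
Implicit Types (m : M1 R E) (f g : E -> R).

Lemma continuous_bounded f : continuous f -> exists2 M : R, 0 < M & forall t, `|f t| <= M.
Proof.
move=> cf; have [M [Mr hM]] := compact_bounded (continuous_compact (continuous_subspaceT cf)
  (@compact_unit_interval R)).
exists (`|M| + 1); first by rewrite ltr_wpDl.
move=> t; apply: (hM (`|M| + 1)); last by exists t.
by rewrite (le_lt_trans (ler_norm _))// ltrDl.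
Qed.

Lemma continuous_Cb f : continuous f -> Cb R E f.
Proof.
move=> cf; have [M M0 hM] := continuous_bounded cf.
by apply: (@Cb_of_bounds _ _ f (- M) M) => // t; rewrite -ler_norml.
Qed.

Lemma cint_integrable m f : continuous f -> m.-integrable setT (EFin \o f).
Proof.
move=> cf; have [M M0 hM] := continuous_bounded cf.
apply: measurable_bounded_integrable => //.
- by rewrite (le_lt_trans (probability_le1 _ _)) ?ltry.
- exact: continuous_borel_measurable.
- exists M; split; first exact: num_real.
  by move=> M' MM' t _; exact: (le_trans (hM t) (ltW MM')).
Qed.

Lemma cint_EFin m f : continuous f ->
  (\int[m]_t (f t)%:E)%E = (\int[m]_t f t)%R%:E.
Proof.
move=> cf; rewrite /Rintegral fineK//.
exact: (integrable_fin_num _ (cint_integrable m cf)).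
Qed.

Lemma cint_cst m (c : R) : (\int[m]_(t in [set: E]) c)%R = c.
Proof.
rewrite Rintegral_cst// [X in fine X](_ : _ = 1%E) ?mulr1//.
exact: probability_setT.
Qed.

Lemma cintD m f g : continuous f -> continuous g ->
  (\int[m]_t (f t + g t))%R = (\int[m]_t f t)%R + (\int[m]_t g t)%R.
Proof. by move=> cf cg; rewrite RintegralD//; exact: cint_integrable. Qed.

Lemma cintZ m (c : R) f : continuous f ->
  (\int[m]_t (c * f t))%R = c * (\int[m]_t f t)%R.
Proof. by move=> cf; rewrite RintegralZl//; exact: cint_integrable. Qed.

Lemma cint_sum m (n : nat) (F : nat -> E -> R) : (forall i, continuous (F i)) ->
  (\int[m]_t (\sum_(i < n) F i t))%R = \sum_(i < n) (\int[m]_t F i t)%R.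
Proof.
move=> cF; elim: n => [|n IH].
  by rewrite big_ord0 -[RHS](cint_cst m); apply: eq_Rintegral => t _; rewrite big_ord0.
rewrite big_ord_recr/= -IH -cintD//; last exact: continuous_sumf.
by apply: eq_Rintegral => t _; rewrite big_ord_recr.
Qed.

Lemma cint_le m f g : continuous f -> continuous g -> (forall t, f t <= g t) ->
  (\int[m]_t f t)%R <= (\int[m]_t g t)%R.
Proof.
move=> cf cg fg; apply: le_Rintegral => //; exact: cint_integrable.
Qed.

Lemma cint_bounds m f (a b : R) : continuous f -> (forall t, a <= f t <= b) ->
  a <= (\int[m]_t f t)%R <= b.
Proof.
move=> cf fab; apply/andP; split.
  rewrite -[leLHS](cint_cst m); apply: cint_le => //; first exact: continuous_cst.
  by move=> t; case/andP: (fab t).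
rewrite -[leRHS](cint_cst m); apply: cint_le => //; first exact: continuous_cst.
by move=> t; case/andP: (fab t).
Qed.

End integrals_on_unit_interval.

Lemma continuous_comp_real {R : realType} {X : topologicalType} (f : X -> R) (h : R -> R) :
  continuous f -> continuous h -> continuous (fun x => h (f x)).
Proof. by move=> cf ch x; exact: (cvg_comp f h (cf x) (ch (f x))). Qed.

Lemma continuous_sub {R : realType} {X : topologicalType} (f g : X -> R) :
  continuous f -> continuous g -> continuous (fun x => f x - g x).
Proof. by move=> cf cg x; apply: cvgB; [exact: cf|exact: cg]. Qed.

Lemma continuous_combination {R : realType} {X : topologicalType} (n : nat)
    (c : nat -> R) (phi : nat -> X -> R) :
  (forall i, continuous (phi i)) -> continuous (fun t => \sum_(i < n) c i * phi i t).
Proof.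
move=> cphi; apply: (@continuous_sumf R X n (fun i t => c i * phi i t)) => i.
exact: continuous_scale.
Qed.

Lemma cint_combination {R : realType} (m : M1 R (unit_interval R)) (n : nat)
    (c : nat -> R) (phi : nat -> unit_interval R -> R) :
  (forall i, continuous (phi i)) ->
  (\int[m]_t (\sum_(i < n) c i * phi i t))%R = \sum_(i < n) c i * (\int[m]_t phi i t)%R.
Proof.
move=> cphi; rewrite (@cint_sum R m n (fun i t => c i * phi i t)).
  by apply: eq_bigr => i _; rewrite cintZ.
by move=> i; exact: continuous_scale.
Qed.

(** * The rate function and the upper bound *)

Section upper_bound.
Context {R : realType} (alpha : R).
Local Notation E := (unit_interval R).
Variables (nu : M1 R E) (Q : R -> probability (borel (M1 R E)) R).
Hypothesis al01 : 0 < alpha < 1.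
Hypothesis lawQ : forall theta : R, 0 < theta -> dirichlet_process_law theta alpha nu (Q theta).
Implicit Types (f g : E -> R) (m mu : M1 R E) (th : R).

Let al0 : 0 < alpha. Proof. by case/andP: al01. Qed.

Local Notation A f := (\int[nu]_t (f t `^ alpha))%R.
Local Notation I := (rate_function alpha nu).

(** A test function of null moment contributes [-oo] to the supremum, because the
    logarithm of 0 is [-oo]. *)
Lemma rate_term f mu : continuous f -> (forall t, 0 <= f t) ->
  ((alpha^-1)%:E * lne (\int[nu]_x (f x `^ alpha)%:E) + 1 - \int[mu]_x (f x)%:E)%E =
  if A f == 0 then -oo%E else (alpha^-1 * ln (A f) + 1 - (\int[mu]_t f t)%R)%:E.
Proof.
move=> cf f0; rewrite !cint_EFin//; last exact: continuous_powR_pos.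
have A0 : 0 <= A f by apply: Rintegral_ge0 => t _; exact: powR_ge0.
case: ifPn => [/eqP ->|An0]; last by rewrite lne_EFin// lt_neqAle eq_sym An0.
by rewrite le0_lneNy// gt0_muleNy ?lte_fin ?invr_gt0.
Qed.

Lemma rate_function_ge f mu : continuous f -> (forall t, 0 <= f t) -> 0 < A f ->
  ((alpha^-1 * ln (A f) + 1 - (\int[mu]_t f t)%R)%:E <= I mu)%E.
Proof.
move=> cf f0 A0; apply: ereal_sup_ubound; exists f.
  by split => //; exact: continuous_Cb.
by rewrite rate_term// gt_eqF.
Qed.

Lemma moment_ge0_gt0 f (a : R) : continuous f -> 0 < a -> (forall t, a <= f t) -> 0 < A f.
Proof.
move=> cf a0 fa; have f0 t : 0 <= f t by rewrite (le_trans (ltW a0)).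
have : a `^ alpha <= A f.
  rewrite -[leLHS](cint_cst nu); apply: cint_le.
  - exact: continuous_cst.
  - exact: continuous_powR_pos.
  - by move=> t; rewrite ge0_ler_powR ?nnegrE ?(ltW al0)// ltW.
by apply: lt_le_trans; rewrite powR_gt0.
Qed.

(** Adding a small constant makes a near-optimal test function positive, at a cost
    as small as desired since the moment increases. *)
Lemma rate_function_gtP (c : R) mu : (c%:E < I mu)%E ->
  exists f (a b : R), [/\ continuous f, 0 < a, forall t, a <= f t <= b &
    c < alpha^-1 * ln (A f) + 1 - (\int[mu]_t f t)%R].
Proof.
move=> /ereal_sup_gt[_ [f [[cf _] f0] <-]]; rewrite rate_term//.
case: ifPn => // An0; rewrite lte_fin => cJ.
have A0 : 0 < A f.
  by rewrite lt_neqAle eq_sym An0 Rintegral_ge0// => t _; exact: powR_ge0.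
pose e := (alpha^-1 * ln (A f) + 1 - (\int[mu]_t f t)%R - c) / 2.
have e0 : 0 < e by rewrite divr_gt0// subr_gt0.
have [M M0 hM] := continuous_bounded cf.
exists (fun t => f t + e), e, (M + e).
have cfe : continuous (fun t => f t + e).
  by apply: continuous_add => //; exact: continuous_cst.
split => //.
  move=> t; rewrite lerDr f0/= lerD2r; exact: le_trans (ler_norm _) (hM t).
rewrite cintD//; last exact: continuous_cst.
rewrite cint_cst.
have : ln (A f) <= ln (A (fun t => f t + e)).
  have le_moment : A f <= A (fun t => f t + e).
  apply: cint_le; try apply: continuous_powR_pos => //.
    by move=> t; rewrite addr_ge0// ltW.
    move=> t; rewrite ge0_ler_powR ?nnegrE ?(ltW al0)// ?addr_ge0 ?(ltW e0)//.
    by rewrite lerDl ltW.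
  exact: ler_ln_pos.
move=> /(ler_wpM2l (ltW (_ : 0 < alpha^-1))); rewrite invr_gt0 => /(_ al0).
move=> le_ln.
have eE : e = (alpha^-1 * ln (A f) + 1 - (\int[mu]_t f t)%R - c) / 2 by [].
lra.
Qed.

(** The constant test function 1 contributes 0. *)
Lemma rate_function_ge0 mu : (0 <= I mu)%E.
Proof.
have A1 : A (fun=> 1) = 1.
  by rewrite -[RHS](cint_cst nu); apply: eq_Rintegral => t _; rewrite powR1.
have := @rate_function_ge (fun=> 1) mu.
rewrite A1 ln1 mulr0 add0r cint_cst subrr; apply => //.
exact: continuous_cst.
Qed.

Lemma open_integral_lt f (z : R) : continuous f ->
  open [set m : M1 R E | (\int[m]_t f t)%R < z].
Proof.
move=> cf; apply: (@open_comp _ _ (fun m : M1 R E => (\int[m]_t f t)%R) [set x | x < z]).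
  by move=> m _; exact: (continuous_M1_integral (continuous_Cb cf)).
exact: open_lt.
Qed.

(** A test function that witnesses [I mu > a] does so on a neighbourhood. *)
Lemma rate_function_lsc : lower_semicontinuous I.
Proof.
move=> mu c /rate_function_gtP[f [a [b [cf a0 fab cJ]]]].
have f0 t : 0 <= f t by rewrite (le_trans (ltW a0))//; case/andP: (fab t).
exists [set m : M1 R E | (\int[m]_t f t)%R < alpha^-1 * ln (A f) + 1 - c].
  by apply: open_nbhs_nbhs; split; [exact: open_integral_lt|rewrite /=; lra].
move=> m /= fm; apply: (lt_le_trans _ (rate_function_ge m cf f0 _)).
  rewrite lte_fin; lra.
by apply: (moment_ge0_gt0 cf a0) => t; case/andP: (fab t).
Qed.

Local Notation tilted f th := (fun m : M1 R E => (\int[m]_t f t)%R `^ (- th)).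

Lemma measurable_tilted f th : continuous f ->
  measurable_fun ([set: borel (M1 R E)] : set (borel (M1 R E))) (tilted f th).
Proof.
move=> cf; apply: (@measurableT_comp _ _ _ _ _ _ (fun x : R => x `^ (- th))).
  exact: measurable_powR.
exact: (measurable_M1_integral (continuous_Cb cf)).
Qed.

(** Markov's inequality for the tilting density, combined with [ln z <= z - 1]. *)
Lemma half_space_bound f (a b c z th : R) : continuous f -> 0 < a ->
    (forall t, a <= f t <= b) -> 0 < th -> 0 < z ->
    c <= alpha^-1 * ln (A f) + 1 - z ->
  (Q th [set m : M1 R E | ((\int[m]_t f t)%R < z)%R] <= (expR (- (th * c)))%:E)%E.
Proof.
move=> cf a0 fab th0 z0 cz.
set N : set (borel (M1 R E)) := [set m | _].
have mN : measurable (N : set (borel (M1 R E))).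
  by apply: sub_sigma_algebra; exact: open_integral_lt.
have A0 : 0 < A f by apply: (moment_ge0_gt0 cf a0) => t; case/andP: (fab t).
have le1 : (Q th N <= (z `^ th * A f `^ (- (th / alpha)))%:E)%E.
  rewrite EFinM -(dirichlet_markov_krein al01 th0 (lawQ th0) cf a0 fab).
  rewrite -ge0_integralZl_EFin//; last 3 first.
  - by move=> m _; rewrite lee_fin powR_ge0.
  - by apply/measurable_EFinP; exact: measurable_tilted.
  - exact: powR_ge0.
  rewrite -(setIT N) -integral_indic//.
  apply: ge0_le_integral => //.
  - by apply/measurable_EFinP; exact: measurable_indic.
  - by apply: measurable_funeM; apply/measurable_EFinP; exact: measurable_tilted.
  move=> m _; rewrite -EFinM lee_fin indicE.
  have [/set_mem Nm|_] := boolP (m \in N); last by rewrite mulr_ge0 ?powR_ge0.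
  have fm0 : 0 < (\int[m]_t f t)%R.
    by rewrite (lt_le_trans a0)//; case/andP: (cint_bounds m cf fab).
  rewrite powRN ler_pdivlMr ?powR_gt0// mul1r.
  by rewrite ge0_ler_powR ?nnegrE ?(ltW th0) ?(ltW fm0) ?(ltW z0)// ltW.
apply: (le_trans le1); rewrite lee_fin.
rewrite -[X in X * _]lnK ?posrE ?powR_gt0// -[X in _ * X]lnK ?posrE ?powR_gt0//.
rewrite -expRD ler_expR !ln_powR.
have lnz : ln z <= z - 1.
  by rewrite -[X in ln X](subrK 1 z) [X in ln X]addrC; apply: le_ln1Dx; lra.
have -> : th * ln z + - (th / alpha) * ln (A f) = th * (ln z - alpha^-1 * ln (A f)).
  by ring.
rewrite -[leRHS]mulrN ler_wpM2l ?(ltW th0)//; lra.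
Qed.

Lemma exponential_nbhd (c : R) mu : (c%:E < I mu)%E ->
  exists N : set (M1 R E), [/\ open N, N mu &
    forall th, 0 < th -> (Q th N <= (expR (- (th * c)))%:E)%E].
Proof.
move=> /rate_function_gtP[f [a [b [cf a0 fab cJ]]]].
exists [set m : M1 R E | (\int[m]_t f t)%R < alpha^-1 * ln (A f) + 1 - c].
split; [exact: open_integral_lt|rewrite /=; lra|].
move=> th th0; apply: (half_space_bound cf a0 fab th0); last lra.
have : a <= (\int[mu]_t f t)%R by case/andP: (cint_bounds mu cf fab).
lra.
Qed.

Lemma finite_cover_bound (P : probability (borel (M1 R E)) R) (q : R)
    (s : seq (M1 R E)) (N : M1 R E -> set (M1 R E)) (F : set (borel (M1 R E))) :
  measurable F ->
  (forall m, m \in s -> open (N m) /\ (P (N m) <= q%:E)%E) ->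
  (forall x, F x -> exists2 m, m \in s & N m x) ->
  (P F <= ((size s)%:R * q)%:E)%E.
Proof.
elim: s F => [|m s IH] F mF hN cov.
  rewrite mul0r (_ : F = set0) ?measure0//.
  by apply/seteqP; split => // x /cov[].
have [oN PN] := hN m (mem_head _ _).
have mN : measurable (N m : set (borel (M1 R E))) by exact: sub_sigma_algebra.
have mFN : measurable (F `\` (N m : set (borel (M1 R E)))) by exact: measurableD.
have /IH : forall x, (F `\` (N m : set (borel (M1 R E)))) x -> exists2 m, m \in s & N m x.
  move=> x [/cov[m']]; rewrite inE => /orP[/eqP -> //|m's Nx _]; by exists m'.
move=> /(_ mFN) hrec.
have {}hrec := hrec (fun m' m's => hN m' (mem_behead (s := m :: s) m's)).
apply: (@le_trans _ _ (P (N m) + P (F `\` (N m : set (borel (M1 R E)))))%E).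
  apply: (@le_trans _ _ (P ((N m : set (borel (M1 R E))) `|` (F `\` (N m : set (borel (M1 R E))))))); last first.
    exact: measureU2.
  apply: le_measure; rewrite ?inE//; first exact: measurableU.
  by move=> x Fx; have [Nx|Nx] := pselect (N m x); [left|right].
by rewrite /= -natr1 mulrDl mul1r addrC EFinD leeD.
Qed.

Lemma limf_esup_le (g : R -> \bar R) (y : \bar R) :
  (\forall th \near +oo, (g th <= y)%E) -> (limf_esup g (pinfty_nbhs R) <= y)%E.
Proof.
move=> hg; apply: (@le_trans _ _ (ereal_sup (g @` [set th | (g th <= y)%E]))).
  by apply: ereal_inf_lbound; exists [set th | (g th <= y)%E].
by apply: ge_ereal_sup => _ [th /= h <-].
Qed.

Lemma limf_einf_ge (g : R -> \bar R) (y : \bar R) :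
  (\forall th \near +oo, (y <= g th)%E) -> (y <= limf_einf g (pinfty_nbhs R))%E.
Proof.
move=> hg; rewrite /limf_einf leeNr; apply: limf_esup_le.
by apply: filterS hg => th; rewrite leeN2.
Qed.

(** The number of half-spaces in the cover does not grow with [th], so that it is
    negligible at speed [th]. *)
Lemma closed_upper_bound (F : set (M1 R E)) : closed F ->
  (limf_esup (log_rate Q F) (pinfty_nbhs R) <= - ereal_inf (I @` F))%E.
Proof.
move=> clF; rewrite leeNr; apply: le_ereal_approx => c cI.
rewrite leeNr -EFinN; apply/lee_addgt0Pr => e e0.
have /choice[N hN] : forall mu, exists U : set (M1 R E), F mu ->
    [/\ open U, U mu & forall th, 0 < th -> (Q th U <= (expR (- (th * c)))%:E)%E].
  move=> mu; have [Fmu|nF] := pselect (F mu); last by exists setT.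
  have [|U hU] := @exponential_nbhd c mu; last by exists U.
  by apply: (lt_le_trans cI); apply: ereal_inf_lbound; exists mu.
have := subclosed_compact clF (@compact_M1 R) (@subsetT _ F).
rewrite compact_cover => /(_ _ F N)[|x Fx|D DF cov].
- by move=> mu /hN[].
- by exists x => //; case: (hN _ Fx).
have mF : measurable (F : set (borel (M1 R E))).
  rewrite -(setCK F); apply: measurableC; apply: sub_sigma_algebra.
  exact: closed_openC.
(* the successor keeps the logarithm of [n] finite when the cover is empty *)
pose s := enum_fset D; pose n : R := (size s).+1%:R.
have n1 : 1 <= n by rewrite ler1n.
have n0 : 0 < n by rewrite ltr0n.
apply: limf_esup_le; near=> th.
have th0 : 0 < th by near: th; apply: nbhs_pinfty_gt; exact: num_real.
have QF : (Q th F <= (n * expR (- (th * c)))%:E)%E.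
  apply: (@le_trans _ _ (((size s)%:R * expR (- (th * c)))%:E)).
    apply: (@finite_cover_bound (Q th) _ s N) => //.
    by move=> m /DF /set_mem Fm; have [oN _ QN] := hN m Fm; split => //; exact: QN.
  by rewrite lee_fin ler_wpM2r ?expR_ge0// ler_nat.
have q0 : 0 < n * expR (- (th * c)) by rewrite mulr_gt0 ?expR_gt0.
rewrite /log_rate.
apply: (@le_trans _ _ ((th^-1)%:E * (ln (n * expR (- (th * c))))%:E)%E).
  rewrite lee_pmul2l ?lte_fin ?invr_gt0// -lne_EFin//.
  by rewrite lee_lne// in_itv/= ?leey ?andbT ?lee_fin ?(ltW q0)//.
rewrite -EFinM -EFinD lee_fin lnM ?posrE ?expR_gt0// expRK mulrDr mulrN.
rewrite mulrA mulVf ?gt_eqF// mul1r addrC lerD2l ler_pdivrMl//.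
by rewrite -ler_pdivrMr//; near: th; apply: nbhs_pinfty_ge; exact: num_real.
Unshelve. all: by end_near. Qed.

End upper_bound.

(** * Elementary inequalities and partitions of unity *)

(** The tangent line of the convex function [z^(- p)] at [z = 1], taken at
    [z = 1 / (1 + x)]. *)
Lemma powR_ge_quadratic {R : realType} (p x : R) : 0 <= p -> `|x| <= 2^-1 ->
  1 + p * x - 2 * p * x ^+ 2 <= (1 + x) `^ p.
Proof.
rewrite ler_norml => p0 /andP[x1 x2].
have x0 : 0 < 1 + x by lra.
pose y := (1 + x)^-1.
have y0 : 0 < y by rewrite invr_gt0.
have := powR_tangent_neg y0 p0.
have -> : (1 + x) `^ p = y `^ (- p).
  by rewrite /y -powR_inv1 ?(ltW x0)// -powRrM mulN1r opprK.
apply: le_trans.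
have yE : y * (1 + x) = 1 by rewrite mulVf// gt_eqF.
have y2 : y <= 2 by rewrite /y -[leRHS]invrK lef_pV2 ?posrE//; lra.
rewrite -subr_ge0.
have -> : 1 - p * (y - 1) - (1 + p * x - 2 * p * x ^+ 2) = p * x ^+ 2 * (2 - y).
  have e1 : 1 - y = x * y by rewrite -[X in X - _]yE; ring.
  have e2 : x * y = x - x ^+ 2 * y by rewrite -[x in X in _ = X - _]mulr1 -yE; ring.
  have -> : y - 1 = - (x - x ^+ 2 * y) by rewrite -e2 -e1; ring.
  by ring.
by apply: mulr_ge0; [rewrite mulr_ge0// sqr_ge0|rewrite subr_ge0].
Qed.

Lemma powR_expR {R : realType} (x p : R) : 0 < x -> x `^ p = expR (p * ln x).
Proof. by move=> x0; rewrite /powR gt_eqF. Qed.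

Lemma powR_pred {R : realType} (x p : R) : 0 < x -> x `^ p = x * x `^ (p - 1).
Proof.
move=> x0; transitivity (expR (ln x) * expR ((p - 1) * ln x)).
  by rewrite -expRD powR_expR//; congr expR; ring.
by rewrite lnK ?posrE// powR_expR.
Qed.

Lemma ln_ge_quadratic {R : realType} (y : R) : 0 <= y <= 2^-1 -> - (2 * y) <= ln (1 - y).
Proof.
move=> /andP[y0 y1].
have z0 : 0 < 1 - y by lra.
have w0 : 0 < (1 - y)^-1 by rewrite invr_gt0.
have := @le_ln1Dx _ ((1 - y)^-1 - 1).
have -> : 1 + ((1 - y)^-1 - 1) = (1 - y)^-1 by ring.
rewrite lnV ?posrE// => /(_ _); rewrite ltrBrDl subrr => /(_ w0).
have zE : (1 - y)^-1 * (1 - y) = 1 by rewrite mulVf// gt_eqF.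
have w2 : (1 - y)^-1 <= 2 by rewrite -[leRHS]invrK lef_pV2 ?posrE//; lra.
have : (1 - y)^-1 - 1 <= 2 * y by nra.
lra.
Qed.

Lemma small_step {R : realType} (x1 y1 x2 y2 x3 y3 : R) :
  0 < x1 -> 0 < y1 -> 0 < x2 -> 0 < y2 -> 0 < x3 -> 0 < y3 ->
  exists e : R, [/\ 0 < e, e * x1 <= y1, e * x2 <= y2 & e * x3 <= y3].
Proof.
move=> x10 y10 x20 y20 x30 y30.
have [p1 p2 p3] : [/\ 0 < x1 / y1, 0 < x2 / y2 & 0 < x3 / y3] by rewrite !divr_gt0.
pose s := x1 / y1 + x2 / y2 + x3 / y3.
have s0 : 0 < s by rewrite !addr_gt0.
have es x y : 0 < y -> x / y <= s -> s^-1 * x <= y.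
  move=> y0 xs; rewrite -[leRHS]mul1r -ler_pdivrMr// -mulrA mulrC ler_pdivrMr//.
  by rewrite mul1r.
exists s^-1; split; first by rewrite invr_gt0.
- by apply: es => //; rewrite /s -addrA lerDl addr_ge0// ltW.
- by apply: es => //; rewrite /s addrAC lerDr addr_ge0// ltW.
- by apply: es => //; rewrite /s lerDr addr_ge0// ltW.
Qed.

(** The gain [- ln (1 - e * d / b)] is of order [e], and the cost of order
    [e ^+ 2]. *)
Lemma first_order_gain {R : realType} (al a b B d : R) :
  0 < al < 1 -> 0 < a -> 0 < b -> 0 < B -> 0 < d ->
  exists e k : R, [/\ 0 < e /\ 0 < k, e * (2 * B) <= a, e * d < b,
    0 < 1 - 2 * al * e ^+ 2 * (B / a) ^+ 2 &
    k <= al^-1 * ln (1 - 2 * al * e ^+ 2 * (B / a) ^+ 2) - ln (1 - e * d / b)].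
Proof.
move=> /andP[al0 al1] a0 b0 B0 d0.
have K0 : 0 < (B / a) ^+ 2 by rewrite exprn_gt0// divr_gt0.
have [||||||e [e0 h1 h2 h3]] := @small_step R (2 * B) a (8 * b * (B / a) ^+ 2) d (2 * d) b => //.
- by rewrite mulr_gt0.
- by rewrite mulr_gt0// mulr_gt0.
- by rewrite mulr_gt0.
pose u := e * (B / a); pose w := e * d / b; pose y := 2 * al * u ^+ 2.
have u12 : u <= 2^-1.
  by rewrite /u mulrA ler_pdivrMr// -ler_pdivrMl// mulrC invrK -mulrA [B * 2]mulrC.
have u0 : 0 <= u by rewrite mulr_ge0 ?(ltW e0)// divr_ge0 ?ltW.
have w12 : w <= 2^-1.
  by rewrite /w ler_pdivrMr// -ler_pdivrMl// mulrC invrK -mulrA [d * 2]mulrC.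
have w0 : 0 < w by rewrite divr_gt0// mulr_gt0.
have uw : 8 * u ^+ 2 <= w.
  rewrite /w ler_pdivlMr//.
  have -> : 8 * u ^+ 2 * b = e * (e * (8 * b * (B / a) ^+ 2)) by rewrite /u; ring.
  by rewrite ler_wpM2l ?(ltW e0).
have yE : 2 * al * e ^+ 2 * (B / a) ^+ 2 = y by rewrite /y /u; ring.
have e1 : e * (2 * B) <= a by [].
have e2 : e * d < b by move: w12; rewrite /w ler_pdivrMr// => h; apply: (le_lt_trans h); rewrite gtr_pMl// invf_lt1// ltr1n.
have ay : al^-1 * (2 * y) = 4 * u ^+ 2 by rewrite /y; field; rewrite gt_eqF.
have y0 : 0 <= y by rewrite /y mulr_ge0 ?sqr_ge0// mulr_ge0// ltW.
have y12 : y <= 2^-1.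
  have : u ^+ 2 <= 4^-1 by clear -u0 u12; nra.
  have : al * u ^+ 2 <= u ^+ 2 by rewrite ler_piMl ?sqr_ge0// ltW.
  have -> : y = 2 * (al * u ^+ 2) by rewrite /y; ring.
  by clear; move: (u ^+ 2) (al * u ^+ 2) => q p; lra.
have ly : - (4 * u ^+ 2) <= al^-1 * ln (1 - y).
  rewrite -ay -mulrN ler_wpM2l ?invr_ge0 ?(ltW al0)//.
  by apply: ln_ge_quadratic; rewrite y0.
have lw : ln (1 - w) <= - w.
  by apply: le_ln1Dx; rewrite ltrN2 (le_lt_trans w12)// invf_lt1// ltr1n.
exists e, (w / 2); rewrite -/w yE; split => //.
- by split => //; rewrite divr_gt0.
- by rewrite subr_gt0 (le_lt_trans y12)// invf_lt1// ltr1n.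
move: uw ly lw; clear; move: (u ^+ 2) (ln (1 - w)) (al^-1 * ln (1 - y)) => v q p; lra.
Qed.

Section weighted_means.
Context {R : realType} (n : nat).
Variables (w x : nat -> R).
Hypothesis w0 : forall i, 0 <= w i.
Hypothesis w1 : \sum_(i < n) w i = 1.
Hypothesis x0 : forall i, (i < n)%N -> 0 < x i.

Lemma weighted_mean_gt0 : 0 < \sum_(i < n) w i * x i.
Proof.
have wx0 (i : 'I_n) : 0 <= w i * x i by rewrite mulr_ge0// ltW// x0.
rewrite lt_neqAle sumr_ge0 ?andbT// eq_sym; apply/negP => s0.
have : \sum_(i < n) w i = 0.
  apply: big1 => i _; move: s0; rewrite psumr_eq0// => /allP/(_ i).
  by rewrite mem_index_enum => /(_ isT); rewrite /= mulf_eq0 (gt_eqF (x0 _))// orbF => /eqP.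
by rewrite w1 => /eqP; rewrite oner_eq0.
Qed.

Let s := \sum_(i < n) w i * x i.
Let s0 : 0 < s := weighted_mean_gt0.

Lemma powR_scaled (p : R) i : (i < n)%N -> x i `^ p = s `^ p * (x i / s) `^ p.
Proof.
move=> im; rewrite -powRM ?(ltW s0)//; last by rewrite divr_ge0// ?(ltW s0)// ltW// x0.
by rewrite mulrC divfK// gt_eqF.
Qed.

Let tangent_sum (p : R) : \sum_(i < n) w i * (1 + p * (x i / s - 1)) = 1.
Proof.
transitivity (\sum_(i < n) ((1 - p) * w i + (p / s) * (w i * x i))).
  by apply: eq_bigr => i _; field; rewrite gt_eqF.
rewrite big_split/= -!mulr_sumr w1 -/s divfK ?gt_eqF//; ring.
Qed.

(** Jensen's inequality, from the tangent line at the mean. *)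
Lemma powR_mean_convex (p : R) : 0 <= p ->
  (\sum_(i < n) w i * x i) `^ (- p) <= \sum_(i < n) w i * x i `^ (- p).
Proof.
move=> p0; rewrite -/s -[leLHS]mulr1 -(tangent_sum (- p)) mulr_sumr.
apply: ler_sum => i _; rewrite powR_scaled// mulrCA ler_wpM2l//.
rewrite ler_wpM2l ?powR_ge0//; have := @powR_tangent_neg _ (x i / s) p.
by rewrite mulNr; apply => //; rewrite divr_gt0// x0.
Qed.

Lemma powR_mean_concave (p : R) : 0 <= p <= 1 ->
  \sum_(i < n) w i * x i `^ p <= (\sum_(i < n) w i * x i) `^ p.
Proof.
move=> p01; rewrite -/s -[leRHS]mulr1 -(tangent_sum p) mulr_sumr.
apply: ler_sum => i _; rewrite powR_scaled// mulrCA ler_wpM2l ?powR_ge0//.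
by rewrite ler_wpM2l// powR_tangent// divr_gt0// x0.
Qed.

End weighted_means.

Section partition_of_unity.
Context {R : realType}.
Local Notation E := (unit_interval R).
Implicit Types (s t : E).

(** Differences of translates of the ramp are tents that telescope to 1. *)
Definition ramp (y : R) : R := uval (uclamp y).

Lemma ramp_le0 y : y <= 0 -> ramp y = 0.
Proof.
by move=> y0; rewrite /ramp uval_uclamp min_r ?max_l//; lra.
Qed.

Lemma ramp_ge1 y : 1 <= y -> ramp y = 1.
Proof. by move=> y1; rewrite /ramp uval_uclamp min_l// max_r. Qed.

Lemma ramp_homo x y : x <= y -> ramp x <= ramp y.
Proof.
move=> xy; have [x0|x0] := leP x 0; first by rewrite ramp_le0//; case/andP: (uval_itv (uclamp y)).
have [y1|y1] := leP 1 y; first by rewrite [ramp y]ramp_ge1//; case/andP: (uval_itv (uclamp x)).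
by rewrite /ramp !uval_uclamp !min_r ?max_r//; lra.
Qed.

Lemma continuous_ramp : continuous ramp.
Proof.
move=> y.
exact: (cvg_comp _ _ (@continuous_uclamp R y) (@continuous_uval R _)).
Qed.

Definition tent (n i : nat) t : R :=
  ramp (n%:R * uval t - i%:R + 1) - ramp (n%:R * uval t - i%:R).

Lemma continuous_tent n i : continuous (tent n i).
Proof.
have cn : continuous (fun t => n%:R * uval t - i%:R).
  by apply: continuous_add; [apply: continuous_scale; exact: continuous_uval|exact: continuous_cst].
have cr : continuous (fun t => ramp (n%:R * uval t - i%:R + 1)).
  apply: (continuous_comp_real _ continuous_ramp).
  by apply: continuous_add => //; exact: continuous_cst.
apply: continuous_sub => //.
exact: (continuous_comp_real cn continuous_ramp).
Qed.

Lemma tent_ge0 n i t : 0 <= tent n i t.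
Proof. by rewrite subr_ge0 ramp_homo// lerDl. Qed.

Lemma tent_sum n t : \sum_(i < n.+1) tent n i t = 1.
Proof.
pose G i : R := ramp (n%:R * uval t - i%:R + 1).
have -> : \sum_(i < n.+1) tent n i t = \sum_(0 <= i < n.+1) (G i - G i.+1).
  rewrite big_mkord; apply: eq_bigr => i _; rewrite /tent /G -[i.+1%:R]natr1.
  by congr (_ - ramp _); ring.
have /andP[t0 t1] := uval_itv t.
rewrite -[LHS]opprK -sumrN; under eq_bigr do rewrite opprB.
rewrite telescope_sumr// opprB /G ramp_ge1; last first.
  by rewrite subr0 lerDr mulr_ge0.
rewrite ramp_le0 ?subr0// -natr1 opprD addrA subrK subr_le0.
by rewrite -[leRHS]mulr1 ler_wpM2l.
Qed.

Definition node (n i : nat) : E := uclamp (i%:R / n%:R).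

Lemma uval_node n i : (i <= n)%N -> (0 < n)%N -> uval (node n i) = i%:R / n%:R.
Proof.
move=> ilen n0; have in1 : i%:R / n%:R <= 1 :> R.
  by rewrite ler_pdivrMr ?ltr0n// mul1r ler_nat.
have in0 : 0 <= i%:R / n%:R :> R by rewrite divr_ge0.
by rewrite uval_uclamp min_r// max_r.
Qed.

Lemma tent_node n i : (i <= n)%N -> (0 < n)%N -> tent n i (node n i) = 1.
Proof.
move=> ilen n0; rewrite /tent uval_node// mulrC divfK ?pnatr_eq0 -?lt0n//.
by rewrite subrr add0r ramp_ge1// ramp_le0// subr0.
Qed.

Lemma tent_support n i t : (i <= n)%N -> (0 < n)%N -> tent n i t != 0 ->
  `|uval t - uval (node n i)| <= n%:R^-1.
Proof.
move=> ilen n0; have n0' : 0 < n%:R :> R by rewrite ltr0n.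
apply: contraR; rewrite -ltNge uval_node// => far.
have {far} : 1 < `|n%:R * uval t - i%:R|.
  have -> : n%:R * uval t - i%:R = n%:R * (uval t - i%:R / n%:R).
    by field; rewrite gt_eqF.
  by rewrite normrM gtr0_norm// mulrC -ltr_pdivrMr// mul1r.
rewrite /tent lter_normr => /orP[|] far.
  by rewrite !ramp_ge1 ?subrr//; lra.
by rewrite !ramp_le0 ?subrr//; lra.
Qed.

Lemma common_modulus (gs : seq (E -> R)) (w : R) : 0 < w ->
  (forall i, (i < size gs)%N -> continuous (nth (fun=> 0) gs i)) ->
  exists n : nat, forall i, (i < size gs)%N -> forall s t,
    `|uval s - uval t| <= n.+1%:R^-1 ->
    `|nth (fun=> 0) gs i s - nth (fun=> 0) gs i t| <= w.
Proof.
move=> w0; elim: gs => [|g gs IH] cg; first by exists 0%N.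
have [n1 h1] := unit_interval_uniform_continuity (cg 0%N isT) w0.
have [n2 h2] := IH (fun i => cg i.+1).
have inv_le (m k : nat) : (m <= k)%N -> k.+1%:R^-1 <= m.+1%:R^-1 :> R.
  by move=> mk; rewrite lef_pV2 ?posrE ?ltr0n// ler_nat.
exists (maxn n1 n2) => -[|i] /= ig s t st.
  by apply: h1; apply: (le_trans st); rewrite inv_le// leq_maxl.
by apply: h2 => //; apply: (le_trans st); rewrite inv_le// leq_maxr.
Qed.

End partition_of_unity.

(** * The lower bound *)

Section lower_bound.
Context {R : realType} (alpha : R).
Local Notation E := (unit_interval R).
Variables (nu : M1 R E) (Q : R -> probability (borel (M1 R E)) R).
Hypothesis al01 : 0 < alpha < 1.
Hypothesis lawQ : forall theta : R, 0 < theta -> dirichlet_process_law theta alpha nu (Q theta).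
Implicit Types (f g : E -> R) (m mu : M1 R E) (th : R).

Let al0 : 0 < alpha. Proof. by case/andP: al01. Qed.
Let al1 : alpha < 1. Proof. by case/andP: al01. Qed.

Local Notation A f := (\int[nu]_t (f t `^ alpha))%R.
Local Notation I := (rate_function alpha nu).
Local Notation tilted f th := (fun m : M1 R E => (\int[m]_t f t)%R `^ (- th)).
Local Notation mfun0 Y := (measurable_fun ([set: borel (M1 R E)] : set (borel (M1 R E))) Y).

(** The first-order term is the vanishing mean of [g]; the quadratic term is
    controlled since [e * g / f] is at most 1/2 in absolute value. *)
Lemma perturbed_moment f g (a B e : R) : continuous f -> continuous g ->
    0 < a -> (forall t, a <= f t) -> (forall t, `|g t| <= B) -> 0 < e ->
    e * (2 * B) <= a -> (\int[nu]_t (g t * f t `^ (alpha - 1)))%R = 0 ->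
  A f * (1 - 2 * alpha * e ^+ 2 * (B / a) ^+ 2) <= A (fun t => f t + e * g t).
Proof.
move=> cf cg a0 fa gB e0 eB mean0.
have f0 t : 0 < f t by rewrite (lt_le_trans a0).
have cfp p : continuous (fun t => f t `^ p) by exact: continuous_powRf.
have cge : continuous (fun t => f t + e * g t).
  by apply: continuous_add => //; exact: continuous_scale.
have gf t : e * `|g t| * 2 <= a.
  by rewrite (le_trans _ eB)// -mulrA ler_wpM2l ?(ltW e0)// mulrC ler_wpM2l.
have fe0 t : 0 < f t + e * g t.
  have : e * `|g t| = `|e * g t| by rewrite normrM gtr0_norm.
  have := gf t; have := fa t; have := ler_norm (- (e * g t)); rewrite normrN; lra.
pose k := 2 * alpha * e ^+ 2 * (B / a) ^+ 2.
have -> : A f * (1 - k) = (\int[nu]_t ((1 - k) * f t `^ alpha +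
    (alpha * e) * (g t * f t `^ (alpha - 1))))%R.
  rewrite cintD ?cintZ ?mean0//.
  - by rewrite mulr0 addr0 mulrC.
  - by apply: continuous_mul => //; exact: cfp.
  - by apply: continuous_scale; exact: cfp.
  - by apply: continuous_scale; apply: continuous_mul => //; exact: cfp.
apply: cint_le.
- apply: continuous_add; first by apply: continuous_scale; exact: cfp.
  by apply: continuous_scale; apply: continuous_mul => //; exact: cfp.
- exact: continuous_powRf.
move=> t; pose x := e * g t / f t.
have fx : f t + e * g t = f t * (1 + x).
  by rewrite /x; field; rewrite gt_eqF.
have xle : `|x| <= e * (B / a).
  rewrite /x normrM normfV (gtr0_norm (f0 t)) normrM (gtr0_norm e0) -mulrA.
  rewrite ler_wpM2l ?(ltW e0)//; apply: ler_pM => //; first by rewrite invr_ge0 ltW.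
  by rewrite lef_pV2 ?posrE.
have x12 : `|x| <= 2^-1.
  apply: (le_trans xle); rewrite mulrA ler_pdivrMr//.
  lra.
have x2 : x ^+ 2 <= e ^+ 2 * (B / a) ^+ 2.
  rewrite -exprMn -[leLHS]real_normK ?num_real//.
  by rewrite ler_pXn2r ?nnegrE// (le_trans _ xle).
have fp : f t * f t `^ (alpha - 1) = f t `^ alpha by rewrite -powR_pred.
have x1 : 0 <= 1 + x by move: x12; rewrite ler_norml => /andP[? _]; lra.
rewrite fx powRM ?(ltW (f0 t))//.
have := powR_ge_quadratic (ltW al0) x12.
move=> /(ler_wpM2l (powR_ge0 (f t) alpha)); apply: le_trans.
have -> : alpha * e * (g t * f t `^ (alpha - 1)) = f t `^ alpha * (alpha * x).
  by rewrite -fp /x; field; rewrite gt_eqF.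
rewrite -subr_ge0.
have -> : f t `^ alpha * (1 + alpha * x - 2 * alpha * x ^+ 2) -
   ((1 - k) * f t `^ alpha + f t `^ alpha * (alpha * x)) =
   f t `^ alpha * (2 * alpha) * (e ^+ 2 * (B / a) ^+ 2 - x ^+ 2).
  by rewrite /k; ring.
apply: mulr_ge0; last by rewrite subr_ge0.
by rewrite mulr_ge0 ?powR_ge0// mulr_ge0// ltW.
Qed.

(** On the event the integral of [f] may be replaced by that of [f + e * g], which is
    smaller by a factor [r = 1 - e * d / b], while the moment of the new function
    differs to second order in [e] only; [Y] is [r^th] times the tilting density
    of [f + e * g]. The bound on [Y] stands for one on the tilted mass of the event,
    in a form that is stable under sums. *)
Lemma tilted_tail f g (a b d : R) : continuous f -> 0 < a ->
    (forall t, a <= f t <= b) -> continuous g ->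
    (\int[nu]_t (g t * f t `^ (alpha - 1)))%R = 0 -> 0 < d ->
  exists2 k : R, 0 < k & forall th, 0 < th -> exists Y : M1 R E -> R,
    [/\ mfun0 Y, forall m, 0 <= Y m,
        forall m, (\int[m]_t g t)%R <= - d -> tilted f th m <= Y m &
        (\int[Q th]_m (Y m)%:E <= (expR (- (th * (alpha^-1 * ln (A f) + k))))%:E)%E].
Proof.
move=> cf a0 fab cg mean0 d0.
have fa t : a <= f t by case/andP: (fab t).
have fb t : f t <= b by case/andP: (fab t).
have b0 : 0 < b by rewrite (lt_le_trans a0)// (le_trans (fa point)).
have [B B0 gB] := continuous_bounded cg.
have [e [k [[e0 k0] h1 edb y1 gain]]] := first_order_gain al01 a0 b0 B0 d0.
pose f' t := f t + e * g t.
have cf' : continuous f' by apply: continuous_add => //; exact: continuous_scale.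
have egB t : `|e * g t| <= a / 2.
  rewrite normrM gtr0_norm// ler_pdivlMr// (le_trans _ h1)// -mulrA ler_wpM2l ?(ltW e0)//.
  by rewrite mulrC ler_wpM2l.
have f'ab t : a / 2 <= f' t <= b + a / 2.
  have := egB t; rewrite ler_norml => /andP[h h'].
  by have := fa t; have := fb t; rewrite /f'; lra.
have a20 : 0 < a / 2 by lra.
have A0 : 0 < A f by exact: (moment_ge0_gt0 nu al01 cf a0).
have A'0 : 0 < A f' by apply: (moment_ge0_gt0 nu al01 cf' a20) => t; case/andP: (f'ab t).
have := perturbed_moment cf cg a0 fa gB e0 h1 mean0.
rewrite -/f'; set y := 2 * alpha * e ^+ 2 * (B / a) ^+ 2 in y1 gain * => AA'.
pose r := 1 - e * d / b.
have r0 : 0 < r by rewrite subr_gt0 ltr_pdivrMr// mul1r.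
exists k => //.
move=> th th0; exists (fun m => r `^ th * (\int[m]_t f' t)%R `^ (- th)); split.
- apply: measurable_funM => //; exact: measurable_tilted.
- by move=> m; rewrite mulr_ge0 ?powR_ge0.
- move=> m gm.
  have fm0 : 0 < (\int[m]_t f t)%R by rewrite (lt_le_trans a0)//; case/andP: (cint_bounds m cf fab).
  have fmb : (\int[m]_t f t)%R <= b by case/andP: (cint_bounds m cf fab).
  have f'm0 : 0 < (\int[m]_t f' t)%R by rewrite (lt_le_trans a20)//; case/andP: (cint_bounds m cf' f'ab).
  have f'r : (\int[m]_t f' t)%R <= r * (\int[m]_t f t)%R.
    rewrite cintD ?cintZ//; last exact: continuous_scale.
    move: (\int[m]_t f t)%R (\int[m]_t g t)%R => u v in fm0 fmb gm f'm0 *.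
    rewrite /r mulrBl mul1r lerD2l.
    apply: (@le_trans _ _ (- (e * d))); first by rewrite -mulrN ler_wpM2l ?(ltW e0).
    rewrite lerN2 mulrAC ler_pdivrMr// ler_wpM2l//.
    by rewrite mulr_ge0 ?(ltW e0)// ltW.
  have e1 : (\int[m]_t f t)%R `^ (- th) = r `^ th * (r * (\int[m]_t f t)%R) `^ (- th).
    rewrite powRM ?(ltW r0) ?(ltW fm0)// mulrA !powR_expR// -expRD.
    by rewrite -mulrDl addrN mul0r expR0 mul1r.
  by rewrite e1 ler_wpM2l ?powR_ge0// powR_anti// ?ltW.
under eq_integral do rewrite EFinM.
rewrite ge0_integralZl_EFin//; last 3 first.
- by move=> m _; rewrite lee_fin powR_ge0.
- by apply/measurable_EFinP; exact: measurable_tilted.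
- exact: powR_ge0.
rewrite (dirichlet_markov_krein al01 th0 (lawQ th0) cf' a20 f'ab) -EFinM lee_fin.
rewrite !powR_expR// -expRD ler_expR.
have lA : ln (A f) + ln (1 - y) <= ln (A f').
  by rewrite -lnM ?posrE//; apply: ler_ln_pos => //; exact: mulr_gt0.
have -> : th * ln r + - (th / alpha) * ln (A f') = - (th * (alpha^-1 * ln (A f') - ln r)).
  by ring.
rewrite lerN2 ler_wpM2l ?(ltW th0)//.
apply: (@le_trans _ _ (alpha^-1 * (ln (A f) + ln (1 - y)) - ln r)).
  by rewrite mulrDr -addrA lerD2l.
by rewrite lerD2r ler_wpM2l// invr_ge0 ltW.
Qed.

(** The events for [g] and [- g] together bound the absolute value, hence the
    factor 2. *)
Lemma tilted_tails f (a b d : R) (gs : seq (E -> R)) : continuous f -> 0 < a ->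
    (forall t, a <= f t <= b) -> 0 < d ->
    (forall i, (i < size gs)%N -> continuous (nth (fun=> 0) gs i) /\
      (\int[nu]_t (nth (fun=> 0) gs i t * f t `^ (alpha - 1)))%R = 0) ->
  exists2 k : R, 0 < k & forall th, 0 < th -> exists Y : M1 R E -> R,
    [/\ mfun0 Y, forall m, 0 <= Y m,
        forall m, (exists2 i, (i < size gs)%N & d <= `|(\int[m]_t nth (fun=> 0) gs i t)%R|) ->
          tilted f th m <= Y m &
        (\int[Q th]_m (Y m)%:E <=
          ((2 * size gs)%:R * expR (- (th * (alpha^-1 * ln (A f) + k))))%:E)%E].
Proof.
move=> cf a0 fab d0; elim: gs => [|g gs IH] hgs.
  exists 1 => // th th0; exists (fun=> 0); split => //.
  - by move=> m [].
  - by rewrite integral0 muln0 mul0r.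
have [k3 k30 h3] := IH (fun i => hgs i.+1).
have [cg gmean] := hgs 0%N isT.
have [k1 k10 h1] := tilted_tail cf a0 fab cg gmean d0.
have cNg : continuous (fun t => - 1 * g t) by exact: continuous_scale.
have Ngmean : (\int[nu]_t ((- 1 * g t) * f t `^ (alpha - 1)))%R = 0.
  transitivity (-1 * (\int[nu]_t (g t * f t `^ (alpha - 1)))%R); last by rewrite gmean mulr0.
  rewrite -cintZ; first by apply: eq_Rintegral => t _; rewrite mulrA.
  apply: continuous_mul => //; apply: continuous_powRf => // t.
  by rewrite (lt_le_trans a0)//; case/andP: (fab t).
have [k2 k20 h2] := tilted_tail cf a0 fab cNg Ngmean d0.
pose k := Num.min k1 (Num.min k2 k3).
exists k; first by rewrite !lt_min k10 k20.
move=> th th0.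
have [Y1 [mY1 Y10 Y1f Y1i]] := h1 th th0.
have [Y2 [mY2 Y20 Y2f Y2i]] := h2 th th0.
have [Y3 [mY3 Y30 Y3f Y3i]] := h3 th th0.
exists (fun m => Y1 m + Y2 m + Y3 m); split.
- by apply: measurable_funD => //; exact: measurable_funD.
- by move=> m; rewrite !addr_ge0.
- move=> m [[|i]] /= ig dg; last first.
    apply: (@le_trans _ _ (Y3 m)); last by rewrite lerDr addr_ge0.
    by apply: Y3f; exists i.
  have [gm|gm] := leP 0 (\int[m]_t g t)%R.
    apply: (@le_trans _ _ (Y2 m)); last by rewrite -addrA addrCA lerDl addr_ge0.
    by apply: Y2f; rewrite cintZ// mulN1r lerN2; rewrite ger0_norm in dg.
  apply: (@le_trans _ _ (Y1 m)); last by rewrite -addrA lerDl addr_ge0.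
  by apply: Y1f; rewrite ltr0_norm// in dg; rewrite lerNr.
under eq_integral do rewrite !EFinD.
rewrite ge0_integralD//=; last 4 first.
- by move=> m _; rewrite -EFinD lee_fin addr_ge0.
- by apply: emeasurable_funD; exact/measurable_EFinP.
- by move=> m _; rewrite lee_fin.
- exact/measurable_EFinP.
rewrite ge0_integralD//=; last 4 first.
- by move=> m _; rewrite lee_fin.
- exact/measurable_EFinP.
- by move=> m _; rewrite lee_fin.
- exact/measurable_EFinP.
have mono k' : k <= k' -> expR (- (th * (alpha^-1 * ln (A f) + k'))) <=
    expR (- (th * (alpha^-1 * ln (A f) + k))).
  by move=> kk'; rewrite ler_expR lerN2 ler_wpM2l ?(ltW th0)// lerD2l.
rewrite mulnS natrD mulrDl EFinD; apply: leeD.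
  rewrite mulr_natl mulr2n EFinD; apply: leeD.
    by apply: (le_trans Y1i); rewrite lee_fin mono// /k ge_min lexx.
  by apply: (le_trans Y2i); rewrite lee_fin mono// /k !ge_min lexx orbT.
apply: (le_trans Y3i); rewrite lee_fin ler_wpM2l// mono// /k !ge_min lexx !orbT//.
Qed.

(** Almost all of the tilted mass sits where the listed integrals vanish up to
    [d]; there the tilting density is at most [z^(-th)], so that the probability
    of [G] is at least about [z^th] times the total tilted mass. *)
Lemma tilted_lower_bound f (a b d z : R) (gs : seq (E -> R)) (G : set (M1 R E)) :
    continuous f -> 0 < a -> (forall t, a <= f t <= b) -> 0 < d -> 0 < z -> open G ->
    (forall i, (i < size gs)%N -> continuous (nth (fun=> 0) gs i) /\
      (\int[nu]_t (nth (fun=> 0) gs i t * f t `^ (alpha - 1)))%R = 0) ->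
    (forall m, (forall i, (i < size gs)%N -> `|(\int[m]_t nth (fun=> 0) gs i t)%R| < d) ->
      z <= (\int[m]_t f t)%R /\ G m) ->
  ((ln z - alpha^-1 * ln (A f))%:E <= limf_einf (log_rate Q G) (pinfty_nbhs R))%E.
Proof.
move=> cf a0 fab d0 z0 oG hgs hG.
have [k k0 hk] := tilted_tails cf a0 fab d0 hgs.
have A0 : 0 < A f by apply: (moment_ge0_gt0 nu al01 cf a0) => t; case/andP: (fab t).
set L := alpha^-1 * ln (A f) in hk *.
pose n : R := (2 * size gs)%:R + 1.
have n0 : 0 < n by rewrite ltr_wpDl.
have mG : measurable (G : set (borel (M1 R E))) by exact: sub_sigma_algebra.
apply: le_ereal_approx => c; rewrite lte_fin => cL.
have gap : 0 < ln z - L - c by rewrite subr_gt0.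
apply: limf_einf_ge; near=> th.
have th0 : 0 < th by near: th; apply: nbhs_pinfty_gt; exact: num_real.
have th1 : ln (2 * n) / k <= th by near: th; apply: nbhs_pinfty_ge; exact: num_real.
have th2 : ln 2 / (ln z - L - c) <= th by near: th; apply: nbhs_pinfty_ge; exact: num_real.
have [Y [mY Y0 Yf Yi]] := hk th th0.
have QGfin : Q th G \is a fin_num by exact: fin_num_measure.
set q := fine (Q th G).
have qE : Q th G = q%:E by rewrite fineK.
have total : expR (- (th * L)) <=
    n * expR (- (th * (L + k))) + expR (- (th * ln z)) * q.
  rewrite -lee_fin EFinD [X in (_ + X)%E]EFinM -qE.
  have -> : (expR (- (th * L)))%:E = (\int[Q th]_m (tilted f th m)%:E)%E.
    rewrite (dirichlet_markov_krein al01 th0 (lawQ th0) cf a0 fab) powR_expR//.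
    by congr ((expR _)%:E); rewrite /L; ring.
  apply: (@le_trans _ _ (\int[Q th]_m ((Y m)%:E + (expR (- (th * ln z)))%:E * (\1_(G : set (borel (M1 R E))) m)%:E))%E).
    apply: ge0_le_integral => //.
    - by move=> m _; rewrite lee_fin powR_ge0.
    - by apply/measurable_EFinP; exact: measurable_tilted.
    - apply: emeasurable_funD; first exact/measurable_EFinP.
      by apply: measurable_funeM; apply/measurable_EFinP; exact: measurable_indic.
    - move=> m _; rewrite -EFinM -EFinD lee_fin.
      have [bad|good] := pselect (exists2 i, (i < size gs)%N &
          d <= `|(\int[m]_t nth (fun=> 0) gs i t)%R|).
        by rewrite (le_trans (Yf m bad))// lerDl mulr_ge0 ?expR_ge0.
      have [|zf Gm] := hG m.
        by move=> i ig; rewrite ltNge; apply/negP => dg; apply: good; exists i.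
      rewrite indicE mem_set// mulr1 -mulNr -powR_expR//.
      rewrite (le_trans _ (_ : z `^ (- th) <= _)) ?lerDr//.
      by rewrite powR_anti// ltW.
  rewrite ge0_integralD//=; last 3 first.
  - by move=> m _; rewrite lee_fin.
  - exact/measurable_EFinP.
  - by apply: measurable_funeM; apply/measurable_EFinP; exact: measurable_indic.
  apply: leeD.
    by apply: (le_trans Yi); rewrite lee_fin ler_wpM2r ?expR_ge0// lerDl.
  rewrite ge0_integralZl_EFin ?expR_ge0//; last first.
    by apply/measurable_EFinP; exact: measurable_indic.
  by rewrite integral_indic// setIT.
have nk : n * expR (- (th * (L + k))) <= expR (- (th * L)) / 2.
  rewrite mulrDr opprD expRD mulrCA ler_wpM2l ?expR_ge0//.
  rewrite -ler_pdivlMl// -invfM mulrC -[leRHS]lnK ?posrE ?invr_gt0 ?mulr_gt0//.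
  rewrite ler_expR lnV ?posrE ?mulr_gt0// lerN2.
  by rewrite -ler_pdivrMl// mulrC [n * 2]mulrC.
have q_ge : expR (th * c) <= q.
  have e1 : expR (- (th * L)) / 2 <= expR (- (th * ln z)) * q by lra.
  have e2 : expR (th * (ln z - L)) / 2 <= q.
    have -> : expR (th * (ln z - L)) / 2 = expR (th * ln z) * (expR (- (th * L)) / 2).
      by rewrite mulrA -expRD mulrBr.
    rewrite [leRHS](_ : q = expR (th * ln z) * (expR (- (th * ln z)) * q)).
      by rewrite ler_wpM2l ?expR_ge0.
    by rewrite mulrA -expRD subrr expR0 mul1r.
  apply: le_trans e2; rewrite ler_pdivlMr// -[X in _ * X]lnK ?posrE// -expRD ler_expR.
  move: th2; rewrite ler_pdivrMr//; lra.
have q0 : 0 < q by rewrite (lt_le_trans _ q_ge)// expR_gt0.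
rewrite /log_rate qE lne_EFin// -EFinM lee_fin ler_pdivlMl//.
by rewrite -[leLHS]expRK ler_ln ?posrE ?expR_gt0.
Unshelve. all: by end_near. Qed.

Hypothesis full : msupport nu = setT.

Lemma full_support_integral_gt0 g t0 : continuous g -> (forall t, 0 <= g t) ->
  0 < g t0 -> 0 < (\int[nu]_t g t)%R.
Proof.
move=> cg g0 gt0.
pose V : set E := [set t | g t0 / 2 < g t].
have oV : open V.
  apply: (@open_comp _ _ g [set x | g t0 / 2 < x]) => [t _|]; first exact: cg.
  exact: open_gt.
have mV : measurable (V : set (borel E)) by exact: sub_sigma_algebra.
have nV : (0 < nu V)%E.
  have : msupport nu t0 by rewrite full.
  by apply => //; rewrite /V /=; lra.
rewrite -lte_fin -cint_EFin//.
apply: (@lt_le_trans _ _ ((g t0 / 2)%:E * nu V)%E).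
  by rewrite mule_gt0// lte_fin; lra.
rewrite -(setIT (V : set (borel E))) -integral_indic// -ge0_integralZl_EFin//; last 2 first.
- by apply/measurable_EFinP; exact: measurable_indic.
- lra.
apply: ge0_le_integral => //.
- by move=> t _; rewrite -EFinM lee_fin mulr_ge0//; lra.
- by apply: measurable_funeM; apply/measurable_EFinP; exact: measurable_indic.
- by apply/measurable_EFinP; exact: continuous_borel_measurable.
move=> t _; rewrite -EFinM lee_fin indicE.
have [/set_mem Vt|_] := boolP (t \in V); last by rewrite mulr0.
by rewrite mulr1; exact: ltW.
Qed.

(** If [mu] gave [g] no mass, the test functions [c * g] with [c] large would make
    the rate infinite. *)
Lemma finite_rate_integral_gt0 mu (v : R) g t0 : I mu = v%:E -> continuous g ->
  (forall t, 0 <= g t) -> 0 < g t0 -> 0 < (\int[mu]_t g t)%R.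
Proof.
move=> Iv cg g0 gt0; rewrite lt_neqAle Rintegral_ge0 ?andbT//; apply/negP => /eqP mu0.
have cga : continuous (fun t => g t `^ alpha) by exact: continuous_powR_pos.
have A0 : 0 < A g.
  apply: (@full_support_integral_gt0 _ t0) => //; first by move=> t; exact: powR_ge0.
  by rewrite powR_gt0.
pose c := expR (v - alpha^-1 * ln (A g)).
have c0 : 0 < c by exact: expR_gt0.
have Ac : A (fun t => c * g t) = c `^ alpha * A g.
  by rewrite -cintZ//; apply: eq_Rintegral => t _; rewrite powRM// ltW.
have := @rate_function_ge _ _ nu al01 (fun t => c * g t) mu.
rewrite Ac cintZ// -mu0 mulr0 Iv lee_fin subr0 => /(_ _ _ _).
have -> : alpha^-1 * ln (c `^ alpha * A g) = v.
  rewrite lnM ?posrE ?powR_gt0// ln_powR expRK mulrDr mulrA mulVf ?gt_eqF//; ring.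
move=> h; have : v + 1 <= v.
  apply: h; [exact: continuous_scale|by move=> t; rewrite mulr_ge0// ltW|].
  by rewrite mulr_gt0 ?powR_gt0.
lra.
Qed.

Let gamma := alpha / (1 - alpha).
Let gamma0 : 0 < gamma. Proof. by rewrite divr_gt0// subr_gt0. Qed.

(** With [w i] the mass of [phi i] for [nu] and [K] the sum of the
    [w i * r i^(- gamma)], the moment of the mixed density is at most [K] by convexity
    of [x^(- gamma)]; the test function [F] below has [mu]-integral 1, and its
    [alpha]-moment is at least [K^(1 - alpha)] by concavity of [x^alpha]. *)
Lemma discretized_rate_le mu (n : nat) (phi : nat -> E -> R) (r : nat -> R) :
    (forall i, continuous (phi i)) -> (forall i t, 0 <= phi i t) ->
    (forall t, \sum_(i < n) phi i t = 1) -> (forall i, (i < n)%N -> 0 < r i) ->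
    (forall i, (i < n)%N -> (\int[mu]_t phi i t)%R = r i * (\int[nu]_t phi i t)%R) ->
  (((alpha^-1 - 1) *
     ln (\int[nu]_t ((\sum_(i < n) r i * phi i t) `^ (- gamma)))%R)%:E <= I mu)%E.
Proof.
move=> cphi phi0 phi1 r0 mu_nu.
pose w i := (\int[nu]_t phi i t)%R.
have w0 i : 0 <= w i by apply: Rintegral_ge0.
have w1 : \sum_(i < n) w i = 1.
  by rewrite -cint_sum// -[RHS](cint_cst nu); apply: eq_Rintegral => t _; rewrite phi1.
have rphiE t : \sum_(i < n) r i * phi i t = \sum_(i < n) phi i t * r i.
  by apply: eq_bigr => i _; rewrite mulrC.
pose h t := \sum_(i < n) r i * phi i t.
have ch : continuous h by exact: continuous_combination.
have h0 t : 0 < h t.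
  by rewrite /h rphiE; exact: (weighted_mean_gt0 (fun i => phi0 i t) (phi1 t) r0).
pose K := \sum_(i < n) w i * r i `^ (- gamma).
have K0 : 0 < K.
  by apply: (@weighted_mean_gt0 _ _ _ (fun i => r i `^ (- gamma))) => // i iltn; rewrite powR_gt0 ?r0.
have hK : (\int[nu]_t h t `^ (- gamma))%R <= K.
  apply: (@le_trans _ _ (\int[nu]_t (\sum_(i < n) (fun i => r i `^ (- gamma)) i * phi i t))%R).
    apply: cint_le.
    - exact: continuous_powRf.
    - exact: (@continuous_combination R E n (fun i => r i `^ (- gamma)) phi cphi).
    - move=> t; rewrite /h rphiE.
      apply: le_trans (powR_mean_convex (fun i => phi0 i t) (phi1 t) r0 (ltW gamma0)) _.
      by apply: ler_sum => i _; rewrite mulrC.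
  rewrite (@cint_combination R nu n (fun i => r i `^ (- gamma)) phi)//.
  by apply: ler_sum => i _; rewrite mulrC.
have hg0 : 0 < (\int[nu]_t h t `^ (- gamma))%R.
  apply: (@full_support_integral_gt0 _ point).
  - exact: continuous_powRf.
  - by move=> t; exact: powR_ge0.
  - by rewrite powR_gt0.
pose q := (1 - alpha)^-1.
have qE : - gamma = 1 - q by rewrite /gamma /q; field; rewrite subr_eq0 gt_eqF.
have qa : - q * alpha = - gamma by rewrite /gamma /q; ring.
(* the optimal test function for masses [r i * w i] against [w i] *)
pose x i := K^-1 * r i `^ (- q).
have x0 i : (i < n)%N -> 0 < x i.
  by move=> iltn; rewrite mulr_gt0 ?invr_gt0// powR_gt0// r0.
pose F t := \sum_(i < n) x i * phi i t.
have FE t : F t = \sum_(i < n) phi i t * x i by apply: eq_bigr => i _; rewrite mulrC.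
have cF : continuous F by exact: continuous_combination.
have F0 t : 0 < F t by rewrite FE; exact: (weighted_mean_gt0 (fun i => phi0 i t) (phi1 t) x0).
have muF : (\int[mu]_t F t)%R = 1.
  rewrite cint_combination//.
  transitivity (K^-1 * K); last by rewrite mulVf// gt_eqF.
  rewrite mulr_sumr; apply: eq_bigr => i _.
  rewrite mu_nu// /x -!mulrA; congr (_ * _).
  rewrite mulrA [RHS]mulrC; congr (_ * _).
  rewrite qE [RHS]powR_pred ?r0// mulrC; congr (_ * powR _ _).
  by ring.
have AF : K `^ (1 - alpha) <= A F.
  have KE : K `^ (1 - alpha) = K `^ (- alpha) * K.
    by rewrite [LHS]powR_pred// mulrC; congr (powR _ _ * _); ring.
  apply: (@le_trans _ _ (\int[nu]_t (\sum_(i < n) (fun i => x i `^ alpha) i * phi i t))%R).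
    rewrite (@cint_combination R nu n (fun i => x i `^ alpha) phi)// KE mulr_sumr; apply: ler_sum => i _; rewrite /x powRM; last 2 first.
    - by rewrite invr_ge0 ltW.
    - exact: powR_ge0.
    rewrite -powRrM qa -powR_inv1 ?(ltW K0)// -powRrM mulN1r -/(w i).
    by rewrite -mulrA ler_wpM2l ?powR_ge0// mulrC.
  apply: cint_le.
  - exact: (@continuous_combination R E n (fun i => x i `^ alpha) phi cphi).
  - exact: continuous_powRf.
  - move=> t; rewrite FE.
    have al01' : 0 <= alpha <= 1 by rewrite !ltW.
    apply: le_trans (powR_mean_concave (fun i => phi0 i t) (phi1 t) x0 al01').
    by apply: ler_sum => i _; rewrite mulrC.
have := @rate_function_ge _ _ nu al01 F mu cF (fun t => ltW (F0 t)).
rewrite muF addrK => /(_ (lt_le_trans _ AF)); rewrite powR_gt0// => /(_ isT).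
apply: le_trans; rewrite lee_fin.
have -> : alpha^-1 - 1 = alpha^-1 * (1 - alpha) by field; rewrite gt_eqF.
rewrite -mulrA ler_wpM2l ?invr_ge0 ?(ltW al0)//.
apply: (@le_trans _ _ (ln (K `^ (1 - alpha)))).
  rewrite ln_powR ler_wpM2l ?subr_ge0 ?(ltW al1)//.
  exact: ler_ln_pos.
by apply: ler_ln_pos => //; exact: powR_gt0.
Qed.

Lemma integral_partition_approx m (n : nat) (phi : nat -> E -> R) (p : nat -> E) g (e : R) :
    (forall i, continuous (phi i)) -> (forall i t, 0 <= phi i t) -> continuous g ->
    (forall i t, (i < n)%N -> phi i t != 0 -> `|g t - g (p i)| <= e) ->
  forall i, (i < n)%N ->
  `|(\int[m]_t (g t * phi i t))%R - g (p i) * (\int[m]_t phi i t)%R| <=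
    e * (\int[m]_t phi i t)%R.
Proof.
move=> cphi phi0 cg gp i iltn.
have cgp : continuous (fun t => g t * phi i t) by exact: continuous_mul.
have bd t : `|g t * phi i t - g (p i) * phi i t| <= e * phi i t.
  have [->|pn0] := eqVneq (phi i t) 0; first by rewrite !mulr0 subrr normr0.
  by rewrite -mulrBl normrM (ger0_norm (phi0 i t)) ler_wpM2r// gp.
have cN : continuous (fun t => e * phi i t) by exact: continuous_scale.
have cc : continuous (fun t => g (p i) * phi i t) by exact: continuous_scale.
rewrite -!cintZ// ler_distl; apply/andP; split.
  rewrite lerBlDr -cintD//; apply: cint_le => //; first exact: continuous_add.
  by move=> t; have := bd t; rewrite ler_distl lerBlDr => /andP[].
rewrite -cintD//; apply: cint_le => //; first exact: continuous_add.
by move=> t; have := bd t; rewrite ler_distl lerBlDr => /andP[].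
Qed.

(** The density mixes the ratios of the masses that [mu] and [nu] give to the tents
    of a fine grid; both integrals of a listed function are then within [w] of its
    average over the nodes with the masses of [mu]. *)
Lemma density_approximation mu (v w : R) (gs : seq (E -> R)) : I mu = v%:E -> 0 < w ->
    (forall i, (i < size gs)%N -> continuous (nth (fun=> 0) gs i)) ->
  exists h : E -> R, [/\ continuous h, forall t, 0 < h t, (\int[nu]_t h t)%R = 1,
    forall i, (i < size gs)%N ->
      `|(\int[nu]_t (nth (fun=> 0) gs i t * h t))%R - (\int[mu]_t nth (fun=> 0) gs i t)%R|
        <= 2 * w &
    (alpha^-1 - 1) * ln (\int[nu]_t (h t `^ (- gamma)))%R <= v].
Proof.
move=> Iv w0 cgs.
have [N hN] := common_modulus w0 cgs.
pose n := N.+1; have n0 : (0 < n)%N by [].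
pose phi := @tent R n; pose p := @node R n.
have cphi i : continuous (phi i) by exact: continuous_tent.
have phi0 i t : 0 <= phi i t by exact: tent_ge0.
have phi1 t : \sum_(i < n.+1) phi i t = 1 by exact: tent_sum.
have nu0 i : (i < n.+1)%N -> 0 < (\int[nu]_t phi i t)%R.
  move=> iltn; apply: (@full_support_integral_gt0 _ (p i)) => //.
  by rewrite /phi /p tent_node// ltr01.
have mu0 i : (i < n.+1)%N -> 0 < (\int[mu]_t phi i t)%R.
  move=> iltn; apply: (@finite_rate_integral_gt0 mu v _ (p i)) => //.
  by rewrite /phi /p tent_node// ltr01.
pose r i := (\int[mu]_t phi i t)%R / (\int[nu]_t phi i t)%R.
have r0 i : (i < n.+1)%N -> 0 < r i by move=> iltn; rewrite divr_gt0 ?nu0 ?mu0.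
have rE i : (i < n.+1)%N -> (\int[mu]_t phi i t)%R = r i * (\int[nu]_t phi i t)%R.
  by move=> iltn; rewrite /r divfK// gt_eqF// nu0.
have mu1 : \sum_(i < n.+1) (\int[mu]_t phi i t)%R = 1.
  by rewrite -cint_sum// -[RHS](cint_cst mu); apply: eq_Rintegral => t _; rewrite phi1.
exists (fun t => \sum_(i < n.+1) r i * phi i t); split.
- exact: continuous_combination.
- move=> t; rewrite (eq_bigr (fun i : 'I_n.+1 => phi i t * r i)); last by move=> i _; rewrite mulrC.
  exact: (weighted_mean_gt0 (fun i => phi0 i t) (phi1 t) r0).
- by rewrite cint_combination// -mu1; apply: eq_bigr => i _; rewrite -rE.
- move=> j jg; set g := nth _ gs j; have cg : continuous g := cgs j jg.
  have gp i t : (i < n.+1)%N -> phi i t != 0 -> `|g t - g (p i)| <= w.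
    by move=> iltn pn0; apply: hN => //; exact: tent_support.
  have cgp i : continuous (fun t => g t * phi i t) by exact: continuous_mul.
  have -> : (\int[nu]_t (g t * (\sum_(i < n.+1) r i * phi i t)))%R =
      \sum_(i < n.+1) r i * (\int[nu]_t (g t * phi i t))%R.
    transitivity (\int[nu]_t (\sum_(i < n.+1) r i * (g t * phi i t)))%R.
      by apply: eq_Rintegral => t _; rewrite mulr_sumr; apply: eq_bigr => i _; rewrite mulrCA.
    exact: (@cint_combination _ nu n.+1 r (fun i t => g t * phi i t)).
  have -> : (\int[mu]_t g t)%R = \sum_(i < n.+1) (\int[mu]_t (g t * phi i t))%R.
    rewrite -(@cint_sum R mu n.+1 (fun i t => g t * phi i t))//.
    by apply: eq_Rintegral => t _; rewrite -mulr_sumr phi1 mulr1.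
  rewrite -sumrB (le_trans (ler_norm_sum _ _ _))//.
  apply: (@le_trans _ _ (\sum_(i < n.+1) (2 * w) * (\int[mu]_t phi i t)%R)).
    apply: ler_sum => i _.
    have hnu := @integral_partition_approx nu n.+1 phi p g w cphi phi0 cg gp i (ltn_ord i).
    have hmu := @integral_partition_approx mu n.+1 phi p g w cphi phi0 cg gp i (ltn_ord i).
    have {hnu} := ler_wpM2l (ltW (r0 i (ltn_ord i))) hnu.
    rewrite -[X in X * `|_|](ger0_norm (ltW (r0 i (ltn_ord i)))) -normrM mulrBr.
    rewrite mulrCA [X in _ <= X]mulrCA -rE//.
    move: hmu; rewrite !ler_norml => /andP[? ?] /andP[? ?]; lra.
  by rewrite -mulr_sumr mu1 mulr1.
- by have := discretized_rate_le cphi phi0 phi1 r0 rE; rewrite Iv lee_fin.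
Qed.

(** The tilting function [f = h^(- q)] is such that [f^(alpha - 1) = h], so that the
    tilted law concentrates at the measure of density [h], near [mu]. *)
Lemma open_lower_bound (G : set (M1 R E)) : open G ->
  (- ereal_inf (I @` G) <= limf_einf (log_rate Q G) (pinfty_nbhs R))%E.
Proof.
move=> oG; rewrite leeNl; apply: le_ereal_inf_tmp => _ [mu Gmu <-].
rewrite leeNl.
have := rate_function_ge0 nu al01 mu.
case Iv : (I mu) => [v| |] // _; last by rewrite leNye.
apply: le_ereal_approx => c; rewrite -EFinN lte_fin => cv.
pose eta := (- v - c) / 2; have eta0 : 0 < eta by rewrite divr_gt0// subr_gt0.
have [gs [e [e0 Cgs sub]]] := M1_basic_nbhd (open_nbhs_nbhs (conj oG Gmu)).
have cgs i : (i < size gs)%N -> continuous (nth (fun=> 0) gs i) by move=> /Cgs[].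
have w0 : 0 < e / 8 by rewrite divr_gt0.
have [h [ch h0 h1 hgs hv]] := density_approximation Iv w0 cgs.
pose q := (1 - alpha)^-1.
pose f t := h t `^ (- q).
have cf : continuous f by exact: continuous_powRf.
have f0 t : 0 < f t by rewrite powR_gt0.
have fh t : f t `^ (alpha - 1) = h t.
  rewrite /f -powRrM (_ : - q * (alpha - 1) = 1) ?powRr1 ?ltW//.
  by rewrite /q; field; rewrite subr_eq0 gt_eqF.
have fa t : f t `^ alpha = h t `^ (- gamma).
  by rewrite /f -powRrM; congr (_ `^ _); rewrite /q /gamma; ring.
have [b b0 fb] := continuous_bounded cf.
have [b' b'0 fb'] : exists2 b', 0 < b' & forall t, `|h t `^ q| <= b'.
  by apply: continuous_bounded; exact: continuous_powRf.
have fab t : b'^-1 <= f t <= b.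
  apply/andP; split; last by rewrite (le_trans (ler_norm _)).
  by rewrite /f powRN lef_pV2 ?posrE ?powR_gt0// (le_trans (ler_norm _)).
have a0 : 0 < b'^-1 by rewrite invr_gt0.
have A0 : 0 < A f by apply: (moment_ge0_gt0 nu al01 cf a0) => t; case/andP: (fab t).
have AE : A f = (\int[nu]_t (h t `^ (- gamma)))%R by apply: eq_Rintegral => t _; rewrite fa.
(* under the density [h] the mean of [f] is its own moment [A f] *)
pose z := A f * expR (- eta).
have z0 : 0 < z by rewrite mulr_gt0 ?expR_gt0.
have zA : z < A f by rewrite -[ltRHS]mulr1 ltr_pM2l// expR_lt1 oppr_lt0.
pose d := Num.min (e / 4) (A f - z).
have d0 : 0 < d by rewrite lt_min divr_gt0//= subr_gt0.
have de : d <= e / 4 by rewrite ge_min lexx.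
have dz : d <= A f - z by rewrite ge_min lexx orbT.
pose cg g := (\int[nu]_t (g t * h t))%R.
pose center g t := g t - cg g.
(* the first entry controls the tilting density, the others the neighbourhood *)
pose psi := center f :: map center gs.
have ccenter g : continuous g -> continuous (center g).
  by move=> gc; apply: continuous_sub => //; exact: continuous_cst.
have mean_center g : continuous g -> (\int[nu]_t (center g t * f t `^ (alpha - 1)))%R = 0.
  move=> gc; transitivity (\int[nu]_t (g t * h t + - cg g * h t))%R.
    by apply: eq_Rintegral => t _; rewrite fh /center mulrBl mulNr.
  rewrite cintD ?cintZ//; first by rewrite h1 mulr1 subrr.
  - exact: continuous_mul.
  - exact: continuous_scale.
have cgf : cg f = A f by apply: eq_Rintegral => t _; rewrite -fh -powR_pred.
have int_center m g : continuous g -> (\int[m]_t center g t)%R = (\int[m]_t g t)%R - cg g.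
  by move=> gc; rewrite cintD ?cint_cst//; exact: continuous_cst.
have := @tilted_lower_bound f b'^-1 b d z psi G cf a0 fab d0 z0 oG.
move=> /(_ _ _)/wrap[].
- move=> [|i] /= ipsi; first by split; [exact: ccenter|exact: mean_center].
  rewrite size_map ltnS in ipsi; rewrite (nth_map (fun=> 0))//.
  by split; [apply: ccenter|apply: mean_center]; exact: cgs.
- move=> m hm; split.
    have := hm 0%N isT; rewrite /= int_center// cgf ltr_norml => /andP[? _]; lra.
  apply: sub => i ig.
  have := hm i.+1; rewrite /= size_map ltnS ig => /(_ isT).
  rewrite (nth_map (fun=> 0))// int_center; last exact: cgs.
  have := hgs i ig; rewrite -/(cg _) ler_norml => /andP[? ?].
  by rewrite !ltr_norml => /andP[? ?]; apply/andP; split; lra.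
move=> /(le_trans _); apply; rewrite lee_fin /z lnM ?posrE ?expR_gt0// expRK.
move: hv; rewrite -AE.
have : eta = (- v - c) / 2 by [].
rewrite [(_ - 1) * _]mulrBl mul1r; lra.
Qed.

End lower_bound.

Theorem theorem4p7 (R : realType) (alpha : R) (nu : M1 R (unit_interval R))
    (Q : R -> probability (borel (M1 R (unit_interval R))) R) :
  0 < alpha < 1 ->
  diffusive nu ->
  msupport nu = setT ->
  (forall theta : R, 0 < theta -> dirichlet_process_law theta alpha nu (Q theta)) ->
  LDP Q (rate_function alpha nu).
Proof.
move=> al01 _ full lawQ; split.
- exact: rate_function_ge0.
- exact: rate_function_lsc.
- move=> F; exact: (closed_upper_bound al01 lawQ).
- move=> G; exact: (open_lower_bound al01 lawQ full).
Qed.
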